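(* Let $m\ge 2$ and consider Ising lattice gauge theory (gauge group $\mathbb{Z}_2$) on $\mathbb{Z}^m$ at inverse temperature $\beta>0$. For edges $e_1,\dots,e_n\in E$ let $U_n(\sigma(e_1),\dots,\sigma(e_n))$ be the Ursell function of the edge spins. Then the following holds. (a) For any $n\in\mathbb{N}$, there exist $e_1,\dots,e_n\in E$ such that $U_n(\sigma(e_1),\dots,\sigma(e_n))=0$. (b) If $n$ is odd or $n=2$, then for any $e_1,\dots,e_n\in E$ it holds that $U_n(\sigma(e_1),\dots,\sigma(e_n))=0$. (c) If $n\ge 4$ is even, then there exist $e_1,\dots,e_n\in E$ such that $U_n(\sigma(e_1),\dots,\sigma(e_n))>0$. (d) Let $m\ge 3$. If $n\ge 10$ is even and $\beta$ is sufficiently large, then there exist $e_1,\dots,e_n\in E$ such that $U_n(\sigma(e_1),\dots,\sigma(e_n))<0$. Conversely, if $U_n(\sigma(e_1),\dots,\sigma(e_n))<0$, then it must hold that $n\ge 10$. (e) Let $m=2$. If $n\ge 16$ is even and $\beta$ is sufficiently large, then there exist $e_1,\dots,e_n\in E$ such that $U_n(\sigma(e_1),\dots,\sigma(e_n))<0$. Conversely, if $U_n(\sigma(e_1),\dots,\sigma(e_n))<0$, then it must hold that $n\ge 16$.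
   Context: Model. $E$ is the set of directed nearest-neighbour edges of $\mathbb{Z}^m$. For $N\ge1$ let $B_N=[-N,N]^m\cap\mathbb{Z}^m$, let $E(B_N)$ be the directed edges with both endpoints in $B_N$, and let $P(B_N)$ be the set of oriented plaquettes (unit lattice squares, each with both of its orientations) whose four boundary edges lie in $E(B_N)$. A 1-form (gauge field configuration) is a function $\sigma:E(B_N)\to\mathbb{Z}_2$ with $\sigma(-e)=-\sigma(e)$; the set of these is $\Omega_1(B_N,\mathbb{Z}_2)$. For $p\in P(B_N)$ put $d\sigma(p)=\sum_{e\in\partial p}\sigma(e)\in\mathbb{Z}_2$, the sum being over the four oriented boundary edges of $p$. Let $\rho:\mathbb{Z}_2\to\{1,-1\}$, $\rho(0)=1$, $\rho(1)=-1$. The lattice gauge theory measure is $$\mu_{\beta,N}(\sigma)=\frac{1}{Z_{\beta,N}}\exp\Big(\beta\sum_{p\in P(B_N)}\rho(d\sigma(p))\Big),\qquad \sigma\in\Omega_1(B_N,\mathbb{Z}_2),$$ where $Z_{\beta,N}$ is the normalizing constant, with expectation $\mathbb{E}_{N,\beta}$. The infinite volume expectation is $\mathbb{E}=\mathbb{E}_\beta=\lim_{N\to\infty}\mathbb{E}_{N,\beta}$; for products of edge spins this limit exists (Ginibre inequalities). Edge spins. Inside $U_n$ the symbol $\sigma(e)$ stands for the $\pm1$-valued spin $\rho(\sigma(e))$. Ursell function. Let $\mathfrak{F}_n$ be the set of partitions of $[n]=\{1,\dots,n\}$ into nonempty blocks, and $|\mathfrak{P}|$ the number of blocks of $\mathfrak{P}$.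 For random variables $X_1,\dots,X_n$, $$U_n(X_1,\dots,X_n)=\sum_{\mathfrak{P}\in\mathfrak{F}_n}(-1)^{|\mathfrak{P}|-1}(|\mathfrak{P}|-1)!\prod_{P\in\mathfrak{P}}\mathbb{E}\Big[\prod_{i\in P}X_i\Big].$$
   Formalization: The edges are taken pairwise distinct up to orientation in (b) for n=2 and in the converses of (d) and (e), since with repeated edges U_2(σ(e),σ(e))=1 and U_4(σ(e),σ(e),σ(e),σ(e))=-2; the edges found in (a), (c), (d), (e) are distinct too. *)

(* Defs.v *)
From HB Require Import structures.
From mathcomp Require Import all_boot all_order all_algebra finmap.
From mathcomp Require Import all_classical all_reals all_analysis.

Set Implicit Arguments.
Unset Strict Implicit.
Unset Printing Implicit Defensive.

Import Order.TTheory GRing.Theory Num.Theory.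
Import numFieldNormedType.Exports.
Local Open Scope fset_scope.
Local Open Scope ring_scope.

Section Lattice.
Variable m : nat.

Definition site := 'rV[int]_m.

Definition dir (i : 'I_m) : site := delta_mx ord0 i.

(* A directed edge is the pair (tail, head). *)
Definition nn (e : site * site) : bool :=
  \sum_(i < m) `|(e.2 - e.1) ord0 i| == 1.

Definition rev_edge (e : site * site) : site * site := (e.2, e.1).

Definition box (N : nat) : {fset site} :=
  [fset (\row_i ((k i)%:Z - N%:Z) : site)
  | k : {ffun 'I_m -> 'I_(2 * N).+1} in {: {ffun 'I_m -> 'I_(2 * N).+1}}].

Lemma in_box N (x : site) :
  (x \in box N) = [forall i, (`|x ord0 i| <= N%:Z)].
Proof.
apply/imfsetP/forallP => /= [[k _ ->] i|xN].
  rewrite mxE ler_norml lerBrDr addNr lez_nat leq0n /= lerBlDr -PoszD lez_nat.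
  by rewrite addnn -mul2n -ltnS.
exists [ffun i => inord (absz (x ord0 i + N%:Z))] => //.
apply/rowP => i; rewrite mxE ffunE.
have /[!ler_norml] /andP[Nx xN'] := xN i.
have x0 : 0 <= x ord0 i + N%:Z by rewrite -lerBlDr sub0r.
rewrite inordK ?gez0_abs ?addrK// ltnS -lez_nat gez0_abs//.
by rewrite mul2n -addnn PoszD lerD2r.
Qed.

Definition boxE (N : nat) : {fset site * site} :=
  [fset e in box N `*` box N | nn e].

Lemma in_boxE N (e : site * site) :
  (e \in boxE N) = [&& e.1 \in box N, e.2 \in box N & nn e].
Proof. by rewrite !inE andbA. Qed.

(* (x, (i, j)) with i != j is the unit square with corners x, x + e_i,
   x + e_i + e_j, x + e_j, oriented in this order; (x, (j, i)) is the same
   square with the opposite orientation. *)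
Definition plaq := (site * ('I_m * 'I_m))%type.

Definition is_plaq (p : plaq) : bool := p.2.1 != p.2.2.

Definition boundary (p : plaq) : seq (site * site) :=
  let: (x, (i, j)) := p in
  [:: (x, x + dir i);
      (x + dir i, x + dir i + dir j);
      (x + dir i + dir j, x + dir j);
      (x + dir j, x)].

Definition boxP (N : nat) : {fset plaq} :=
  [fset p in box N `*` [fset ij : 'I_m * 'I_m in {: 'I_m * 'I_m}]
  | is_plaq p && all (fun e => e \in boxE N) (boundary p)].

Lemma in_boxP N (p : plaq) :
  (p \in boxP N) = is_plaq p && all (fun e => e \in boxE N) (boundary p).
Proof.
rewrite !inE /= andbC; case: (boolP (is_plaq p)) => //= _.
case: p => x [i j] /=; rewrite !inE /=.
by case: (x \in box N); rewrite /= ?andbF ?andbT.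
Qed.

Definition gauge_field (N : nat) := {ffun boxE N -> 'Z_2}.

(* The value 0 is used outside E(B_N); a given edge lies in E(B_N) for all
   large N, so this choice does not affect limits as N grows. *)
Definition at_edge N (s : gauge_field N) (e : site * site) : 'Z_2 :=
  oapp s 0 (insub e).

Definition Omega1 (N : nat) : {set gauge_field N} :=
  [set s : gauge_field N |
    [forall e : boxE N, at_edge s (rev_edge (val e)) == - at_edge s (val e)]].

Definition dfield N (s : gauge_field N) (p : plaq) : 'Z_2 :=
  \sum_(e <- boundary p) at_edge s e.

End Lattice.

Section Measure.
Variables (R : realType) (m : nat).

Definition rho (g : 'Z_2) : R := if g == 0 then 1 else -1.

Definition spin (e : site m * site m) N (s : gauge_field m N) : R :=
  rho (at_edge s e).

Definition weight (beta : R) N (s : gauge_field m N) : R :=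
  expR (beta * \sum_(p <- boxP m N) rho (dfield s p)).

Definition Zpart (beta : R) (N : nat) : R :=
  \sum_(s in Omega1 m N) weight beta s.

Definition mu (beta : R) N (s : gauge_field m N) : R :=
  weight beta s / Zpart beta N.

Definition expectN (beta : R) N (f : gauge_field m N -> R) : R :=
  \sum_(s in Omega1 m N) f s * mu beta s.

(* A random variable of the infinite volume theory is given by its
   representatives in the boxes B_N. *)
Definition observable := forall N, gauge_field m N -> R.

Definition expect (beta : R) (f : observable) : R :=
  limn (fun N => expectN beta (f N)).

Definition ursell (beta : R) n (X : 'I_n -> observable) : R :=
  \sum_(P : {set {set 'I_n}} | finset.partition P [set: 'I_n]%SET)
    (-1) ^+ (#|P| - 1) * ((#|P| - 1)`!)%:R *
    \prod_(B in P) expect beta (fun N s => \prod_(i in B) X i N s).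

Definition ursell_spins (beta : R) n (e : 'I_n -> site m * site m) : R :=
  ursell beta (fun i => spin (e i)).

End Measure.

Definition edges m n (e : 'I_n -> site m * site m) : Prop :=
  forall i, nn (e i).

(* Distinct as undirected edges: over Z_2 the spins at e and -e coincide. *)
Definition distinct_edges m n (e : 'I_n -> site m * site m) : Prop :=
  edges e /\
  forall i j, i != j -> e i != e j /\ e i != rev_edge (e j).

(* Main.v *)
(* The spins at the edges of a set [A] have nonzero joint mean only if [A] is
   even, i.e. every vertex has even degree in [A]. By the Griffiths inequalities
   these means are nonnegative, supermultiplicative and monotone in the volume.
   If the even subsets of [{1..n}] are stable under intersection they form a
   Boolean algebra with at most [n / 4] atoms, as nonempty even sets have at
   least 4 edges; with one or two atoms the Ursell function is nonnegative by
   supermultiplicativity, and with three atoms in the plane it is so by the exact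
   formula [E (loop) = t ^ area]. Stability can only fail if four disjoint
   nonempty parts [A :&: B], [A :\: B], [B :\: A], [~: (A :|: B)] have the same
   odd vertices, which costs at least 10 edges, and 16 edges in the plane.
   Conversely, if the edges form four disjoint paths with common endpoints, there
   are no three disjoint nonempty even sets but three ways of splitting into two,
   so the Ursell function is close to [1 - 3] at low temperature. *)

(* A plaquette with spin [r] has weight proportional to [1 + t * r], where [t = tanh (2 beta)], so a
   mean is a ratio of polynomials in [t] with nonnegative coefficients. This makes a low-temperature
   expansion unnecessary: a rectangular loop has mean at least [t ^ area], and [t] tends to 1. For
   [n <= 9] there is no room for three disjoint nonempty even sets, and stability under intersection
   is the whole matter. In the plane such triples do occur for [n] from 12 on, and the three
   negative two-block terms must be compared with the one-block and three-block terms. What decides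
   this is that one of the three sets has at most 5 edges: if it bounds a region at all, it is a
   single square and only contributes a factor [t]. The bounds 10 and 16 are attained by four paths
   between adjacent sites: lengths 1, 3, 3, 3 in space, and 1, 3, 3, 9 in the plane, where the
   longest path has to go around one of the squares. One path of length 3 is then lengthened by two
   edges at a time to reach every even [n]. *)
Require Import Defs.
From HB Require Import structures.
From mathcomp Require Import all_boot all_order all_algebra finmap.
From mathcomp Require Import all_classical all_reals all_analysis.
From mathcomp Require Import zify ring lra fintype finset finmap.

Set Implicit Arguments.
Unset Strict Implicit.
Unset Printing Implicit Defensive.

Import Order.TTheory GRing.Theory Num.Theory.
Import numFieldNormedType.Exports.
Local Open Scope ring_scope.

(** * Griffiths inequalities for characters *)

Section Characters.
Variables (R : realFieldType) (I : finType).
Notation T := {ffun I -> 'Z_2}.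

Definition ischar (chi : T -> R) : Prop :=
  (forall x y, chi (x + y) = chi x * chi y) /\
  (forall x, chi x = 1 \/ chi x = -1).

Lemma ischar_sq chi x : ischar chi -> chi x * chi x = 1.
Proof. by case=> _ /(_ x) [] ->; rewrite ?mulrNN mulr1. Qed.

Lemma ischar_le1 chi x : ischar chi -> chi x <= 1.
Proof. by case=> _ /(_ x) [] -> //; lra. Qed.

Lemma ischar_ge chi x : ischar chi -> -1 <= chi x.
Proof. by case=> _ /(_ x) [] -> //; lra. Qed.

Lemma ischar1 : ischar (fun=> 1).
Proof. by split=> [x y|x]; [rewrite mulr1|left]. Qed.

Lemma ischarM chi psi :
  ischar chi -> ischar psi -> ischar (fun s => chi s * psi s).
Proof.
move=> [cM c1] [pM p1]; split=> [x y|x].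
  by rewrite cM pM mulrACA.
by case: (c1 x) => ->; case: (p1 x) => ->;
  rewrite ?mulrNN ?mulr1 ?mul1r ?mulrN1; auto.
Qed.

Lemma ffunZ2_addKr (x y : T) : x + (x + y) = y.
Proof.
rewrite addrA -[RHS]add0r; congr (_ + _); apply/ffunP=> i.
rewrite !ffunE; apply/val_inj => /=.
by case: (x i) => [[|[]]].
Qed.

Variables (G : {set T}).
Hypothesis G0 : 0 \in G.
Hypothesis GD : forall x y, x \in G -> y \in G -> x + y \in G.

Lemma sum_shift (F : T -> R) (x : T) :
  x \in G -> \sum_(s in G) F (x + s) = \sum_(s in G) F s.
Proof.
move=> xG; rewrite [RHS](reindex_inj (@addrI _ x)) /=.
apply: eq_bigl => s; apply/idP/idP => [|xsG]; first exact: GD.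
by rewrite -(ffunZ2_addKr x s) GD.
Qed.

Lemma sum_char_eq0 chi x :
  ischar chi -> x \in G -> chi x = -1 -> \sum_(s in G) chi s = 0.
Proof.
move=> [cM _] xG cx; suff: \sum_(s in G) chi s = - \sum_(s in G) chi s by lra.
rewrite -{1}(sum_shift _ xG) -sumrN; apply: eq_bigr => s _.
by rewrite cM cx mulN1r.
Qed.

Lemma sum_char_trivial chi : (forall s, s \in G -> chi s = 1) ->
  \sum_(s in G) chi s = #|G|%:R :> R.
Proof. by move=> c1; rewrite (eq_bigr (fun=> 1)) // sumr_const. Qed.

Lemma sum_char_cases chi : ischar chi ->
  (forall s, s \in G -> chi s = 1) \/ exists2 s, s \in G & chi s = -1.
Proof.
move=> cc; case: (boolP [exists s in G, chi s == -1]) => [|].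
  by case/exists_inP => s sG /eqP; right; exists s.
rewrite negb_exists_in => /forall_inP cN; left=> s sG.
by case: (cc.2 s) (cN s sG) => // ->; rewrite eqxx.
Qed.

Lemma sum_char_ge0 chi : ischar chi -> 0 <= \sum_(s in G) chi s.
Proof.
move=> cc; have [/sum_char_trivial ->|[x xG cx]] := sum_char_cases cc.
  exact: ler0n.
by rewrite (sum_char_eq0 cc xG cx).
Qed.

Variables (J : choiceType) (b : J -> T -> R).
Hypothesis bch : forall j, ischar (b j).

(** Expanding the product gives nonnegative multiples of characters, and each character has a
    nonnegative sum over [G]. The coefficients are general because in [griffiths2] they depend on
    the second copy of the field. *)
Lemma griffiths1_gen (c d : J -> R) (L : seq J) chi :
  (forall j, 0 <= c j) -> (forall j, 0 <= d j) -> ischar chi ->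
  0 <= \sum_(s in G) chi s * \prod_(j <- L) (c j + d j * b j s).
Proof.
move=> c0 d0; elim: L chi => [|j L IH] chi cc.
  rewrite (eq_bigr chi) ?(sum_char_ge0 cc) // => s _.
  by rewrite big_nil mulr1.
rewrite (eq_bigr (fun s => c j * (chi s * \prod_(j <- L) (c j + d j * b j s)) +
   d j * (chi s * b j s * \prod_(j <- L) (c j + d j * b j s)))); last first.
  by move=> s _; rewrite big_cons; ring.
rewrite big_split /= -!mulr_sumr addr_ge0 ?mulr_ge0 //; first exact: IH.
exact: (IH (fun s => chi s * b j s) (ischarM cc (bch j))).
Qed.

Variable t : R.
Hypothesis t01 : 0 <= t <= 1.

Let t0 : 0 <= t. Proof. by case/andP: t01. Qed.
Let t1 : t <= 1. Proof. by case/andP: t01. Qed.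

Definition gibbs_wt (L : seq J) (s : T) : R := \prod_(j <- L) (1 + t * b j s).

Definition gibbs_sum (L : seq J) (chi : T -> R) : R :=
  \sum_(s in G) chi s * gibbs_wt L s.

Lemma gibbs_wt_ge0 L s : 0 <= gibbs_wt L s.
Proof.
apply: prodr_ge0 => j _; have := ischar_ge s (bch j).
have := t01 => /andP[? ?] ?; nra.
Qed.

Lemma gibbs_sum_ge0 L chi : ischar chi -> 0 <= gibbs_sum L chi.
Proof. exact: (griffiths1_gen (c := fun=> 1) (d := fun=> t)). Qed.

Lemma eq_gibbs_sum L chi psi : (forall s, s \in G -> chi s = psi s) ->
  gibbs_sum L chi = gibbs_sum L psi.
Proof. by move=> e; apply: eq_bigr => s sG; rewrite e. Qed.

Lemma gibbs_sum_cons j L chi :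
  gibbs_sum (j :: L) chi =
  gibbs_sum L chi + t * gibbs_sum L (fun s => chi s * b j s).
Proof.
rewrite /gibbs_sum mulr_sumr -big_split /=; apply: eq_bigr => s _.
by rewrite /gibbs_wt big_cons; ring.
Qed.

Lemma gibbs_sum_perm L L' chi :
  perm_eq L L' -> gibbs_sum L chi = gibbs_sum L' chi.
Proof.
by move=> LL'; apply: eq_bigr => s _; rewrite /gibbs_wt (perm_big _ LL').
Qed.

Lemma gibbs_sum_le1 L chi : ischar chi -> gibbs_sum L chi <= gibbs_sum L (fun=> 1).
Proof.
move=> cc; apply: ler_sum => s _.
by rewrite ler_wpM2r ?gibbs_wt_ge0 ?ischar_le1.
Qed.

(** Adding bonds to the empty list only increases the sum. This keeps the normalisation positive
    even at [t = 1], where single weights may vanish. *)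
Lemma gibbs_sum_ge_card L : #|G|%:R <= gibbs_sum L (fun=> 1).
Proof.
elim: L => [|j L IH].
  by rewrite /gibbs_sum sum_char_trivial // => s _; rewrite /gibbs_wt big_nil mulr1.
rewrite gibbs_sum_cons (le_trans IH) // lerDl mulr_ge0 ?gibbs_sum_ge0 //.
exact: ischarM ischar1 (bch j).
Qed.

Lemma gibbs_sum_gt0 L : 0 < gibbs_sum L (fun=> 1).
Proof.
apply: lt_le_trans (gibbs_sum_ge_card L); rewrite ltr0n card_gt0.
by apply/set0Pn; exists 0.
Qed.

(* The duplicate-variable trick: with [s' = s + u], the difference is a sum over
   [u] of [1 - psi u >= 0] times a ferromagnetic sum over [s]. *)
Lemma griffiths2 L chi psi : ischar chi -> ischar psi ->
  gibbs_sum L chi * gibbs_sum L psi <=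
  gibbs_sum L (fun s => chi s * psi s) * gibbs_sum L (fun=> 1).
Proof.
move=> cc pp; rewrite -subr_ge0.
pose F s u := chi s * psi s * (1 - psi u) * gibbs_wt L s * gibbs_wt L (u + s).
have -> : gibbs_sum L (fun s => chi s * psi s) * gibbs_sum L (fun=> 1) -
    gibbs_sum L chi * gibbs_sum L psi = \sum_(u in G) \sum_(s in G) F s u.
  rewrite exchange_big /gibbs_sum !big_distrl -sumrB /=; apply: eq_bigr => s sG.
  rewrite !big_distrr /= -sumrB -(sum_shift _ sG) /=; apply: eq_bigr => u uG.
  rewrite /F [u + s]addrC pp.1 mul1r.
  ring.
apply: sumr_ge0 => u uG.
(* Since [b j s] squares to 1, the product of the factors at [s] and [u + s] is again affine in
   [b j s], with nonnegative coefficients depending on [u]. *)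
rewrite (eq_bigr (fun s => (1 - psi u) * (chi s * psi s *
  \prod_(j <- L) ((1 + t ^+ 2 * b j u) + (t * (1 + b j u)) * b j s)))).
  rewrite -mulr_sumr mulr_ge0 ?subr_ge0 ?ischar_le1 //.
  apply: (griffiths1_gen (c := fun j => 1 + t ^+ 2 * b j u)
    (d := fun j => t * (1 + b j u))) => [j|j|].
  - have := ischar_ge u (bch j); have : t ^+ 2 <= 1 by rewrite expr_le1.
    have : 0 <= t ^+ 2 by rewrite exprn_ge0. nra.
  - rewrite mulr_ge0 //; have := ischar_ge u (bch j); lra.
  - exact: ischarM.
move=> s _; rewrite /F /gibbs_wt.
have -> : \prod_(j <- L) ((1 + t ^+ 2 * b j u) + (t * (1 + b j u)) * b j s) =
   \prod_(j <- L) (1 + t * b j s) * \prod_(j <- L) (1 + t * b j (u + s)).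
  rewrite -big_split /=; apply: eq_bigr => j _; rewrite (bch j).1.
  have := ischar_sq s (bch j) => bb.
  transitivity (1 + t * b j s + t * (b j u * b j s) +
    t ^+ 2 * b j u * (b j s * b j s)); last by ring.
  by rewrite bb; ring.
ring.
Qed.

(** This is [griffiths2] for [chi] and [b j], cleared of denominators: a further bond does not lower
    a mean. *)
Lemma gibbs_sum_add j L chi : ischar chi ->
  gibbs_sum L chi * gibbs_sum (j :: L) (fun=> 1) <=
  gibbs_sum (j :: L) chi * gibbs_sum L (fun=> 1).
Proof.
move=> cc; rewrite !gibbs_sum_cons.
have := griffiths2 L cc (bch j).
have -> : gibbs_sum L (fun s => 1 * b j s) = gibbs_sum L (b j).
  by apply: eq_gibbs_sum => s _; rewrite mul1r.
move: (gibbs_sum _ _) (gibbs_sum _ _) (gibbs_sum _ _) (gibbs_sum _ _) => x y z w.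
by have := t0; nra.
Qed.

Lemma gibbs_mean_cat L L' chi : ischar chi ->
  gibbs_sum L chi / gibbs_sum L (fun=> 1) <=
  gibbs_sum (L' ++ L) chi / gibbs_sum (L' ++ L) (fun=> 1).
Proof.
move=> cc; elim: L' => [|j L' IH] //=; apply: (le_trans IH).
rewrite ler_pdivrMr ?gibbs_sum_gt0 // mulrAC ler_pdivlMr ?gibbs_sum_gt0 //.
exact: gibbs_sum_add.
Qed.

(** Take [j] out and let [x], [z] be the remaining sums of [b j] and of 1. The mean is
    [(x + t z) / (z + t x)], which is at least [t] because [x >= 0] and [t ^ 2 <= 1]. *)
Lemma gibbs_mean_bond j L : j \in L ->
  t <= gibbs_sum L (b j) / gibbs_sum L (fun=> 1).
Proof.
move=> jL; rewrite ler_pdivlMr ?gibbs_sum_gt0 // !(gibbs_sum_perm _ (perm_to_rem jL)).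
rewrite !gibbs_sum_cons.
have -> : gibbs_sum (rem j L) (fun s => b j s * b j s) =
    gibbs_sum (rem j L) (fun=> 1).
  by apply: eq_gibbs_sum => s _; rewrite ischar_sq.
have -> : gibbs_sum (rem j L) (fun s => 1 * b j s) = gibbs_sum (rem j L) (b j).
  by apply: eq_gibbs_sum => s _; rewrite mul1r.
have := gibbs_sum_ge0 (rem j L) (bch j).
have : t ^+ 2 <= 1 by rewrite expr_le1.
move: (gibbs_sum _ _) (gibbs_sum _ _) => x y tt x0.
by rewrite mulrDr mulrA -expr2; nra.
Qed.

(* High-temperature expansion: a nonzero correlation forces [chi] to be a
   product of bond characters. *)
Lemma gibbs_sum_neq0 L chi : ischar chi -> gibbs_sum L chi != 0 ->
  exists2 Q, subseq Q L &
    forall s, s \in G -> chi s = \prod_(j <- Q) b j s.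
Proof.
elim: L chi => [|j L IH] chi cc.
  have [c1 _|[x xG cx]] := sum_char_cases cc.
    by exists [::] => // s sG; rewrite big_nil c1.
  rewrite /gibbs_sum (eq_bigr chi) ?(sum_char_eq0 cc xG cx) ?eqxx // => s _.
  by rewrite /gibbs_wt big_nil mulr1.
rewrite gibbs_sum_cons; have [e|/(IH _ cc) [Q QL h] _] := eqVneq (gibbs_sum L chi) 0.
  rewrite e add0r mulf_eq0 negb_or => /andP[_ /(IH _ (ischarM cc (bch j)))].
  case=> Q QL h; exists (j :: Q) => /= [|s sG]; first by rewrite eqxx.
  by rewrite big_cons -h // mulrCA ischar_sq ?mulr1.
by exists Q => //; apply: subseq_trans QL (subseq_cons _ _).
Qed.

(* If the bond characters are independent, the expansion of a product of
   bonds has a single term. *)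
Lemma gibbs_sum_indep (X : {fset J}) L : uniq L ->
  (forall Y : {fset J}, Y != fset0 ->
     (forall j, j \in Y -> (j \in L) || (j \in X)) ->
     exists2 s, s \in G & \prod_(j <- Y) b j s = -1) ->
  gibbs_sum L (fun s => \prod_(j <- X) b j s) =
    if all (mem L) X then t ^+ #|` X| * #|G|%:R else 0.
Proof.
have pc (X' : {fset J}) : ischar (fun s => \prod_(j <- X') b j s).
  elim: (enum_fset X') => [|j s IH].
    by under eq_fun do rewrite big_nil; exact: ischar1.
  by under eq_fun do rewrite big_cons; apply: ischarM.
elim: L X => [|j L IH] X /=.
  move=> _ ind; rewrite /gibbs_sum (eq_bigr (fun s => \prod_(j <- X) b j s)); last first.
    by move=> s _; rewrite /gibbs_wt big_nil mulr1.
  have [->|X0] := eqVneq X fset0.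
    rewrite sum_char_trivial => [|s _]; last by rewrite big_seq_fset0.
    by rewrite cardfs0 expr0 mul1r.
  have [|s sG bs] := ind X X0; first by [].
  rewrite (sum_char_eq0 (pc X) sG bs); case: ifP => // /allP a.
  by case/fset0Pn: X0 => j /a.
move=> /andP[jL uL] ind; rewrite gibbs_sum_cons.
have IHX (X' : {fset J}) : (forall k, k \in X' -> (k == j) || (k \in X)) ->
    gibbs_sum L (fun s => \prod_(j <- X') b j s) =
    if all (mem L) X' then t ^+ #|` X'| * #|G|%:R else 0.
  move=> X'X; apply: IH => // Y Y0 YX; apply: ind => // k /YX /orP[kL|/X'X].
    by rewrite inE kL orbT.
  by rewrite inE => /orP[->|->]; rewrite // orbT.
rewrite IHX; last by move=> k ->; rewrite orbT.
(* Of the two terms of the expansion at [j] only one can survive: the one multiplied by [b j] if [j]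
   is in [X], where the two copies cancel, and the other one if not. *)
have [jX|jX] := boolP (j \in X).
  have -> : all (mem L) X = false.
    by apply/negbTE/negP => /allP /(_ j jX) /=; apply/negP.
  have -> : gibbs_sum L (fun s => \prod_(k <- X) b k s * b j s) =
            gibbs_sum L (fun s => \prod_(k <- (X `\ j)%fset) b k s).
    apply: eq_gibbs_sum => s _; rewrite (big_fsetD1 j) //= mulrAC ischar_sq // mul1r.
    by [].
  rewrite IHX => [|k]; last by rewrite !inE => /andP[_ ->]; rewrite orbT.
  have -> : all (mem L) (X `\ j)%fset = all (mem (j :: L)) X.
    apply/allP/allP => h k.
      move=> kX; have [->|kj] := eqVneq k j; first by rewrite /= inE eqxx.
      by rewrite /= inE (negbTE kj) /=; apply: h; rewrite !inE kj.
    by rewrite !inE => /andP[kj /h]; rewrite /= inE (negbTE kj).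
  rewrite add0r (cardfsD1 j X) jX.
  by case: ifP => _; rewrite ?mulr0 // add1n exprS mulrA.
have -> : gibbs_sum L (fun s => \prod_(k <- X) b k s * b j s) =
          gibbs_sum L (fun s => \prod_(k <- (j |` X)%fset) b k s).
  by apply: eq_gibbs_sum => s _; rewrite big_fsetU1 //= mulrC.
rewrite (IHX (j |` X)%fset) => [|k]; last by rewrite !inE.
have -> : all (mem L) (j |` X)%fset = false.
  by apply/negbTE/negP => /allP /(_ j); rewrite !inE eqxx /= (negbTE jL) => /(_ isT).
rewrite mulr0 addr0; congr (if _ then _ else _).
apply: eq_in_all => k kX /=; rewrite inE; case: eqVneq => // kj.
by rewrite kj (negbTE jL) -kj kX in jX *.
Qed.

End Characters.

(** * Wilson loops in infinite volume *)

Section Spins.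
Variables (R : realType) (m : nat).
Notation edge := (site m * site m)%type.

Definition chi N (s : seq edge) (f : gauge_field m N) : R :=
  \prod_(e <- s) spin R e f.

Lemma Z2_cases (g : 'Z_2) : g = 0 \/ g = 1.
Proof. by case: g => [[|[|//]] i]; [left|right]; apply: val_inj. Qed.

Lemma Z2_opp (g : 'Z_2) : - g = g.
Proof. by case: (Z2_cases g) => ->; apply: val_inj. Qed.

Lemma rhoD (g h : 'Z_2) : rho R (g + h) = rho R g * rho R h.
Proof.
by case: (Z2_cases g) => ->; case: (Z2_cases h) => ->;
  rewrite /rho ?addr0 ?add0r ?mulr1 ?mul1r //= mulrNN mulr1.
Qed.

Lemma rho_sum T (s : seq T) (F : T -> 'Z_2) :
  rho R (\sum_(x <- s) F x) = \prod_(x <- s) rho R (F x).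
Proof.
by elim: s => [|x s IH]; rewrite ?big_nil ?big_cons ?rhoD ?IH // /rho eqxx.
Qed.

Lemma at_edgeD N (f g : gauge_field m N) e :
  at_edge (f + g) e = at_edge f e + at_edge g e.
Proof.
by rewrite /at_edge; case: insub => [u|] /=; rewrite ?ffunE ?addr0.
Qed.

Lemma spin_char N (e : edge) : ischar (spin R e (N := N)).
Proof.
split=> [f g|f]; rewrite /spin ?at_edgeD ?rhoD //.
by rewrite /rho; case: ifP; auto.
Qed.

Lemma chi_char N s : ischar (@chi N s).
Proof.
elim: s => [|e s IH]; rewrite /chi.
  by under eq_fun do rewrite big_nil; exact: ischar1.
under eq_fun do rewrite big_cons; exact: ischarM (spin_char _ _) IH.
Qed.

Lemma chi_cat N s s' (f : gauge_field m N) :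
  chi (s ++ s') f = chi s f * chi s' f.
Proof. by rewrite /chi big_cat. Qed.

Lemma at_edge_out N (f : gauge_field m N) e : e \notin boxE m N -> at_edge f e = 0.
Proof. by move=> eN; rewrite /at_edge insubN. Qed.

Lemma at_edgeE N (F : edge -> 'Z_2) e :
  at_edge ([ffun e => F (val e)] : gauge_field m N) e =
  if e \in boxE m N then F e else 0.
Proof.
by rewrite /at_edge; case: insubP => [u -> <-|/negbTE ->] //=; rewrite ffunE.
Qed.

Lemma nn_rev (e : edge) : nn (rev_edge e) = nn e.
Proof.
rewrite /nn /=; congr (_ == _); apply: eq_bigr => i _.
by rewrite -opprB mxE normrN.
Qed.

Lemma boxE_rev N (e : edge) : (rev_edge e \in boxE m N) = (e \in boxE m N).
Proof. by rewrite !in_boxE nn_rev andbCA. Qed.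

(** As [- g = g] in Z_2, antisymmetry says that the field is a function of undirected edges. *)
Lemma Omega1P N (f : gauge_field m N) :
  reflect (forall e, at_edge f (rev_edge e) = at_edge f e) (f \in Omega1 m N).
Proof.
apply: (iffP idP) => [|h].
  rewrite inE => /forallP h e; have [eN|eN] := boolP (e \in boxE m N).
    by have /eqP := h [` eN]%fset; rewrite Z2_opp.
  by rewrite !at_edge_out ?boxE_rev.
by rewrite inE; apply/forallP => e; rewrite h Z2_opp.
Qed.

Lemma at_edge0 N e : at_edge (0 : gauge_field m N) e = 0.
Proof. by rewrite /at_edge; case: insub => //= u; rewrite ffunE. Qed.

Lemma Omega1_0 N : 0 \in Omega1 m N.
Proof. by apply/Omega1P => e; rewrite !at_edge0. Qed.

Lemma Omega1D N (f g : gauge_field m N) :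
  f \in Omega1 m N -> g \in Omega1 m N -> f + g \in Omega1 m N.
Proof.
by move=> /Omega1P hf /Omega1P hg; apply/Omega1P => e; rewrite !at_edgeD hf hg.
Qed.

Definition plaq_rev (p : plaq m) : plaq m := (p.1, (p.2.2, p.2.1)).

Lemma chi_plaq_rev N p (f : gauge_field m N) : f \in Omega1 m N ->
  chi (boundary (plaq_rev p)) f = chi (boundary p) f.
Proof.
case: p => x [i j] /Omega1P h; rewrite /chi /= !big_cons !big_nil /spin.
rewrite -[at_edge f (x, x + dir j)]h /rev_edge /=.
rewrite -[at_edge f (x + dir j, x + dir j + dir i)]h /rev_edge /=.
rewrite -[at_edge f (x + dir j + dir i, x + dir i)]h /rev_edge /=.
rewrite -[at_edge f (x + dir i, x)]h /rev_edge /=.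
rewrite [x + dir j + dir i]addrAC; ring.
Qed.

Lemma rho_dfield N (f : gauge_field m N) p : rho R (dfield f p) = chi (boundary p) f.
Proof. by rewrite /dfield rho_sum. Qed.

(** One orientation of each square. Both orientations carry the same spin by [chi_plaq_rev], which
    is why the coupling becomes [2 * beta]. *)
Definition posP N : seq (plaq m) := [seq p : plaq m <- boxP m N | (p.2.1 < p.2.2)%N].

Lemma mem_posP N p : (p \in posP N) =
  (p.2.1 < p.2.2)%N && all (fun e => e \in boxE m N) (boundary p).
Proof.
rewrite mem_filter in_boxP /is_plaq; case: ltnP => //= lt.
by rewrite -val_eqE neq_ltn lt.
Qed.

Lemma boxP_rev N p : (plaq_rev p \in boxP m N) = (p \in boxP m N).
Proof.
rewrite !in_boxP; congr (_ && _); first by rewrite /is_plaq eq_sym.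
case: p => x [i j] /=; rewrite !andbT.
rewrite -(boxE_rev N (x, x + dir j)) -(boxE_rev N (x + dir j, x + dir j + dir i)).
rewrite -(boxE_rev N (x + dir j + dir i, x + dir i)) -(boxE_rev N (x + dir i, x)).
rewrite /rev_edge /=.
rewrite [x + dir j + dir i]addrAC.
by do 4!case: (_ \in _).
Qed.

Lemma sum_boxP N (F : plaq m -> R) : (forall p, F (plaq_rev p) = F p) ->
  \sum_(p <- boxP m N) F p = 2 * \sum_(p <- posP N) F p.
Proof.
move=> FE; rewrite (bigID (fun p : plaq m => (p.2.1 < p.2.2)%N)) /= -big_filter.
rewrite -/(posP N) mulrDl mul1r; congr (_ + _).
rewrite -[RHS](eq_bigr _ (fun p _ => FE p)) -(big_map plaq_rev xpredT F).
rewrite big_seq_cond -big_filter; apply: perm_big.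
have rK : involutive plaq_rev by case=> ? [].
apply: uniq_perm.
- by rewrite filter_uniq // fset_uniq.
- rewrite map_inj_uniq ?filter_uniq ?fset_uniq //; exact: inv_inj.
move=> p; rewrite -{2}[p]rK (mem_map (inv_inj rK)) !mem_filter boxP_rev /=.
case: (boolP (p \in boxP m N)) => pN; rewrite ?andbF ?andbT //.
move: pN; rewrite in_boxP /is_plaq -val_eqE /= => /andP[pn _].
by rewrite -leqNgt leq_eqVlt eq_sym (negbTE pn).
Qed.

Variable beta : R.
Hypothesis beta0 : 0 < beta.

(* [exp (2 beta r) = c (1 + t r)] for [r = 1] and [r = -1], where
   [t = tanh (2 beta)] *)
Definition tnh : R :=
  (expR (2 * beta) - expR (- (2 * beta))) / (expR (2 * beta) + expR (- (2 * beta))).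

Let wc : R := (expR (2 * beta) + expR (- (2 * beta))) / 2.

Lemma tnh_gt0 : 0 < tnh.
Proof.
apply: divr_gt0; last by rewrite addr_gt0 ?expR_gt0.
rewrite subr_gt0 ltr_expR.
by have := beta0; lra.
Qed.

Lemma tnh_lt1 : tnh < 1.
Proof.
rewrite /tnh ltr_pdivrMr ?addr_gt0 ?expR_gt0 // mul1r.
have := expR_gt0 (- (2 * beta)); lra.
Qed.

Lemma tnh01 : 0 <= tnh <= 1.
Proof. by rewrite !ltW ?tnh_gt0 ?tnh_lt1. Qed.

Lemma expR_rho (r : R) : r = 1 \/ r = -1 -> expR (2 * beta * r) = wc * (1 + tnh * r).
Proof.
have h : expR (2 * beta) + expR (- (2 * beta)) != 0.
  by rewrite lt0r_neq0 // addr_gt0 ?expR_gt0.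
by case=> ->; rewrite ?mulr1 ?mulrN1 /wc /tnh; field.
Qed.

Lemma weightE N (f : gauge_field m N) : f \in Omega1 m N ->
  weight beta f = wc ^+ size (posP N) *
    gibbs_wt (fun p => @chi N (boundary p)) tnh (posP N) f.
Proof.
move=> fO; rewrite /weight (eq_bigr (fun p => chi (boundary p) f)); last first.
  by move=> p _; rewrite rho_dfield.
rewrite sum_boxP => [|p]; last exact: chi_plaq_rev.
rewrite mulrA [beta * 2]mulrC /gibbs_wt; elim: (posP N) => [|p L IH] /=.
  by rewrite !big_nil mulr0 expR0 expr0 mulr1.
rewrite !big_cons mulrDr expRD {}IH expR_rho ?exprS; last exact: (chi_char _ _).2.
ring.
Qed.

Notation gsum N L := (gibbs_sum (Omega1 m N) (fun p => @chi N (boundary p)) tnh L).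

Lemma wc_gt0 : 0 < wc.
Proof. by rewrite /wc divr_gt0 ?addr_gt0 ?expR_gt0. Qed.

Lemma expectNE N s :
  expectN beta (@chi N s) = gsum N (posP N) (@chi N s) / gsum N (posP N) (fun=> 1).
Proof.
have c0 : wc ^+ size (posP N) != 0 by rewrite expf_neq0 // lt0r_neq0 ?wc_gt0.
have ZE : Zpart m beta N = wc ^+ size (posP N) * gsum N (posP N) (fun=> 1).
  rewrite /Zpart /gibbs_sum mulr_sumr; apply: eq_bigr => f fO.
  by rewrite weightE // mul1r.
rewrite /expectN /mu ZE /gibbs_sum mulr_suml; apply: eq_bigr => f fO.
rewrite weightE // invfM !mulrA; congr (_ / _).
by rewrite -mulrA mulrACA divff ?mulr1 // mulrC mulrA mulfK.
Qed.

Let bch N p : ischar (@chi N (boundary p)).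
Proof. exact: chi_char. Qed.

Lemma expectN_ge0 N s : 0 <= expectN beta (@chi N s).
Proof.
rewrite expectNE; apply: divr_ge0;
  apply: (gibbs_sum_ge0 (@Omega1D N) (@bch N) tnh01);
  by [apply: chi_char | apply: ischar1].
Qed.

Lemma gsum1_gt0 N L : 0 < gsum N L (fun=> 1).
Proof. exact: (gibbs_sum_gt0 (@Omega1_0 N) (@Omega1D N) (@bch N) tnh01). Qed.

Lemma expectN_le1 N s : expectN beta (@chi N s) <= 1.
Proof.
rewrite expectNE ler_pdivrMr ?gsum1_gt0 // mul1r.
exact: (gibbs_sum_le1 _ (@bch N) tnh01 _ (chi_char N s)).
Qed.

Lemma expectN_cat N s s' :
  expectN beta (@chi N s) * expectN beta (@chi N s') <=
  expectN beta (@chi N (s ++ s')).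
Proof.
rewrite !expectNE mulrACA -invfM ler_pdivrMr ?mulr_gt0 ?gsum1_gt0 //.
rewrite mulrA mulfVK ?lt0r_neq0 ?gsum1_gt0 //.
have -> : gsum N (posP N) (chi (s ++ s')) =
    gsum N (posP N) (fun f => chi s f * chi s' f).
  by apply: eq_gibbs_sum => f _; rewrite chi_cat.
exact: (griffiths2 (@Omega1D N) (@bch N) tnh01 _ (chi_char N s) (chi_char N s')).
Qed.

Lemma expectN_boundary N p : p \in posP N ->
  tnh <= expectN beta (@chi N (boundary p)).
Proof.
rewrite expectNE.
exact: (gibbs_mean_bond (@Omega1_0 N) (@Omega1D N) (@bch N) tnh01).
Qed.

(* Fields on different boxes are compared by restriction, or extension by 0. *)
Definition transfer N N' (f : gauge_field m N) : gauge_field m N' :=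
  [ffun e => at_edge f (val e)].

Lemma at_transfer N N' (f : gauge_field m N) e :
  at_edge (transfer N' f) e = if e \in boxE m N' then at_edge f e else 0.
Proof. exact: at_edgeE. Qed.

Lemma transferD N N' (f g : gauge_field m N) :
  transfer N' (f + g) = transfer N' f + transfer N' g.
Proof. by apply/ffunP => e; rewrite !ffunE at_edgeD. Qed.

Lemma Omega1_transfer N N' (f : gauge_field m N) :
  f \in Omega1 m N -> transfer N' f \in Omega1 m N'.
Proof.
by move/Omega1P => h; apply/Omega1P => e; rewrite !at_transfer boxE_rev h.
Qed.

Lemma at_edge_inj N (f g : gauge_field m N) :
  (forall e, at_edge f e = at_edge g e) -> f = g.
Proof.
move=> h; apply/ffunP => e; have := h (val e).
by rewrite /at_edge !valK.
Qed.

Lemma transferK N N' (f : gauge_field m N) :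
  {subset boxE m N <= boxE m N'} -> transfer N (transfer N' f) = f.
Proof.
move=> NN'; apply: at_edge_inj => e; rewrite !at_transfer.
have [eN|eN] := boolP (e \in boxE m N); last by rewrite at_edge_out.
by rewrite NN'.
Qed.

Lemma box_sub N N' : (N <= N')%N -> {subset box m N <= box m N'}.
Proof.
move=> NN' x; rewrite !in_box => /forallP h; apply/forallP => i.
by apply: (le_trans (h i)); rewrite lez_nat.
Qed.

Lemma boxE_sub N N' : (N <= N')%N -> {subset boxE m N <= boxE m N'}.
Proof.
move=> NN' e; rewrite !in_boxE => /and3P[e1 e2 ->].
by rewrite !(box_sub NN').
Qed.

Lemma posP_sub N N' : (N <= N')%N -> {subset posP N <= posP N'}.
Proof.
move=> NN' p; rewrite !mem_posP => /andP[-> /allP h].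
by apply/allP => e /h /(boxE_sub NN').
Qed.

(** Restriction is a homomorphism with extension by 0 as a section, so all its fibres have the size
    [K] of its kernel. *)
Lemma sum_transfer N N' : (N <= N')%N -> exists2 K : R, 0 < K &
  forall F : gauge_field m N -> R,
  \sum_(f in Omega1 m N') F (transfer N f) = K * \sum_(f in Omega1 m N) F f.
Proof.
move=> NN'; pose K : R := \sum_(f in Omega1 m N') (transfer N f == 0)%:R.
exists K.
  rewrite /K (bigD1 (0 : gauge_field m N')) ?Omega1_0 //=.
  rewrite ltr_pwDl //; last exact: sumr_ge0.
  have -> : transfer N (0 : gauge_field m N') = 0.
    by apply/ffunP => e; rewrite !ffunE at_edge0.
  by rewrite eqxx.
move=> F; rewrite (partition_big (@transfer N' N) (mem (Omega1 m N))) /=; last first.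
  by move=> f; exact: Omega1_transfer.
rewrite mulr_sumr; apply: eq_bigr => g gO.
transitivity (\sum_(f in Omega1 m N') (transfer N f == g)%:R * F g).
  rewrite big_mkcondr /=; apply: eq_bigr => f _.
  by case: eqP => [->|_]; rewrite ?mul1r ?mul0r.
rewrite -mulr_suml; congr (_ * _).
rewrite -(sum_shift (@Omega1D N') _ (Omega1_transfer N' gO)).
apply: eq_bigr => f _; rewrite transferD transferK; last exact: boxE_sub.
by rewrite -[X in _ == X]addr0 (inj_eq (addrI _)).
Qed.

Lemma chi_transfer N N' s (f : gauge_field m N') : all (mem (boxE m N)) s ->
  chi s (transfer N f) = chi s f.
Proof.
move=> /allP h; apply: eq_big_seq => e /h /= eN.
by rewrite /spin at_transfer eN.
Qed.

Lemma gsum_transfer N N' : (N <= N')%N -> exists2 K : R, 0 < K &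
  forall s, all (mem (boxE m N)) s ->
    gsum N' (posP N) (@chi N' s) = K * gsum N (posP N) (@chi N s).
Proof.
move=> /sum_transfer[K K0 h]; exists K => // s sN.
rewrite -h; apply: eq_bigr => f _; rewrite chi_transfer //; congr (_ * _).
apply: eq_big_seq => p; rewrite mem_posP => /andP[_ pN].
by rewrite chi_transfer.
Qed.

(** Puts the normalisation in the form to which [gsum_transfer] applies. *)
Lemma gsum_nil N L : gsum N L (fun=> 1) = gsum N L (@chi N [::]).
Proof. by apply: eq_gibbs_sum => f _; rewrite /chi big_nil. Qed.

(** By [gsum_transfer] the mean in the smaller box is a mean over fields of the larger box in which
    only the plaquettes of the smaller one interact. Switching on the others raises it. *)
Lemma expectN_mono N N' s : (N <= N')%N -> all (mem (boxE m N)) s ->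
  expectN beta (@chi N s) <= expectN beta (@chi N' s).
Proof.
move=> NN' sN; rewrite !expectNE; have [K K0 h] := gsum_transfer NN'.
have -> : gsum N (posP N) (chi s) / gsum N (posP N) (fun=> 1) =
   gsum N' (posP N) (chi s) / gsum N' (posP N) (fun=> 1).
  by rewrite !gsum_nil !h // -mulf_div divff ?mul1r // lt0r_neq0.
have pe : perm_eq (posP N') ([seq p <- posP N' | p \notin posP N] ++ posP N).
  rewrite -(perm_filterC (mem (posP N))) perm_catC perm_cat2l.
  apply: uniq_perm; rewrite ?filter_uniq ?fset_uniq // => p.
  by rewrite mem_filter /= andb_idr // => /(posP_sub NN').
rewrite !(gibbs_sum_perm _ _ _ _ pe).
exact: (gibbs_mean_cat (@Omega1_0 N') (@Omega1D N') (@bch N') tnh01 _ _ (chi_char N' s)).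
Qed.

Definition wilson s : R := limn (fun N => expectN beta (@chi N s)).

Lemma sites_in_box (x : site m) : exists N, forall N', (N <= N')%N -> x \in box m N'.
Proof.
exists (\max_i `|x ord0 i|%N) => N' h; rewrite in_box; apply/forallP => i.
rewrite -abszE lez_nat; apply: leq_trans h; exact: (leq_bigmax i).
Qed.

Lemma edges_in_box s : all (@nn m) s ->
  exists N, forall N', (N <= N')%N -> all (mem (boxE m N')) s.
Proof.
elim: s => [|e s IH] /=; first by exists 0%N.
move=> /andP[en /IH[N hN]].
have [N1 h1] := sites_in_box e.1; have [N2 h2] := sites_in_box e.2.
exists (maxn N (maxn N1 N2)) => N'; rewrite !geq_max => /and3P[? ? ?].
by rewrite hN // in_boxE h1 // h2 // en.
Qed.

Lemma cvg_wilson s : all (@nn m) s ->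
  ((fun N => expectN beta (@chi N s)) @ \oo --> wilson s)%classic.
Proof.
move=> /edges_in_box[N0 h].
pose u N := expectN beta (@chi N s).
(* Monotonicity starts when the box contains [s]; in smaller boxes spins outside read the default
   value. Hence the shift by [N0]. *)
have /cvg_ex[l ul] : cvg ((fun N => u (N + N0)%N) @ \oo)%classic.
  apply: nondecreasing_is_cvgn.
    move=> N N' NN'; apply: expectN_mono; first by rewrite leq_add2r.
    by apply: h; rewrite leq_addl.
  by exists 1 => _ [N _ <-]; apply: expectN_le1.
suff ul' : (u @ \oo --> l)%classic by rewrite /wilson (cvg_lim _ ul').
by rewrite -(cvg_shiftn N0).
Qed.

Lemma wilson_ge s c : all (@nn m) s ->
  (exists N0, forall N, (N0 <= N)%N -> c <= expectN beta (@chi N s)) -> c <= wilson s.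
Proof.
move=> /cvg_wilson cs [N0 h]; apply: (limr_ge (cvgP _ cs)).
by exists N0.
Qed.

Lemma wilson_le s c : all (@nn m) s ->
  (exists N0, forall N, (N0 <= N)%N -> expectN beta (@chi N s) <= c) -> wilson s <= c.
Proof.
move=> /cvg_wilson cs [N0 h]; apply: (limr_le (cvgP _ cs)).
by exists N0.
Qed.

Lemma wilson_ge0 s : all (@nn m) s -> 0 <= wilson s.
Proof. by move=> /wilson_ge; apply; exists 0%N => N _; exact: expectN_ge0. Qed.

Lemma wilson_le1 s : all (@nn m) s -> wilson s <= 1.
Proof. by move=> /wilson_le; apply; exists 0%N => N _; exact: expectN_le1. Qed.

Lemma wilson_cat s s' : all (@nn m) s -> all (@nn m) s' ->
  wilson s * wilson s' <= wilson (s ++ s').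
Proof.
move=> sn sn'; have ssn : all (@nn m) (s ++ s') by rewrite all_cat sn.
have c1 := cvgM (cvg_wilson sn) (cvg_wilson sn').
apply: (ler_cvg_to (c1 _) (cvg_wilson ssn)).
by near=> N; exact: expectN_cat.
Unshelve. all: by end_near.
Qed.

End Spins.

(** * Lists of edges as chains modulo 2 *)

Section Chains.
Variable m : nat.
Notation edge := (site m * site m)%type.

(** The exclusive or makes incidence additive modulo 2; for lattice edges it means being an end, see
    [inc_nn]. *)
Definition inc (x : site m) (e : edge) : bool := (x == e.1) (+) (x == e.2).

Definition same (e e' : edge) : bool := (e' == e) || (e' == rev_edge e).

(** The coefficient of the undirected edge [e] in the Z_2-chain given by [s]. *)
Definition par (s : seq edge) (e : edge) : bool := odd (count (same e) s).

Definition hedge (x : site m) (i : 'I_m) : edge := (x, x + dir i).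

Lemma rev_edgeK : involutive (@rev_edge m).
Proof. by case. Qed.

Lemma same_refl e : same e e.
Proof. by rewrite /same eqxx. Qed.

Lemma same_sym e e' : same e e' = same e' e.
Proof.
by apply/orP/orP => [][/eqP ->|/eqP ->]; rewrite ?rev_edgeK eqxx; auto.
Qed.

Lemma same_revr e e' : same e (rev_edge e') = same e e'.
Proof.
by rewrite /same orbC (inj_eq (inv_inj rev_edgeK)) (inv_eq rev_edgeK).
Qed.

Lemma same_revl e e' : same (rev_edge e) e' = same e e'.
Proof. by rewrite same_sym same_revr same_sym. Qed.

Lemma same_eql e e' f : same e e' -> same f e = same f e'.
Proof. by move/orP => [/eqP ->|/eqP ->]; rewrite ?same_revr. Qed.

Lemma same_eqr e e' f : same e e' -> same e f = same e' f.
Proof. by rewrite ![same _ f]same_sym; apply: same_eql. Qed.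

Lemma par_cat s s' e : par (s ++ s') e = par s e (+) par s' e.
Proof. by rewrite /par count_cat oddD. Qed.

Lemma dirE (i k : 'I_m) : dir i ord0 k = (k == i)%:R.
Proof. by rewrite /dir mxE eqxx. Qed.

Lemma dir_inj : injective (@dir m).
Proof.
move=> i k /rowP /(_ i); rewrite !dirE eqxx.
by case: eqVneq.
Qed.

Lemma dirD_neq0 (i k : 'I_m) : dir i + dir k != 0.
Proof.
apply/negP => /eqP /rowP /(_ i); rewrite !mxE !eqxx /=.
by case: (i == k).
Qed.

Lemma dir_neq0 (i : 'I_m) : dir i != 0.
Proof.
apply/negP => /eqP /rowP /(_ i); rewrite !mxE !eqxx /=.
by [].
Qed.

Lemma same_hedge x i y k : same (hedge x i) (hedge y k) = (x == y) && (i == k).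
Proof.
apply/orP/andP => [[/eqP [-> /addrI /dir_inj ->] //|/eqP[->]]|[/eqP -> /eqP ->]].
  rewrite -addrA -[RHS]addr0 => /addrI /eqP.
  by rewrite (negbTE (dirD_neq0 i k)).
by left.
Qed.

Lemma nn_hedge x i : nn (hedge x i).
Proof.
rewrite /nn; have -> : (hedge x i).2 - (hedge x i).1 = dir i.
  by rewrite /= addrC addKr.
rewrite (bigD1 i) //= big1 => [|k ki]; first by rewrite dirE eqxx normr1.
by rewrite dirE (negbTE ki) normr0.
Qed.

Lemma boundaryE (x : site m) i j : boundary (x, (i, j)) =
  [:: hedge x i; hedge (x + dir i) j; rev_edge (hedge (x + dir j) i);
      rev_edge (hedge x j)].
Proof. by rewrite /boundary /hedge /rev_edge /= [x + dir j + dir i]addrAC. Qed.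

Lemma nn_boundary p : all (@nn m) (boundary p).
Proof. by case: p => x [i j]; rewrite boundaryE /= !nn_rev !nn_hedge. Qed.

Lemma par_boundary (x y : site m) (i j k : 'I_m) :
  par (boundary (y, (i, j))) (hedge x k) =
  ((x == y) && (k == i)) (+) ((x == y + dir i) && (k == j)) (+)
  ((x == y + dir j) && (k == i)) (+) ((x == y) && (k == j)).
Proof.
rewrite /par boundaryE /= !same_revr !same_hedge addn0 !oddD !oddb.
by rewrite !addbA.
Qed.

Lemma deg_boundary x p : ~~ odd (count (inc x) (boundary p)).
Proof.
case: p => y [i j]; rewrite /= /inc /= addn0 !oddD !oddb.
by do 4!case: (x == _).
Qed.

Lemma inc_rev x e : inc x (rev_edge e) = inc x e.
Proof. by rewrite /inc addbC. Qed.

End Chains.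

(** * Gauge invariance and the area lower bound *)

Section Invariance.
Variables (R : realType) (m : nat).
Notation edge := (site m * site m)%type.

Definition test N (P : pred edge) : gauge_field m N := [ffun e => (P (val e))%:R].

Lemma test_Omega1 N (P : pred edge) : (forall e, P (rev_edge e) = P e) ->
  test N P \in Omega1 m N.
Proof.
move=> h; apply/Omega1P => e.
by rewrite !(at_edgeE N (fun e => (P e)%:R)) boxE_rev h.
Qed.

Lemma chi_test N (P : pred edge) s : all (mem (boxE m N)) s ->
  chi R s (test N P) = (-1) ^+ count P s.
Proof.
elim: s => [|e s IH] /=; first by rewrite /chi big_nil.
move=> /andP[eN sN]; rewrite /chi big_cons -/(chi R s (test N P)) IH // exprD.
rewrite /spin (at_edgeE N (fun e => (P e)%:R)) eN; congr (_ * _).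
by case: (P e).
Qed.

Lemma chi_perm N s s' (f : gauge_field m N) : perm_eq s s' -> chi R s f = chi R s' f.
Proof. exact: perm_big. Qed.

Lemma spin_same N (f : gauge_field m N) e e' : f \in Omega1 m N -> same e e' ->
  spin R e' f = spin R e f.
Proof. by move=> /Omega1P h /orP[|] /eqP ->; rewrite /spin ?h. Qed.

(** Each step removes two occurrences of one undirected edge, whose spins multiply to 1; hence the
    strong induction on the size. *)
Lemma chi_even N (f : gauge_field m N) s : f \in Omega1 m N ->
  (forall e, ~~ par s e) -> chi R s f = 1.
Proof.
move=> fO; have [n le_sn] := ubnP (size s).
elim: n s le_sn => [//|n IH] [|e s] /=; first by rewrite /chi big_nil.
rewrite ltnS => sn h; have := h e; rewrite /par /= same_refl /= negbK => odds.
have /hasP[e' e's ee'] : has (same e) s by rewrite has_count; case: count odds.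
have ps := perm_to_rem e's.
rewrite /chi big_cons -/(chi R s f) (chi_perm f ps) /chi big_cons.
rewrite (spin_same fO ee') mulrA (ischar_sq f (spin_char R N e)) mul1r.
apply: IH => [|g]; first by rewrite (leq_trans _ sn) // (perm_size ps).
have := h g; rewrite /par /= (permP ps) /= addnA oddD (same_eql g ee').
by rewrite addnn odd_double.
Qed.

Lemma chi_par N (f : gauge_field m N) s s' : f \in Omega1 m N ->
  (forall e, par s e = par s' e) -> chi R s f = chi R s' f.
Proof.
move=> fO h; have : chi R (s ++ s') f = 1.
  by apply: chi_even => // e; rewrite par_cat h addbb.
rewrite chi_cat => e1; rewrite -[LHS]mulr1 -(ischar_sq f (chi_char R N s')).
by rewrite mulrA e1 mul1r.
Qed.

(** The field equal to 1 on a single undirected edge reads off the coefficient of that edge. *)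
Lemma par_chi N s s' : all (mem (boxE m N)) s -> all (mem (boxE m N)) s' ->
  (forall f, f \in Omega1 m N -> chi R s f = chi R s' f) ->
  forall e, par s e = par s' e.
Proof.
move=> sN sN' h e; have := h (test N (same e)).
rewrite test_Omega1 => [/(_ isT)|e']; last exact: same_revr.
rewrite !chi_test // -!(signr_odd _ (count _ _)) -/(par s e) -/(par s' e).
have n1 : -1 != 1 :> R by rewrite lt_eqF // (lt_trans (ltrN10 R) ltr01).
by case: (par s e); case: (par s' e) => // /eqP; rewrite expr1 expr0 ?(negbTE n1) //
  eq_sym (negbTE n1).
Qed.

Variable beta : R.
Hypothesis beta0 : 0 < beta.
Notation E := (@wilson R m beta).
Notation t := (tnh beta).

(** The gauge transformation at [x] flips the spins of all edges at [x]. It preserves every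
    plaquette, by [deg_boundary], but changes the sign of the product over [s]. *)
Lemma expectN_odd N s x : all (mem (boxE m N)) s -> odd (count (inc x) s) ->
  expectN beta (chi R s (N := N)) = 0.
Proof.
move=> sN odds; rewrite expectNE //.
suff -> : gibbs_sum (Omega1 m N) (fun p => chi R (boundary p) (N := N)) t (posP m N)
  (chi R s (N := N)) = 0 by rewrite mul0r.
set S := LHS; suff : S = - S by lra.
pose g := test N (inc x).
have gO : g \in Omega1 m N by apply: test_Omega1 => e; rewrite inc_rev.
rewrite {1}/S /gibbs_sum -(sum_shift (@Omega1D m N) _ gO) /S /gibbs_sum -sumrN.
apply: eq_bigr => f _; rewrite (chi_char R N s).1 {1}/g chi_test //.
rewrite -signr_odd odds mulN1r mulNr; congr (- (_ * _)).
apply: eq_big_seq => p; rewrite mem_posP => /andP[_ pN].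
rewrite (chi_char R N (boundary p)).1 /g chi_test //.
by rewrite -signr_odd (negbTE (deg_boundary x p)) mul1r.
Qed.

Lemma wilson_odd s x : all (@nn m) s -> odd (count (inc x) s) -> E s = 0.
Proof.
move=> sn odds; have [N0 h] := edges_in_box sn.
by apply/eqP; rewrite eq_le (wilson_le beta0) ?(wilson_ge beta0) //;
  exists N0 => N /h sN; rewrite (expectN_odd sN odds).
Qed.

Lemma eq_wilson s s' :
  (forall N f, f \in Omega1 m N -> chi R s f = chi R s' f) -> E s = E s'.
Proof.
move=> h; rewrite /wilson; congr (limn _); apply/funext => N.
by apply: eq_bigr => f fO; rewrite h.
Qed.

Lemma wilson_par s s' : (forall e, par s e = par s' e) -> E s = E s'.
Proof. by move=> h; apply: eq_wilson => N f fO; apply: chi_par. Qed.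

Lemma wilson_nil : E [::] = 1.
Proof.
apply/eqP; rewrite eq_le wilson_le1 //= wilson_ge //; exists 0%N => N _.
rewrite expectNE // gsum_nil divff // -gsum_nil lt0r_neq0 //.
exact: gsum1_gt0.
Qed.

Lemma wilson_boundary (x : site m) i j : i != j -> t <= E (boundary (x, (i, j))).
Proof.
have lt_ij (i' j' : 'I_m) : (i' < j')%N -> t <= E (boundary (x, (i', j'))).
  move=> lij; apply: wilson_ge => //; first exact: nn_boundary.
  have [N0 h] := edges_in_box (nn_boundary (x, (i', j'))).
  exists N0 => N /h pN; apply: expectN_boundary => //.
  by rewrite mem_posP /= lij.
rewrite -val_eqE neq_ltn => /orP[/lt_ij //|/lt_ij].
suff -> : E (boundary (x, (i, j))) = E (boundary (x, (j, i))) by [].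
by apply: eq_wilson => N f fO; rewrite -(chi_plaq_rev R _ fO).
Qed.

Definition side (x : site m) (i : 'I_m) (a : nat) : seq edge :=
  [seq hedge (x + dir i *+ l) i | l <- iota 0 a].

(** The sides point along [i] and [j] instead of around the rectangle. Over Z_2 only undirected
    edges matter, and this way sides concatenate by [side_cat]. *)
Definition rect (x : site m) (i j : 'I_m) (a b : nat) : seq edge :=
  side x i a ++ side (x + dir j *+ b) i a ++
  side x j b ++ side (x + dir i *+ a) j b.

Lemma side_cat x i a b : side x i (a + b) = side x i a ++ side (x + dir i *+ a) i b.
Proof.
rewrite /side iotaD map_cat; congr (_ ++ _).
rewrite add0n -{1}[a]addn0 iotaDl -map_comp; apply: eq_map => l /=.
by rewrite mulrnDr addrA.
Qed.

Lemma nn_side x i a : all (@nn m) (side x i a).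
Proof. by rewrite all_map; apply/allP => l _; exact: nn_hedge. Qed.

Lemma nn_rect x i j a b : all (@nn m) (rect x i j a b).
Proof. by rewrite !all_cat !nn_side. Qed.

Let sq s N (f : gauge_field m N) : chi R s f * chi R s f = 1.
Proof. exact: ischar_sq (chi_char R N s). Qed.

(** Unit squares have means at least [t]. They are glued by [wilson_cat] to rows and rows to
    rectangles, the shared sides occurring twice and cancelling. *)
Lemma wilson_rect x i j a b : i != j -> t ^+ (a * b) <= E (rect x i j a b).
Proof.
move=> ij; have t0 : 0 <= t by rewrite ltW ?tnh_gt0.
have row y a' : t ^+ a' <= E (rect y i j a' 1).
  elim: a' => [|a' IH].
    suff -> : E (rect y i j 0 1) = E [::] by rewrite wilson_nil expr0.
    apply: eq_wilson => N f fO; rewrite [in RHS]/chi big_nil.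
    by rewrite /rect mulr0n addr0 !chi_cat sq /chi !big_nil !mul1r.
  have -> : E (rect y i j a'.+1 1) =
      E (rect y i j a' 1 ++ boundary (y + dir i *+ a', (i, j))).
    apply: eq_wilson => N f /Omega1P fO.
    rewrite /rect -addn1 !side_cat !chi_cat.
    have -> : chi R (boundary (y + dir i *+ a', (i, j))) f =
       chi R (side (y + dir i *+ a') i 1) f * chi R (side (y + dir i *+ (a' + 1)) j 1) f *
       chi R (side (y + dir j *+ 1 + dir i *+ a') i 1) f *
       chi R (side (y + dir i *+ a') j 1) f.
      rewrite boundaryE /chi /side /= !big_cons !big_nil /spin !fO /=.
      rewrite !mulr0n !addr0 addn1 mulrSr mulr1n addrA.
      by rewrite [y + dir i *+ a' + dir j]addrAC; ring.
    move: (sq (side (y + dir i *+ a') j 1) f) => e.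
    transitivity (chi R (side y i a') f * chi R (side (y + dir i *+ a') i 1) f *
      (chi R (side (y + dir j *+ 1) i a') f *
      chi R (side (y + dir j *+ 1 + dir i *+ a') i 1) f) *
      (chi R (side y j 1) f * chi R (side (y + dir i *+ (a' + 1)) j 1) f) *
      (chi R (side (y + dir i *+ a') j 1) f * chi R (side (y + dir i *+ a') j 1) f)).
      by rewrite e mulr1; ring.
    ring.
  apply: le_trans (wilson_cat beta0 (nn_rect _ _ _ _ _) (nn_boundary _)).
  by rewrite exprSr ler_pM ?exprn_ge0 ?wilson_boundary.
elim: b => [|b IH].
  suff -> : E (rect x i j a 0) = E [::] by rewrite wilson_nil muln0 expr0.
  apply: eq_wilson => N f fO; rewrite [in RHS]/chi big_nil.
  by rewrite /rect /= mulr0n addr0 cats0 chi_cat sq.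
have -> : E (rect x i j a b.+1) =
    E (rect x i j a b ++ rect (x + dir j *+ b) i j a 1).
  apply: eq_wilson => N f fO.
  rewrite /rect -(addn1 b) !side_cat !chi_cat mulrnDr addrA.
  rewrite [x + dir j *+ b + dir i *+ a]addrAC.
  move: (sq (side (x + dir j *+ b) i a) f) => e.
  set A := chi R (side (x + dir j *+ b) i a) f in e *.
  set B := chi R (side x i a) f.
  set C := chi R (side (x + dir j *+ b + dir j *+ 1) i a) f.
  transitivity (B * C * (chi R (side x j b) f * chi R (side (x + dir j *+ b) j 1) f) *
   (chi R (side (x + dir i *+ a) j b) f *
    chi R (side (x + dir i *+ a + dir j *+ b) j 1) f) * (A * A)).
    by rewrite e mulr1; ring.
  ring.
apply: le_trans (wilson_cat beta0 (nn_rect _ _ _ _ _) (nn_rect _ _ _ _ _)).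
rewrite mulnS addnC exprD ler_pM ?exprn_ge0 //.
Qed.

End Invariance.

(** * Exact solution in the plane *)

Lemma seq_argmax (T : eqType) (s : seq T) (f : T -> int) x0 : x0 \in s ->
  exists2 x, x \in s & forall y, y \in s -> f y <= f x.
Proof.
elim: s x0 => // a s IH x0 _; case: s IH => [|b s] IH.
  by exists a; rewrite ?mem_head // => y; rewrite inE => /eqP ->.
have [x xs xmax] := IH b (mem_head _ _).
have [le|lt] := leP (f x) (f a).
  exists a; rewrite ?mem_head // => y; rewrite inE => /orP[/eqP -> //|/xmax].
  by move=> h; apply: le_trans le.
exists x; first by rewrite inE xs orbT.
by move=> y; rewrite inE => /orP[/eqP ->|/xmax //]; apply: ltW.
Qed.

Lemma seq_argmin (T : eqType) (s : seq T) (f : T -> int) x0 : x0 \in s ->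
  exists2 x, x \in s & forall y, y \in s -> f x <= f y.
Proof.
move=> /(seq_argmax (fun x => - f x))[x xs h]; exists x => // y /h.
by rewrite lerN2.
Qed.

Section Planar.
Notation o0 := (ord0 : 'I_2).
Notation o1 := (ord_max : 'I_2).
Notation edge := (site 2 * site 2)%type.

Definition square (x : site 2) : plaq 2 := (x, (o0, o1)).

Definition loops (s : seq (site 2)) : seq edge :=
  flatten [seq boundary (square x) | x <- s].

Lemma ord2P (k : 'I_2) : k = o0 \/ k = o1.
Proof. by case: k => [[|[|//]] i]; [left|right]; apply: val_inj. Qed.

Lemma par_square x y k : par (boundary (square y)) (hedge x k) =
  (x == y) (+) (x - dir (rev_ord k) == y).
Proof.
have r0 : rev_ord o0 = o1 by apply: val_inj.
have r1 : rev_ord o1 = o0 by apply: val_inj.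
rewrite par_boundary; case: (ord2P k) => ->; rewrite ?r0 ?r1 subr_eq /=.
  by rewrite !andbF !andbT !addbF.
by rewrite !andbF !andbT !addbF addFb addbC.
Qed.

Lemma par_loops s x k : uniq s ->
  par (loops s) (hedge x k) = (x \in s) (+) (x - dir (rev_ord k) \in s).
Proof.
elim: s => // y s IH /= /andP[ys us].
rewrite -[loops (y :: s)]/(boundary (square y) ++ loops s) par_cat IH //.
have e w : (w \in y :: s) = (w == y) (+) (w \in s).
  by rewrite inE; case: eqVneq => // ->; rewrite (negbTE ys).
rewrite par_square !e -!addbA; congr (_ (+) _).
by rewrite addbCA.
Qed.

Lemma nn_loops s : all (@nn 2) (loops s).
Proof.
elim: s => // x s IH; rewrite -[loops (x :: s)]/(boundary (square x) ++ loops s).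
by rewrite all_cat nn_boundary.
Qed.

Variables (R : realType).

Lemma chi_loops N s (f : gauge_field 2 N) :
  chi R (loops s) f = \prod_(x <- s) chi R (boundary (square x)) f.
Proof.
elim: s => [|x s IH]; first by rewrite /chi !big_nil.
rewrite -[loops (x :: s)]/(boundary (square x) ++ loops s).
by rewrite chi_cat big_cons IH.
Qed.

(* The top edge of a highest square of [Y] lies on no other square of [Y]. *)
Lemma square_indep N (Y : {fset site 2}) : Y != fset0 ->
  all (mem (boxE 2 N)) (loops Y) ->
  exists2 f, f \in Omega1 2 N & \prod_(x <- Y) chi R (boundary (square x)) f = -1.
Proof.
move=> /fset0Pn[y0 y0Y] YN.
have [y yY ymax] := seq_argmax (fun x : site 2 => x ord0 o1) y0Y.
have yN : y + dir o1 \notin Y.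
  apply/negP => /ymax; by rewrite mxE dirE eqxx gerDl.
pose e := hedge (y + dir o1) o0.
exists (test N (same e)); first by apply: test_Omega1 => e'; rewrite same_revr.
rewrite -chi_loops chi_test // -signr_odd -/(par _ _) par_loops ?fset_uniq //.
rewrite (negbTE yN); have -> : rev_ord o0 = o1 by apply: val_inj.
by rewrite addrK yY.
Qed.

Variable beta : R.
Hypothesis beta0 : 0 < beta.
Notation t := (tnh beta).
Notation E := (@wilson R 2 beta).

Definition box_squares N : seq (site 2) := [seq p.1 | p <- posP 2 N].

Lemma posP_square N p : p \in posP 2 N -> p = square p.1.
Proof.
case: p => x [i j]; rewrite mem_posP /square /= => /andP[lij _].
by case: (ord2P i) lij => ->; case: (ord2P j) => ->.
Qed.

Lemma box_squares_uniq N : uniq (box_squares N).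
Proof.
rewrite map_inj_in_uniq ?filter_uniq ?fset_uniq // => p q /posP_square -> /posP_square ->.
by move=> /= ->.
Qed.

Lemma mem_box_squares N x :
  (x \in box_squares N) = all (mem (boxE 2 N)) (boundary (square x)).
Proof.
apply/mapP/idP => [[p pN ->]|xN].
  by rewrite -(posP_square pN); move: pN; rewrite mem_posP => /andP[].
by exists (square x) => //; rewrite mem_posP xN.
Qed.

Lemma gibbs_sum_squares N (F : gauge_field 2 N -> R) :
  gibbs_sum (Omega1 2 N) (fun p => chi R (boundary p) (N := N)) t (posP 2 N) F =
  gibbs_sum (Omega1 2 N) (fun x => chi R (boundary (square x)) (N := N)) t
    (box_squares N) F.
Proof.
apply: eq_bigr => f _; rewrite /gibbs_wt big_map; congr (_ * _).
by apply: eq_big_seq => p /posP_square {1}->.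
Qed.

(** By [square_indep] the plaquettes of the plane are independent characters, so numerator and
    denominator both reduce to a single term of their expansions. *)
Lemma expectN_loops N (X : {fset site 2}) : all (mem (boxE 2 N)) (loops X) ->
  expectN beta (chi R (loops X) (N := N)) = t ^+ #|` X|.
Proof.
move=> XN; rewrite expectNE // !gibbs_sum_squares.
have h (X' : {fset site 2}) : all (mem (boxE 2 N)) (loops X') ->
    gibbs_sum (Omega1 2 N) (fun x => chi R (boundary (square x)) (N := N)) t
      (box_squares N) (chi R (loops X') (N := N)) = t ^+ #|` X'| * #|Omega1 2 N|%:R.
  move=> X'N; have X'E x : x \in X' -> x \in box_squares N.
    move=> xX; rewrite mem_box_squares; apply/allP => e ex; apply: (allP X'N).
    by apply/flattenP; exists (boundary (square x)) => //; apply: map_f.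
  have -> : chi R (loops X') (N := N) =
      fun f => \prod_(x <- X') chi R (boundary (square x)) f.
    by apply/funext => f; rewrite chi_loops.
  rewrite (gibbs_sum_indep (@Omega1D 2 N)) ?box_squares_uniq //.
  - by have -> : all (mem (box_squares N)) X' by apply/allP.
  - by move=> x; exact: chi_char.
  move=> Y Y0 YL; apply: square_indep => //.
  apply/allP => e /flattenP[_ /mapP[x xY ->]]; move: e; apply/allP.
  by rewrite -mem_box_squares; case/orP: (YL x xY) => [|/X'E].
rewrite h //; have -> : (fun=> 1) = chi R (loops (fset0 : {fset site 2})) (N := N).
  by apply/funext => f; rewrite chi_loops big_seq_fset0.
rewrite h; last by apply/allP => e /flattenP[b /mapP[x]]; rewrite in_fset0.
have O0 : #|Omega1 2 N|%:R != 0 :> R.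
  rewrite pnatr_eq0 -lt0n card_gt0; apply/set0Pn; exists 0; exact: Omega1_0.
by rewrite cardfs0 expr0 mul1r mulfK.
Qed.

Lemma wilson_loops (X : {fset site 2}) : E (loops X) = t ^+ #|` X|.
Proof.
have [N0 h] := edges_in_box (nn_loops X).
by apply/eqP; rewrite eq_le (wilson_le beta0) ?(wilson_ge beta0) ?nn_loops //;
  exists N0 => N /h sN; rewrite expectN_loops.
Qed.

(** The chain [s] is the boundary modulo 2 of the region formed by the squares of [X]. *)
Definition fillable (s : seq edge) (X : {fset site 2}) : Prop :=
  forall e, par s e = par (loops X) e.

Lemma wilson_fillable s X : fillable s X -> E s = t ^+ #|` X|.
Proof. by move=> /wilson_par ->; exact: wilson_loops. Qed.

(** In some large box the mean is nonzero, and [gibbs_sum_neq0] writes the loop variable as a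
    product of plaquettes. Equality on all fields becomes equality of chains by [par_chi]. *)
Lemma wilson_neq0 s : all (@nn 2) s -> E s != 0 -> exists X, fillable s X.
Proof.
move=> sn En; have [N0 hN] := edges_in_box sn.
have [N NN0 EN] : exists2 N, (N0 <= N)%N & expectN beta (chi R s (N := N)) != 0.
  apply: contrapT => h; move/negP: En; apply; rewrite eq_le.
  rewrite (wilson_le beta0) ?(wilson_ge beta0) //; exists N0 => N NN0;
    have [->//|e] := eqVneq (expectN beta (chi R s (N := N))) 0;
    by case: h; exists N.
move: EN; rewrite expectNE // mulf_eq0 negb_or gibbs_sum_squares => /andP[EN _].
have ch x : ischar (chi R (boundary (square x)) (N := N)) by exact: chi_char.
have [Q QL hQ] := gibbs_sum_neq0 (@Omega1D 2 N) ch (chi_char R N s) EN.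
have uQ : uniq Q := subseq_uniq QL (box_squares_uniq N).
exists [fset x in Q]%fset; apply: (@par_chi R _ N); first exact: hN.
  apply/allP => e /flattenP[_ /mapP[x xY ->]]; move: e; apply/allP.
  by rewrite -mem_box_squares (mem_subseq QL) //; move: xY; rewrite inE.
move=> f fO; rewrite hQ // chi_loops; apply: perm_big.
apply: uniq_perm; rewrite ?fset_uniq //.
by move=> x; rewrite inE.
Qed.

End Planar.

(** * Ursell functions *)

Section Ursell.
Variables (R : realType) (n : nat) (F : {set 'I_n} -> R).
Hypothesis n0 : (0 < n)%N.
Implicit Types (P : {set {set 'I_n}}) (A B C : {set 'I_n}).

(** The set function [F] is arbitrary, so that the sign arguments of this section are pure
    combinatorics of partitions. *)
Definition ursell_term P : R :=
  (-1) ^+ (#|P| - 1) * ((#|P| - 1)`!)%:R * \prod_(B in P) F B.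

Definition ursell_sum : R :=
  \sum_(P : {set {set 'I_n}} | finset.partition P [set: 'I_n]%SET) ursell_term P.

Let setT_neq0 : [set: 'I_n]%SET != set0.
Proof. by apply/set0Pn; exists (Ordinal n0); rewrite inE. Qed.

Lemma term_neq0 P : ursell_term P != 0 -> forall B, B \in P -> F B != 0.
Proof. by rewrite mulf_eq0 negb_or => /andP[_ /prodf_neq0]. Qed.

Lemma partition_card_gt0 P : finset.partition P [set: 'I_n]%SET -> (0 < #|P|)%N.
Proof.
case/and3P => /eqP c _ _; rewrite card_gt0; apply: contraNneq setT_neq0 => P0.
by rewrite -c P0 /cover big_set0.
Qed.

Lemma partition1 P : finset.partition P [set: 'I_n]%SET -> #|P| = 1%N ->
  P = [set [set: 'I_n]%SET]%SET.
Proof.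
move=> /and3P[/eqP c _ _] /eqP /cards1P[A PA]; move: c.
by rewrite PA /cover big_set1 => ->.
Qed.

Lemma partition2 P : finset.partition P [set: 'I_n]%SET -> #|P| = 2%N ->
  exists A, [/\ P = [set A; ~: A]%SET, A != set0 & ~: A != set0]%SET.
Proof.
move=> /and3P[/eqP c /trivIsetP tr P0] /eqP /cards2P[A [B [AB PE]]].
have Ain : A \in P by rewrite PE !inE eqxx.
have Bin : B \in P by rewrite PE !inE eqxx orbT.
have BE : B = ~: A.
  apply/setP => x; rewrite inE; have : x \in cover P by rewrite c inE.
  rewrite /cover PE big_setU1 ?inE //= big_set1.
  have := tr A B Ain Bin AB; rewrite disjoints_subset => /subsetP /(_ x).
  by rewrite inE; case: (x \in A) => /= [/(_ isT)/negbTE -> //|_ ->].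
exists A; rewrite -BE; split=> //.
  by apply: contraNneq P0 => <-.
by apply: contraNneq P0 => <-.
Qed.

Lemma partition_split A : A != set0 -> ~: A != set0 ->
  finset.partition [set A; ~: A]%SET [set: 'I_n]%SET.
Proof.
move=> A0 A0'; have nA : A != ~: A.
  apply/eqP => /setP h; case/set0Pn: A0 => x xA.
  by have := h x; rewrite inE xA.
apply/and3P; split.
- by rewrite /cover big_setU1 ?inE //= big_set1 setUCr.
- apply/trivIsetP => B C; rewrite !inE.
  have dA : [disjoint A & ~: A] by rewrite disjoints_subset setCK.
  case/orP => /eqP ->; case/orP => /eqP ->; rewrite ?eqxx // => _.
  by rewrite disjoint_sym.
by rewrite !inE negb_or eq_sym A0 eq_sym.
Qed.

Lemma partitionT : finset.partition [set [set: 'I_n]]%SET [set: 'I_n]%SET.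
Proof.
apply/and3P; split; first by rewrite /cover big_set1.
  by apply/trivIsetP => B C; rewrite !inE => /eqP -> /eqP ->; rewrite eqxx.
by rewrite inE eq_sym.
Qed.

Lemma term1 A : ursell_term [set A]%SET = F A.
Proof. by rewrite /ursell_term cards1 big_set1 expr0 !mul1r. Qed.

Lemma term2 A B : A != B -> ursell_term [set A; B]%SET = - (F A * F B).
Proof.
move=> AB; rewrite /ursell_term cards2 AB big_setU1 ?inE //= big_set1.
by rewrite expr1 mulr1 mulN1r.
Qed.

Lemma term3 A B C : A != B -> A != C -> B != C ->
  ursell_term [set A; B; C]%SET = 2 * (F A * F B * F C).
Proof.
move=> AB AC BC; rewrite /ursell_term.
rewrite [in \prod_(_ in _) _]setUC big_setU1 /= ?inE; last first.
  by rewrite negb_or ![C == _]eq_sym AC BC.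
rewrite big_setU1 ?inE //= big_set1.
have -> : #|[set A; B; C]%SET| = 3%N.
  by rewrite setUC cardsU1 !inE negb_or ![C == _]eq_sym AC BC cards2 AB.
rewrite (_ : (3 - 1 = 2)%N) // (_ : 2`! = 2)%N //; ring.
Qed.

Lemma ursell_sum_eq0 : (forall B, B != set0 -> F B = 0) -> ursell_sum = 0.
Proof.
move=> F0; apply: big1 => P PT; apply/eqP; apply/negPn/negP => /term_neq0 h.
have := partition_card_gt0 PT; rewrite card_gt0 => /set0Pn[B BP].
move/eqP: (h B BP); apply; apply: F0.
by case/and3P: PT => _ _; apply: contraNneq => <-.
Qed.

Lemma ursell_sum_on (S : {set {set {set 'I_n}}}) :
  (forall P, P \in S -> finset.partition P [set: 'I_n]%SET) ->
  (forall P, finset.partition P [set: 'I_n]%SET -> ursell_term P != 0 -> P \in S) ->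
  ursell_sum = \sum_(P in S) ursell_term P.
Proof.
move=> SP PS; rewrite /ursell_sum (bigID (mem S)) /= addrC big1 ?add0r.
  by apply: eq_bigl => P; apply/andb_idl/SP.
move=> P /andP[PT PnS]; apply/eqP; apply: contraNT PnS; exact: PS.
Qed.

Lemma ursell_sum_single :
  (forall B, B != set0 -> B != [set: 'I_n]%SET -> F B = 0) ->
  ursell_sum = F [set: 'I_n]%SET.
Proof.
move=> F0; rewrite (ursell_sum_on (S := [set [set [set: 'I_n]]]%SET)).
- by rewrite big_set1 term1.
- by move=> P; rewrite inE => /eqP ->; exact: partitionT.
move=> P PT /term_neq0 h; rewrite inE; apply/eqP/partition1 => //.
apply/eqP; rewrite eqn_leq partition_card_gt0 // andbT leqNgt.
apply/negP => /card_gt1P[A [B [AP BP AB]]].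
case/and3P: PT => _ /trivIsetP tr P0.
have A0 : A != set0 by apply: contraNneq P0 => <-.
have B0 : B != set0 by apply: contraNneq P0 => <-.
move: (h A AP); rewrite F0 ?eqxx //; apply: contraNneq B0 => AT.
have := tr A B AP BP AB; rewrite AT disjoint_sym disjoints_subset setCT.
by rewrite subset0.
Qed.

Hypothesis F_ge0 : forall A, 0 <= F A.

(** Under this condition only partitions into one or two blocks contribute, see [term_no_triple]. *)
Definition no_triple := forall A B C, A != set0 -> B != set0 -> C != set0 ->
  [disjoint A & B] -> [disjoint B & C] -> [disjoint C & A] ->
  F A != 0 -> F B != 0 -> F C != 0 -> False.

Lemma partition3 P : finset.partition P [set: 'I_n]%SET -> (2 < #|P|)%N ->
  exists A B C, [/\ A \in P, B \in P & C \in P] /\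
   [/\ A != set0, B != set0 & C != set0] /\
   [/\ [disjoint A & B], [disjoint B & C] & [disjoint C & A]].
Proof.
move=> /and3P[_ /trivIsetP tr P0] /card_gt2P[A [B [C [[AP BP CP] [AB BC CA]]]]].
have n0' D : D \in P -> D != set0 by move=> DP; apply: contraNneq P0 => <-.
by exists A, B, C; split => //; split; split; auto.
Qed.

Lemma term_no_triple P : no_triple -> finset.partition P [set: 'I_n]%SET ->
  ursell_term P != 0 -> P = [set [set: 'I_n]]%SET \/
  exists A, [/\ P = [set A; ~: A]%SET, A != set0 & ~: A != set0]%SET.
Proof.
move=> h PT t0; have F0 := term_neq0 t0.
have [/(partition3 PT)|P2] := ltnP 2 #|P|.
  case=> A [B [C [[AP BP CP] [[A0 B0 C0] [AB BC CA]]]]].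
  by case: (h A B C) => //; exact: F0.
have := partition_card_gt0 PT; move: P2.
case: (#|P|) (@partition1 P PT) (@partition2 P PT) => [|[|[|//]]] // h1 h2 _ _.
  by left; exact: h1.
by right; exact: h2.
Qed.

Lemma neq_setC A : A != set0 -> A != ~: A.
Proof.
move=> A0; apply/eqP => /setP h; case/set0Pn: A0 => x xA.
by have := h x; rewrite inE xA.
Qed.

Lemma term2_le0 A : A != set0 -> ursell_term [set A; ~: A]%SET <= 0.
Proof.
by move=> A0; rewrite term2 ?neq_setC // oppr_le0 mulr_ge0.
Qed.

(** The one-block term is at most 1, the two given splits subtract more than 1/2 each, and any other
    nonzero term comes from a split and is nonpositive. *)
Lemma ursell_sum_lt0 A B : no_triple -> F [set: 'I_n]%SET <= 1 ->
  A != set0 -> ~: A != set0 -> B != set0 -> ~: B != set0 ->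
  A != B -> A != ~: B ->
  2^-1 < F A * F (~: A) -> 2^-1 < F B * F (~: B) -> ursell_sum < 0.
Proof.
move=> h FT A0 A0' B0 B0' AB AB' hA hB.
have TA C : ~: C != set0 -> C != [set: 'I_n]%SET.
  by apply: contraNneq => ->; rewrite setCT.
have nT C : C != set0 -> ~: C != set0 ->
    [set C; ~: C]%SET != [set [set: 'I_n]]%SET.
  move=> C0 C0'; apply/eqP => /setP /(_ C); rewrite !inE eqxx /=.
  by move/esym/eqP => CT; move: C0'; rewrite CT setCT eqxx.
have nAB : [set A; ~: A]%SET != [set B; ~: B]%SET.
  apply/eqP => /setP /(_ A); rewrite !inE eqxx /=.
  by rewrite (negbTE AB) (negbTE AB').
rewrite /ursell_sum (bigD1 [set [set: 'I_n]]%SET) ?partitionT //= term1.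
rewrite (bigD1 [set A; ~: A]%SET) /=; last by rewrite partition_split ?nT.
rewrite (bigD1 [set B; ~: B]%SET) /=; last first.
  by rewrite partition_split ?nT //= eq_sym.
rewrite !term2 ?neq_setC //.
set s := \sum_(_ | _) _; suff : s <= 0 by lra.
apply: sumr_le0 => P /andP[/andP[/andP[PT P1] P2] P3].
have [->//|/(term_no_triple h PT)[PE|[C [-> C0 _]]]] := eqVneq (ursell_term P) 0.
  by rewrite PE eqxx in P1.
exact: term2_le0.
Qed.

(** At most one split contributes, and the one-block term dominates it. *)
Lemma ursell_sum_ge0_split : no_triple ->
  (forall A, F A * F (~: A) <= F [set: 'I_n]%SET) ->
  (forall A B, A != set0 -> ~: A != set0 -> B != set0 -> ~: B != set0 ->
     F A * F (~: A) != 0 -> F B * F (~: B) != 0 -> A = B \/ A = ~: B) ->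
  0 <= ursell_sum.
Proof.
move=> h gks uniq_split.
case: (boolP [exists A : {set 'I_n}, [&& A != set0, ~: A != set0 &
    F A * F (~: A) != 0]]) => [/existsP[A /and3P[A0 A0' FA]]|].
  have nT : [set A; ~: A]%SET != [set [set: 'I_n]]%SET.
    apply/eqP => /setP /(_ A); rewrite !inE eqxx /=.
    by move/esym/eqP => CT; move: A0'; rewrite CT setCT eqxx.
  rewrite (ursell_sum_on (S := [set [set A; ~: A]; [set [set: 'I_n]]]%SET)).
  - rewrite big_setU1 ?inE //= big_set1 term1 term2 ?neq_setC //.
    by have := gks A; lra.
  - by move=> P; rewrite !inE => /orP[] /eqP ->; rewrite ?partition_split ?partitionT.
  move=> P PT t0; have F0 := term_neq0 t0; rewrite !inE.
  have [->|[B [PE B0 B0']]] := term_no_triple h PT t0; first by rewrite eqxx orbT.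
  have FB : F B * F (~: B) != 0.
    by rewrite mulf_neq0 // F0 // PE !inE eqxx ?orbT.
  have [AB|AB] := uniq_split A B A0 A0' B0 B0' FA FB.
    by rewrite PE AB eqxx.
  by rewrite PE AB setCK setUC eqxx.
rewrite negb_exists => /forallP nsp.
rewrite (ursell_sum_on (S := [set [set [set: 'I_n]]]%SET)).
- by rewrite big_set1 term1.
- by move=> P; rewrite inE => /eqP ->; exact: partitionT.
move=> P PT t0; have F0 := term_neq0 t0; rewrite inE.
have [->//|[B [PE B0 B0']]] := term_no_triple h PT t0.
have := nsp B; rewrite B0 B0' /= negbK mulf_eq0.
have /negbTE -> : F B != 0 by rewrite F0 // PE !inE eqxx.
by have /negbTE -> : F (~: B) != 0 by rewrite F0 // PE !inE eqxx orbT.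
Qed.

End Ursell.

(** * Even sets of edges *)

Section Edges.
Variable m : nat.
Notation edge := (site m * site m)%type.
Implicit Types (x y w : site m).

Lemma nn_coord x y : nn (x, y) -> exists k,
  (forall l, l != k -> y ord0 l = x ord0 l) /\ `|y ord0 k - x ord0 k| = 1.
Proof.
rewrite /nn /= => /eqP s1.
have [k dk] : exists k, (y - x) ord0 k != 0.
  apply: contrapT => h; move: s1; rewrite big1 // => k _.
  by have [->|dk] := eqVneq ((y - x) ord0 k) 0; [rewrite normr0|case: h; exists k].
move: s1; rewrite (bigD1 k) //= => s1.
have r0 : 0 <= \sum_(i < m | i != k) `|(y - x) ord0 i| by apply: sumr_ge0.
have r00 : \sum_(i < m | i != k) `|(y - x) ord0 i| = 0.
  by move: s1 r0 dk; move: (\sum_(i < m | _) _) ((y - x) ord0 k) => S d; lia.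
exists k; split=> [l lk|]; last by move: s1; rewrite r00 addr0 !mxE.
have /eqP := r00; rewrite psumr_eq0 // => /allP /(_ l).
rewrite mem_index_enum lk /= normr_eq0 !mxE subr_eq0 => /(_ isT) /eqP.
by [].
Qed.

Lemma nn_neq x y : nn (x, y) -> x != y.
Proof.
case/nn_coord => k [_]; apply: contra_eqN => /eqP ->.
by rewrite subrr normr0.
Qed.

Lemma nnC x y : nn (x, y) = nn (y, x).
Proof. exact: (nn_rev (y, x)). Qed.

(** The bipartition of the lattice. *)
Definition color x : bool := odd `|(\sum_i x ord0 i)%R|%N.

Lemma color_nn x y : nn (x, y) -> color y = ~~ color x.
Proof.
case/nn_coord => k [yx yk]; rewrite /color (bigD1 k) //= [in RHS](bigD1 k) //=.
rewrite (eq_bigr (fun i => x ord0 i)) => [|i /yx //].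
move: (\sum_(i < m | _) _) yk => S; move: (x ord0 k) (y ord0 k) => a b; lia.
Qed.

(** Let [x] and [y] differ in coordinate [i]. A common neighbour is determined by whether it agrees
    with [x] at [i]: if it does, it agrees with [y] everywhere else; if not, it agrees with [x]
    everywhere else and its value at [i] is forced. So there are at most two. *)
Lemma common_nbr x y w1 w2 w3 : x != y ->
  nn (x, w1) -> nn (x, w2) -> nn (x, w3) ->
  nn (y, w1) -> nn (y, w2) -> nn (y, w3) ->
  w1 != w2 -> w2 != w3 -> w3 != w1 -> False.
Proof.
move=> xy; have [i xyi] : exists i, x ord0 i != y ord0 i.
  apply: contrapT => h; case/negP: xy; apply/eqP/rowP => i.
  by have [//|n] := eqVneq (x ord0 i) (y ord0 i); case: h; exists i.
have det w w' : nn (x, w) -> nn (y, w) -> nn (x, w') -> nn (y, w') ->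
    (w ord0 i == x ord0 i) = (w' ord0 i == x ord0 i) -> w = w'.
  move=> /nn_coord[k [xw xk]] /nn_coord[l [yw yl]].
  move=> /nn_coord[k' [xw' xk']] /nn_coord[l' [yw' yl']].
  have [wx /esym/eqP wx'|wx /esym/negbT wx'] := eqVneq (w ord0 i) (x ord0 i).
    have li : l = i by apply/eqP; apply: contraT => h; case/negP: xyi;
        rewrite -wx yw // eq_sym.
    have li' : l' = i.
      by apply/eqP; apply: contraT => h; case/negP: xyi; rewrite -wx' yw' // eq_sym.
    subst l l'; apply/rowP => j; have [->|ji] := eqVneq j i; first by rewrite wx wx'.
    by rewrite yw // yw'.
  have ki : k = i by apply/eqP; apply: contraT => h; case/negP: wx; rewrite xw // eq_sym.
  have ki' : k' = i by apply/eqP; apply: contraT => h;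
    case/negP: wx'; rewrite xw' // eq_sym.
  subst k k'; apply/rowP => j; have [->|ji] := eqVneq j i; last by rewrite xw // xw'.
  have hl : w ord0 i = y ord0 i \/ `|w ord0 i - y ord0 i| = 1.
    by have [e|ne] := eqVneq i l; [right; rewrite {1 2}e|left; exact: yw].
  have hl' : w' ord0 i = y ord0 i \/ `|w' ord0 i - y ord0 i| = 1.
    by have [e|ne] := eqVneq i l'; [right; rewrite {1 2}e|left; exact: yw'].
  move: xk xk' hl hl' xyi; move: (w ord0 i) (w' ord0 i) (x ord0 i) (y ord0 i); lia.
move=> x1 x2 x3 y1 y2 y3 w12 w23 w31.
have := det w1 w2 x1 y1 x2 y2; have := det w2 w3 x2 y2 x3 y3.
have := det w3 w1 x3 y3 x1 y1.
case: (w1 ord0 i == _); case: (w2 ord0 i == _); case: (w3 ord0 i == _) => //;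
  do ?[move=> /(_ erefl) h; by rewrite h eqxx in w12 w23 w31 | move=> _].
Qed.

Definition opp x (f : edge) : site m := if x == f.1 then f.2 else f.1.

Lemma inc_nn x (f : edge) : nn f -> inc x f = (x == f.1) || (x == f.2).
Proof.
case: f => a b /nn_neq /=; rewrite /inc /=.
by have [->|] := eqVneq x a; case: eqVneq.
Qed.

Lemma nn_opp x f : nn f -> inc x f -> nn (x, opp x f).
Proof.
move=> nf; rewrite inc_nn // /opp; case: f nf => a b /= nf.
by have [->//|_ /= /eqP ->] := eqVneq x a; rewrite nnC.
Qed.

Lemma inc_opp x f : nn f -> inc x f -> inc (opp x f) f.
Proof.
move=> nf; rewrite !inc_nn // /opp; case: (x == f.1); rewrite eqxx ?orbT //.
Qed.

Lemma inc2_nn x y f : nn f -> x != y -> inc x f -> inc y f -> nn (x, y).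
Proof.
move=> nf xy; rewrite !inc_nn //; case: f nf => a b /= nf.
by case/orP => /eqP ex; case/orP => /eqP ey; subst x y;
  rewrite ?eqxx // in xy *; rewrite nnC.
Qed.

Lemma inc2_same x y f g : nn f -> nn g -> x != y ->
  inc x f -> inc y f -> inc x g -> inc y g -> same f g.
Proof.
move=> nf ng xy; rewrite !inc_nn // /same /rev_edge.
case: f nf => a b /= nf; case: g ng => c d /= ng.
by case/orP => /eqP ex; case/orP => /eqP ey; subst x y;
  rewrite ?eqxx // in xy *; case/orP => /eqP h; case/orP => /eqP h'; subst;
  rewrite ?eqxx ?orbT // in xy *.
Qed.

End Edges.

(** * Degree parities and cuts *)

Section EvenSets.
Variables (m n : nat) (e : 'I_n -> site m * site m).
Implicit Types (A B : {set 'I_n}) (x y : site m) (W : pred (site m)).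

Definition dpar A x : bool := \big[addb/false]_(i in A) inc x (e i).

Definition even_set A : Prop := forall x, dpar A x = false.

Definition cutp W A : bool :=
  \big[addb/false]_(i in A) (W (e i).1 (+) W (e i).2).

Lemma odd_card_set A (Q : pred 'I_n) :
  odd #|[set i in A | Q i]| = \big[addb/false]_(i in A) Q i.
Proof.
rewrite -sum1_card (big_morph odd oddD (erefl : odd 0 = false)) big_mkcond /=.
rewrite [RHS]big_mkcond /=; apply: eq_bigr => i _; rewrite inE.
by case: (i \in A); case: (Q i).
Qed.

Definition sel A : seq (site m * site m) := [seq e i | i <- enum A].

Lemma odd_sel A x : odd (count (inc x) (sel A)) = dpar A x.
Proof.
rewrite /sel count_map -sum1_count (big_morph odd oddD (erefl : odd 0 = false)).
rewrite big_mkcond /= big_enum /=; apply: eq_bigr => i _.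
by case: (inc x (e i)).
Qed.

(** A finite list containing every site of nonzero degree, so that sums over sites make sense. *)
Definition endpoints : seq (site m) :=
  undup (flatten [seq [:: (e i).1; (e i).2] | i <- enum 'I_n]).

Lemma mem_endpoints i : ((e i).1 \in endpoints) && ((e i).2 \in endpoints).
Proof.
rewrite !mem_undup; apply/andP; split; apply/flattenP;
  exists [:: (e i).1; (e i).2]; rewrite ?inE ?eqxx ?orbT //;
  by apply/mapP; exists i; rewrite ?mem_enum.
Qed.

Lemma xor_single (s : seq (site m)) W a : uniq s -> a \in s ->
  \big[addb/false]_(x <- s | W x) (x == a) = W a.
Proof.
move=> us sa; rewrite big_mkcond (bigD1_seq a) //= eqxx big1 ?addbF.
  by case: (W a).
by move=> x /negbTE ->; case: ifP.
Qed.

(** Double counting: an edge counts once for each end in [W], so modulo 2 only edges with exactly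
    one end in [W] remain. *)
Lemma cut_lemma W A : \big[addb/false]_(x <- endpoints | W x) dpar A x = cutp W A.
Proof.
rewrite /dpar exchange_big; apply: eq_bigr => i _.
have /andP[e1 e2] := mem_endpoints i.
by rewrite /inc big_split /= !xor_single ?undup_uniq.
Qed.

Lemma even_cut W A : even_set A -> cutp W A = false.
Proof. by move=> hA; rewrite -cut_lemma big1. Qed.

Lemma dparID A B x : dpar A x = dpar (A :&: B) x (+) dpar (A :\: B) x.
Proof. by rewrite {1}/dpar (big_setID B). Qed.

Lemma dparU A B x : [disjoint A & B] -> dpar (A :|: B) x = dpar A x (+) dpar B x.
Proof. by move=> AB; rewrite /dpar -bigU //; apply: eq_bigl => i; rewrite !inE. Qed.

Lemma even_setD A B : even_set A -> even_set (A :&: B) -> even_set (A :\: B).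
Proof. by move=> hA hI x; have := dparID A B x; rewrite hA hI. Qed.

Lemma even_setU A B : [disjoint A & B] -> even_set A -> even_set B ->
  even_set (A :|: B).
Proof. by move=> AB hA hB x; rewrite dparU // hA hB. Qed.

Lemma dpar_mem A x : dpar A x -> exists2 i, i \in A & inc x (e i).
Proof.
move=> d; apply: contrapT => h; move: d; rewrite /dpar big1 // => i iA.
by case: (boolP (inc x (e i))) => // xi; case: h; exists i.
Qed.

Lemma dpar_other A x i : dpar A x = false -> i \in A -> inc x (e i) ->
  exists2 j, j \in A & (j != i) && inc x (e j).
Proof.
move=> d iA xi; apply: contrapT => h; move: d.
rewrite /dpar (bigD1 i) //= xi big1 // => j /andP[jA ji].
by case: (boolP (inc x (e j))) => // xj; case: h; exists j; rewrite ?ji.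
Qed.

Lemma dpar_endpoint A x : dpar A x -> x \in endpoints.
Proof.
case/dpar_mem => i _; have /andP[e1 e2] := mem_endpoints i.
rewrite /inc; have [->//|_] := eqVneq x (e i).1.
by rewrite addFb => /eqP ->.
Qed.

(** The handshake lemma, obtained from the cut around all sites. *)
Lemma dpar_second A x : dpar A x -> exists2 y, y != x & dpar A y.
Proof.
move=> d; apply: contrapT => h.
have := cut_lemma xpredT A.
rewrite (bigD1_seq x) ?undup_uniq ?(dpar_endpoint d) //= d big1.
  by rewrite /cutp big1 // => j _; rewrite addbb.
move=> y yx; case: (boolP (dpar A y)) => // dy; case: h; exists y => //.
Qed.

Hypothesis he : edges e.

(** Every edge joins the two colours, so the cut between them is all of [A]. *)
Lemma even_card A : even_set A -> ~~ odd #|A|.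
Proof.
move=> hA; have := even_cut (@color m) hA; rewrite /cutp -odd_card_set => h.
suff AE : A = [set i in A | color (e i).1 (+) color (e i).2] by rewrite AE h.
apply/setP => i; rewrite inE andb_idr // => _.
have := he i; rewrite [e i]surjective_pairing => /color_nn -> /=.
by case: (color _).
Qed.

Hypothesis hd : distinct_edges e.

Lemma same_inj i j : same (e i) (e j) -> i = j.
Proof.
move=> h; apply/eqP; apply: contraT => ij; move: h; rewrite /same.
have [_ /(_ j i)] := hd; rewrite eq_sym => /(_ ij)[/negbTE -> ].
by move/negbTE ->.
Qed.

Lemma inc2_inj x y i j : x != y -> inc x (e i) -> inc y (e i) ->
  inc x (e j) -> inc y (e j) -> i = j.
Proof. by move=> xy *; apply: same_inj; apply: (inc2_same _ _ xy). Qed.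

(** An edge of [A] meets another edge of [A] at each end, and these two differ because distinct
    edges share at most one end. That makes three edges, and parity gives a fourth. *)
Lemma even_card_ge4 A : even_set A -> A != set0 -> (4 <= #|A|)%N.
Proof.
move=> hA /set0Pn[i iA].
suff : (2 < #|A|)%N.
  rewrite leq_eqVlt => /orP[/eqP e3|//].
  by have := even_card hA; rewrite -e3.
have i1 : inc (e i).1 (e i) by rewrite inc_nn ?eqxx.
have i2 : inc (e i).2 (e i) by rewrite inc_nn ?eqxx ?orbT.
have i12 : (e i).1 != (e i).2.
  by have := he i; rewrite {1}[e i]surjective_pairing => /nn_neq.
have [j jA /andP[ji j1]] := dpar_other (hA _) iA i1.
have [k kA /andP[ki k2]] := dpar_other (hA _) iA i2.
apply/card_gt2P; exists i, j, k; split=> //; split=> //; first by rewrite eq_sym.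
apply: contraNneq ji => jk; apply/eqP; apply: (inc2_inj i12) => //.
by rewrite jk.
Qed.

(** * Even sets whose intersection is not even *)

Section Crossing.
Variables (A B : {set 'I_n}).
Hypothesis hT : even_set [set: 'I_n].
Hypothesis hA : even_set A.
Hypothesis hB : even_set B.

Lemma dpar_parts x :
  [/\ dpar (A :\: B) x = dpar (A :&: B) x, dpar (B :\: A) x = dpar (A :&: B) x &
      dpar (~: (A :|: B)) x = dpar (A :&: B) x].
Proof.
have d1 : dpar (A :\: B) x = dpar (A :&: B) x.
  by have := dparID A B x; rewrite hA; case: (dpar _ _); case: (dpar _ _).
have d2 : dpar (B :\: A) x = dpar (A :&: B) x.
  have := dparID B A x; rewrite hB [B :&: A]setIC.
  by case: (dpar _ _); case: (dpar _ _).
split=> //; have := dparID [set: 'I_n] (A :|: B) x.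
rewrite hT setTI setTD (dparID _ A) setUK setDUl setDv set0U hA d2.
by case: (dpar _ _); case: (dpar _ _).
Qed.

Lemma card_parts (Q : pred 'I_n) :
  (exists2 i, i \in A :&: B & Q i) -> (exists2 i, i \in A :\: B & Q i) ->
  (exists2 i, i \in B :\: A & Q i) -> (exists2 i, i \in ~: (A :|: B) & Q i) ->
  (4 <= #|[set i | Q i]|)%N.
Proof.
move=> [i1 /setIP[a1 b1] q1] [i2 /setDP[a2 b2] q2] [i3 /setDP[b3 a3] q3] [i4].
rewrite inE in_setU negb_or => /andP[a4 b4] q4.
have u : uniq [:: i1; i2; i3; i4].
  rewrite /= !inE !negb_or andbT.
  by do ?[apply/andP; split]; apply: contraTneq isT => E; subst;
     move: a1 b1 a2 b2 a3 b3 a4 b4 => //=; do ?[move=> -> //| move=> _].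
rewrite -[4%N]/(size [:: i1; i2; i3; i4]) -(card_uniqP u) subset_leq_card //.
by apply/subsetP => i; rewrite !inE => /or4P[] /eqP ->.
Qed.

(** All four parts have the same odd vertices, so each of them has an odd number of edges across the
    cut, hence at least one. *)
Lemma cut_crossing W : \big[addb/false]_(x <- endpoints | W x) dpar (A :&: B) x ->
  (4 <= #|[set i | W (e i).1 (+) W (e i).2]|)%N.
Proof.
move=> d.
have pick C : (forall x, dpar C x = dpar (A :&: B) x) ->
    exists2 i, i \in C & W (e i).1 (+) W (e i).2.
  move=> hC; apply: contrapT => h; move: d.
  rewrite -(eq_bigr _ (fun x _ => hC x)) cut_lemma /cutp big1 // => i iC.
  by case: (boolP (_ (+) _)) => // Wi; case: h; exists i.
by apply: card_parts; apply: pick => // x; have [] := dpar_parts x.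
Qed.

Lemma degree_crossing x : dpar (A :&: B) x -> (4 <= #|[set i | inc x (e i)]|)%N.
Proof.
move=> d; have [d1 d2 d3] := dpar_parts x.
by apply: card_parts; apply: dpar_mem; rewrite ?d1 ?d2 ?d3.
Qed.

(** Two odd vertices [x], [y] have degree at least 4, while parity leaves at most 8 edges. Every
    neighbour of [x] along an edge needs a second edge, and too few edges are left for that. *)
Lemma even_setI_small : (n <= 9)%N -> even_set (A :&: B).
Proof.
move=> n9 x; apply/negbTE/negP => dx.
have [y yx dy] := dpar_second dx.
have n8 : (n <= 8)%N.
  have := even_card hT; rewrite cardsT card_ord; move: n9.
  by rewrite leq_eqVlt => /orP[/eqP ->|].
set Ix := [set i | inc x (e i)]; set Iy := [set i | inc y (e i)].
have Ix4 : (4 <= #|Ix|)%N := degree_crossing dx.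
have Iy4 : (4 <= #|Iy|)%N := degree_crossing dy.
have xy : x != y by rewrite eq_sym.
have cU := cardsUI Ix Iy.
have cT : (#|Ix :|: Iy| + #|~: (Ix :|: Iy)| = n)%N by rewrite cardsC card_ord.
pose w i := opp x (e i).
have nw i : i \in Ix -> nn (x, w i) by rewrite inE; apply: nn_opp.
have winj i j : i \in Ix -> j \in Ix -> i != j -> w i != w j.
  move=> iI jI; apply: contraNneq => wij; apply/eqP.
  have /nn_neq xw := nw _ iI; move: iI jI; rewrite !inE => iI jI.
  by apply: (inc2_inj xw) => //; [exact: inc_opp|rewrite wij; exact: inc_opp].
have next i : i \in Ix -> exists2 j, inc (w i) (e j) & (j != i) && (j \notin Ix).
  move=> iI; have xi := iI; rewrite inE in xi.
  have [j _ /andP[ji wj]] := dpar_other (hT (w i)) (in_setT i) (inc_opp (he i) xi).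
  exists j => //; rewrite ji /= inE; apply: contra ji => xj; apply/eqP.
  apply: (inc2_inj (nn_neq (nw i iI))) => //; exact: inc_opp.
(* If no edge joins [x] and [y], the edges at these two sites are all the edges, so three neighbours
   of [x] would also be neighbours of [y]. *)
have [I0|] := eqVneq (Ix :&: Iy) set0.
  have [i1 [i2 [i3 [[h1 h2 h3] [h12 h23 h31]]]]] := card_gt2P (ltnW Ix4 : (2 < #|Ix|)%N).
  have UT j : j \notin Ix -> inc y (e j).
    move=> jx; suff : j \in Ix :|: Iy by rewrite inE (negbTE jx) inE.
    have /eqP : #|~: (Ix :|: Iy)| = 0%N.
      rewrite I0 cards0 in cU; move: cU cT Ix4 Iy4 n8.
      by move: #|Ix| #|Iy| #|_ :|: _| #|~: _| => a b c d; clear; lia.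
    by rewrite cards_eq0 => /eqP/setP/(_ j); rewrite in_setC in_set0 => /negbFE.
  have ny i : i \in Ix -> nn (y, w i).
    move=> iI; have [j wj /andP[ji /UT yj]] := next i iI.
    apply: (inc2_nn (he j)) => //; apply/eqP => yw.
    have /setP /(_ i) := I0; rewrite in_setI iI in_set0 inE /= yw.
    by rewrite inE in iI; rewrite (inc_opp (he i) iI).
  exact: (common_nbr xy (nw _ h1) (nw _ h2) (nw _ h3) (ny _ h1) (ny _ h2) (ny _ h3)
    (winj _ _ h1 h2 h12) (winj _ _ h2 h3 h23) (winj _ _ h3 h1 h31)).
(* If an edge joins them, at most one edge avoids both [x] and [y], and it would have to meet three
   further neighbours of [x]. *)
case/set0Pn => i0 /setIP[]; rewrite !inE => x0 y0.
have nxy : nn (x, y) := inc2_nn (he i0) xy x0 y0.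
have I1 : (#|Ix :&: Iy| <= 1)%N.
  apply/card_le1_eqP => i j /setIP[]; rewrite !inE => xi yi /andP[xj yj].
  exact: (inc2_inj xy).
have R1 : (#|~: (Ix :|: Iy)| <= 1)%N by lia.
have Ix3 : (2 < #|Ix :\ i0|)%N.
  have i0I : i0 \in Ix by rewrite inE.
  by move: Ix4; rewrite (cardsD1 i0 Ix) i0I.
have [i1 [i2 [i3 [[h1 h2 h3] [h12 h23 h31]]]]] := card_gt2P Ix3.
have inR i : i \in Ix :\ i0 -> exists2 j, inc (w i) (e j) & j \in ~: (Ix :|: Iy).
  rewrite in_setD1 => /andP[ii0 iI]; have [j wj /andP[ji jx]] := next i iI.
  exists j => //; rewrite !in_setC in_setU negb_or jx /= inE; apply/negP => yj.
  have xi := iI; rewrite inE in xi.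
  have yw : y != w i.
    apply: contraNneq ii0 => yw; apply/eqP; apply: (inc2_inj xy) => //.
    by rewrite yw; exact: inc_opp.
  (* Both [y] and [w i] are neighbours of [x], so they have the same colour and cannot be
     adjacent. *)
  have := color_nn (inc2_nn (he j) yw yj wj); rewrite (color_nn (nw i iI)).
  by rewrite (color_nn nxy); case: (color x).
have [j1 w1 R1'] := inR _ h1; have [j2 w2 R2'] := inR _ h2.
have [j3 w3 R3'] := inR _ h3.
have j12 := card_le1_eqP R1 _ _ R1' R2'; have j13 := card_le1_eqP R1 _ _ R1' R3'.
subst j2 j3; move: h1 h2 h3; rewrite !in_setD1 => /andP[_ h1] /andP[_ h2] /andP[_ h3].
have := winj _ _ h1 h2 h12; have := winj _ _ h2 h3 h23; have := winj _ _ h3 h1 h31.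
move: w1 w2 w3; rewrite !inc_nn //.
by do 3!case/orP => /eqP ->; rewrite ?eqxx.
Qed.

End Crossing.

End EvenSets.

(** * Stability under intersection in the plane *)

Section PlanarCrossing.
Notation o0 := (ord0 : 'I_2).
Notation o1 := (ord_max : 'I_2).
Variables (n : nat) (e : 'I_n -> site 2 * site 2).
Hypothesis hd : distinct_edges e.
Hypothesis hT : even_set e [set: 'I_n].

Let he : edges e. Proof. by case: hd. Qed.

Lemma ord2_neq (i l : 'I_2) : l != i -> l = rev_ord i.
Proof. by case: (ord2P i) => ->; case: (ord2P l) => -> // _; apply: val_inj. Qed.

Lemma rev_ord2 (i : 'I_2) : rev_ord i != i.
Proof. by case: (ord2P i) => ->. Qed.

Lemma site2_eq (i : 'I_2) (x y : site 2) : x ord0 i = y ord0 i ->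
  x ord0 (rev_ord i) = y ord0 (rev_ord i) -> x = y.
Proof.
move=> xi xj; apply/rowP => l; have [->//|/ord2_neq ->//] := eqVneq l i.
Qed.

Lemma inc_same (x : site 2) f g : same f g -> inc x f = inc x g.
Proof. by case/orP => /eqP ->; rewrite ?inc_rev. Qed.

Lemma nn_dirs (x w : site 2) : nn (x, w) -> exists k, w = x + dir k \/ w = x - dir k.
Proof.
case/nn_coord => k [h hk]; exists k.
have [|] : w ord0 k = x ord0 k + 1 \/ w ord0 k = x ord0 k - 1.
- by move: hk; move: (w ord0 k) (x ord0 k) => a b; lia.
- move=> wk; left; apply/rowP => l; rewrite mxE dirE.
  by have [->|/h ->] := eqVneq l k; rewrite ?addr0.
move=> wk; right; apply/rowP => l; rewrite !mxE eqxx /=.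
by have [->|/h ->] := eqVneq l k; rewrite ?subr0.
Qed.

(** Distinct edges at [x] lead to distinct neighbours, and [x] has only four of them. *)
Lemma full_degree (x w : site 2) : (4 <= #|[set k | inc x (e k)]|)%N -> nn (x, w) ->
  exists k, same (x, w) (e k).
Proof.
move=> d4 xw; set Ix := [set k | inc x (e k)] in d4.
pose N := [:: x + dir o0; x + dir o1; x - dir o0; x - dir o1].
have NP y : nn (x, y) -> y \in N.
  case/nn_dirs => k [] ->; rewrite !inE;
    by case: (ord2P k) => ->; rewrite eqxx ?orbT.
pose s := [seq opp x (e k) | k <- enum Ix].
have incI k : k \in enum Ix -> inc x (e k) by rewrite mem_enum inE.
have us : uniq s.
  rewrite map_inj_in_uniq ?enum_uniq // => k l /incI xk /incI xl eq_opp.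
  apply: (inc2_inj he hd (nn_neq (nn_opp (he k) xk))) => //.
    exact: inc_opp.
  by rewrite eq_opp; exact: inc_opp.
have sN : {subset s <= N}.
  by move=> _ /mapP[k /incI xk ->]; apply: NP; exact: nn_opp.
have sz : (size N <= size s)%N by rewrite size_map -cardE.
have [_ sE] := uniq_min_size us sN sz.
have := NP w xw; rewrite -sE => /mapP[k /incI xk wE]; exists k.
apply: (inc2_same xw (he k) (nn_neq xw)) => //.
- by rewrite inc_nn // eqxx.
- by rewrite inc_nn // eqxx orbT.
by rewrite wE; exact: inc_opp.
Qed.

Lemma opp_sum (x : site 2) f : nn f -> inc x f -> forall k,
  x ord0 k + (opp x f) ord0 k = f.1 ord0 k + f.2 ord0 k.
Proof.
move=> nf + k; rewrite inc_nn // /opp.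
by have [->//|_ /= /eqP ->] := eqVneq x f.1; rewrite addrC.
Qed.

Section Direction.
Variable i : 'I_2.
Notation j := (rev_ord i).

(** The edges crossing the line between coordinates [c] and [c + 1]. As a cut of an even set it has
    even size. *)
Definition strip (k : 'I_2) (c : int) : {set 'I_n} :=
  [set l | ((e l).1 ord0 k <= c) (+) ((e l).2 ord0 k <= c)].

Definition along : {set 'I_n} := [set l | (e l).1 ord0 i != (e l).2 ord0 i].

Lemma strip_even k c : ~~ odd #|strip k c|.
Proof.
have := even_cut (fun x : site 2 => x ord0 k <= c) hT.
rewrite /cutp -odd_card_set => h; suff -> : strip k c = [set l in [set: 'I_n] |
  ((e l).1 ord0 k <= c) (+) ((e l).2 ord0 k <= c)] by rewrite h.
by apply/setP => l; rewrite !inE.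
Qed.

Lemma strip_along c : strip i c \subset along.
Proof.
apply/subsetP => l; rewrite !inE; apply: contraL => /eqP ->.
by rewrite addbb.
Qed.

Lemma alongP l : l \in along -> (e l).1 ord0 j = (e l).2 ord0 j /\
  exists c, l \in strip i c /\
   (((e l).1 ord0 i = c /\ (e l).2 ord0 i = c + 1) \/
    ((e l).2 ord0 i = c /\ (e l).1 ord0 i = c + 1)).
Proof.
rewrite inE => h; have := he l; rewrite [e l]surjective_pairing.
case/nn_coord => k [hk h1].
have ki : k = i by apply/eqP; apply: contraNT h => ki; rewrite hk // eq_sym.
subst k; split; first by rewrite hk ?rev_ord2.
move: h1; rewrite /strip; move Ea: ((e l).1 ord0 i) => a.
move Eb: ((e l).2 ord0 i) => b h1.
exists (Num.min a b); rewrite inE Ea Eb; split; last by lia.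
by lia.
Qed.

Lemma not_alongP l : l \notin along -> (e l).1 ord0 i = (e l).2 ord0 i /\
  `|(e l).2 ord0 j - (e l).1 ord0 j| = 1.
Proof.
rewrite inE negbK => /eqP h; split=> //.
have := he l; rewrite [e l]surjective_pairing => /nn_coord[k [hk]].
have [-> |/ord2_neq -> //] := eqVneq k i.
by rewrite -h subrr normr0.
Qed.

Lemma strip_inj l c c' : l \in strip i c -> l \in strip i c' -> c = c'.
Proof.
move=> lc; have /alongP[_ [d [_ h]]] := subsetP (strip_along c) l lc.
move: lc h; rewrite !inE; move: ((e l).1 ord0 i) ((e l).2 ord0 i) => a b; lia.
Qed.

Lemma strip_disjoint c c' : c != c' -> [disjoint strip i c & strip i c'].
Proof.
move=> cc'; rewrite disjoints_subset; apply/subsetP => l lc; rewrite inE.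
by apply: contra cc' => lc'; apply/eqP; exact: strip_inj lc'.
Qed.

Lemma strip_card3 c c' c'' : c != c' -> c' != c'' -> c != c'' ->
  (#|strip i c| + #|strip i c'| + #|strip i c''| <= #|along|)%N.
Proof.
move=> h1 h2 h3.
have /eqP e1 : strip i c :&: strip i c' == set0 by rewrite setI_eq0 strip_disjoint.
have /eqP e2 : (strip i c :|: strip i c') :&: strip i c'' == set0.
  by rewrite setIUl setU_eq0 !setI_eq0 !strip_disjoint.
have := cardsUI (strip i c) (strip i c').
have := cardsUI (strip i c :|: strip i c') (strip i c'').
rewrite e1 e2 !cards0 !addn0 => h <-; rewrite -h; apply: subset_leq_card.
by rewrite !subUset !strip_along.
Qed.

Lemma strip_ge2 c l : l \in strip i c -> (2 <= #|strip i c|)%N.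
Proof.
move=> lc; have := strip_even i c.
have : (0 < #|strip i c|)%N by rewrite card_gt0; apply/set0Pn; exists l.
by case: #|_| => [|[|]].
Qed.

(* A highest vertical edge of the column has an upper end, which can only be
   even thanks to an odd number of horizontal edges. *)
Lemma column_lemma l : l \notin along ->
  exists2 x : site 2, x ord0 i = (e l).1 ord0 i & dpar e along x.
Proof.
move=> lV; pose b : int := (e l).1 ord0 i.
pose Col := [set k | (k \notin along) && ((e k).1 ord0 i == b)].
have lC : l \in enum Col by rewrite mem_enum in_set lV eqxx.
have [k] := seq_argmax (fun k => (e k).1 ord0 j + (e k).2 ord0 j) lC.
rewrite mem_enum in_set => /andP[kV /eqP kb] kmax.
have [ki kj] := not_alongP kV.
pose x := if (e k).1 ord0 j <= (e k).2 ord0 j then (e k).2 else (e k).1.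
have xb : x ord0 i = b by rewrite /x; case: ifP; rewrite -?ki kb.
have xk : inc x (e k) by rewrite inc_nn // /x; case: ifP; rewrite eqxx ?orbT.
exists x => //; have := hT x; rewrite (dparID _ _ along) setTI setTD.
suff -> : dpar e (~: along) x by case: (dpar _ _).
rewrite /dpar (bigD1 k) ?in_setC // xk big1 // => l' /andP[].
rewrite in_setC => l'V l'k; apply/negbTE/negP => xl'.
have [l'i l'j] := not_alongP l'V.
have l'b : (e l').1 ord0 i = b.
  by move: xl'; rewrite inc_nn // => /orP[]/eqP E; [rewrite -E|rewrite l'i -E].
have := kmax l'; rewrite mem_enum in_set l'V l'b eqxx => /(_ isT) le.
case/negP: l'k; apply/eqP/(same_inj hd).
have xj : 2 * x ord0 j = (e k).1 ord0 j + (e k).2 ord0 j + 1.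
  by move: kj; rewrite /x; case: ifP => + + ; lia.
have yz : opp x (e k) = opp x (e l').
  have s1 := opp_sum (he k) xk; have s2 := opp_sum (he l') xl'.
  apply: (@site2_eq i).
    by move: (s1 i) (s2 i); rewrite -ki -l'i kb l'b; lia.
  have nj : `|(opp x (e l')) ord0 j - x ord0 j| = 1.
    move: xl' l'j; rewrite inc_nn // /opp.
    by have [-> //|_ /= /eqP ->] := eqVneq x (e l').1; rewrite distrC.
  by move: (s1 j) (s2 j) kj l'j nj le xj; lia.
apply: (inc2_same (he l') (he k) (nn_neq (nn_opp (he k) xk))) => //.
- by rewrite yz; exact: inc_opp.
- exact: inc_opp.
Qed.

Lemma same_strip c (f g : site 2) l : same (f, g) (e l) ->
  f ord0 i <= c < g ord0 i -> l \in strip i c.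
Proof. by move/orP => [] /eqP E /andP[h1 h2]; rewrite inE E /= h1 leNgt h2. Qed.

Lemma right_edge (u : site 2) : (4 <= #|[set k | inc u (e k)]|)%N ->
  exists2 l, same (u, u + dir i) (e l) & l \in strip i (u ord0 i).
Proof.
move=> u4; have [l el] := full_degree u4 (nn_hedge u i); exists l => //.
by apply: (same_strip el); rewrite mxE dirE eqxx lexx ltrDl.
Qed.

Lemma left_edge (u : site 2) : (4 <= #|[set k | inc u (e k)]|)%N ->
  exists2 l, same (u, u - dir i) (e l) & l \in strip i (u ord0 i - 1).
Proof.
have nu : nn (u, u - dir i).
  by rewrite nnC; have := nn_hedge (u - dir i) i; rewrite /hedge subrK.
move=> u4; have [l el] := full_degree u4 nu; exists l => //.
move: el; rewrite -same_revl => /same_strip; apply.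
by rewrite /= !mxE !eqxx lexx ltrBlDr ltrDl.
Qed.

(** The two adjacent strips then consist only of the horizontal edges at [u] and [v], so every
    vertex of the column has 0 or 2 horizontal edges. But [u] also has a vertical edge, and
    [column_lemma] asks for a vertex with an odd number. *)
Lemma thin_column (u v : site 2) : u != v -> u ord0 i = v ord0 i ->
  (4 <= #|[set k | inc u (e k)]|)%N -> (4 <= #|[set k | inc v (e k)]|)%N ->
  (#|strip i (u ord0 i)| <= 2)%N -> (#|strip i (u ord0 i - 1)| <= 2)%N -> False.
Proof.
move=> uv uvi u4 v4 s2 s2'; pose a : int := u ord0 i; rewrite -/a in s2 s2'.
have aE (w : site 2) : w ord0 i = a -> (w + dir i) ord0 i = a + 1.
  by move=> <-; rewrite mxE dirE eqxx.
have aE' (w : site 2) : w ord0 i = a -> (w - dir i) ord0 i = a - 1.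
  by move=> <-; rewrite !mxE !eqxx.
have na : a != a + 1 by rewrite eq_sym -subr_eq0 addrAC subrr add0r.
have na' : a != a - 1 by rewrite eq_sym -subr_eq0 addrAC subrr sub0r oppr_eq0.
have two c l l' : l \in strip i c -> l' \in strip i c -> l != l' ->
    (#|strip i c| <= 2)%N -> strip i c = [set l; l'].
  move=> lc lc' ll' c2; apply/esym/eqP; rewrite eqEcard cards2 ll' c2 andbT.
  by apply/subsetP => k; rewrite in_set2 => /orP[] /eqP ->.
have [ku eku kuS] := right_edge u4; have [kv ekv kvS] := right_edge v4.
have [ku' eku' kuS'] := left_edge u4; have [kv' ekv' kvS'] := left_edge v4.
rewrite -uvi -/a in kvS kvS'.
have hu (x : site 2) : x ord0 i = a -> inc x (e ku) = (x == u).
  move=> xa; rewrite -(inc_same x eku) /inc /=; case: (eqVneq x (u + dir i)).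
    by move=> E; case/eqP: na; rewrite -(aE u erefl) -E xa.
  by rewrite addbF.
have hv (x : site 2) : x ord0 i = a -> inc x (e kv) = (x == v).
  move=> xa; rewrite -(inc_same x ekv) /inc /=; case: (eqVneq x (v + dir i)).
    by move=> E; case/eqP: na; rewrite -(aE v (esym uvi)) -E xa.
  by rewrite addbF.
have hu' (x : site 2) : x ord0 i = a -> inc x (e ku') = (x == u).
  move=> xa; rewrite -(inc_same x eku') /inc /=; case: (eqVneq x (u - dir i)).
    by move=> E; case/eqP: na'; rewrite -(aE' u erefl) -E xa.
  by rewrite addbF.
have hv' (x : site 2) : x ord0 i = a -> inc x (e kv') = (x == v).
  move=> xa; rewrite -(inc_same x ekv') /inc /=; case: (eqVneq x (v - dir i)).
    by move=> E; case/eqP: na'; rewrite -(aE' v (esym uvi)) -E xa.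
  by rewrite addbF.
have nuv : ku != kv.
  apply: contra uv => /eqP kk; rewrite -hv ?uvi // -kk hu ?eqxx //.
have nuv' : ku' != kv'.
  apply: contra uv => /eqP kk; rewrite -hv' ?uvi // -kk hu' ?eqxx //.
have S1 : strip i a = [set ku; kv] by apply: two.
have S2 : strip i (a - 1) = [set ku'; kv'] by apply: two.
have [kj ekj] := full_degree u4 (nn_hedge u j).
have dji (w : site 2) : (w + dir j) ord0 i = w ord0 i.
  by rewrite mxE dirE eq_sym (negbTE (rev_ord2 i)) addr0.
have kjV : kj \notin along.
  by rewrite inE negbK; case/orP: ekj => /eqP ->; rewrite /= dji.
have [x xi] := column_lemma kjV.
have xa : x ord0 i = a.
  by rewrite xi; case/orP: ekj => /eqP ->; rewrite //= dji.
have dU : [disjoint strip i a & strip i (a - 1)].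
  by apply: strip_disjoint; rewrite eq_sym -subr_eq0 addrAC subrr sub0r oppr_eq0.
rewrite (dparID _ _ (strip i a :|: strip i (a - 1))).
have /setIidPr -> : strip i a :|: strip i (a - 1) \subset along.
  by rewrite subUset !strip_along.
rewrite dparU // S1 S2 /dpar !big_setU1 ?inE //= !big_set1 hu // hv // hu' // hv' //.
rewrite addbb addFb big1 // => l /setDP[lA lU]; apply/negbTE; apply: contra lU => xl.
have [_ [c [lc h]]] := alongP lA.
move: xl; rewrite inc_nn // -S1 -S2 in_setU => /orP[] /eqP E; move: h;
  rewrite -E xa => -[] [h1 h2].
- by rewrite h1 lc.
- by rewrite h2 addrK lc orbT.
- by rewrite h2 addrK lc orbT.
by rewrite h1 lc.
Qed.

Lemma full_strips (u : site 2) : (4 <= #|[set k | inc u (e k)]|)%N ->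
  (2 <= #|strip i (u ord0 i)|)%N /\ (2 <= #|strip i (u ord0 i - 1)|)%N.
Proof.
move=> u4; have [l _ lS] := right_edge u4; have [l' _ lS'] := left_edge u4.
by split; [apply: strip_ge2 lS|apply: strip_ge2 lS'].
Qed.

Lemma even_gt2 a : ~~ odd a -> (2 < a)%N -> (4 <= a)%N.
Proof. by case: a => [|[|[|[|]]]]. Qed.

Lemma column_strip l : l \notin along ->
  (0 < #|strip i ((e l).1 ord0 i)|)%N \/ (0 < #|strip i ((e l).1 ord0 i - 1)|)%N.
Proof.
move=> /column_lemma[x xi /dpar_mem[k kA xk]].
have [_ [c [kc h]]] := alongP kA.
have cs : (0 < #|strip i c|)%N by rewrite card_gt0; apply/set0Pn; exists k.
rewrite -xi; move: xk; rewrite inc_nn // => /orP[] /eqP E; move: h;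
  rewrite -E => -[] [h1 h2]; rewrite ?h1 ?h2 ?addrK; auto.
Qed.

(** An edge across this line has its lower end at height [c], so its column determines it. *)
Lemma card_row_strip c (s : seq int) :
  (forall l, l \in strip j c -> (e l).1 ord0 i \in s) -> (#|strip j c| <= size s)%N.
Proof.
move=> h; rewrite cardE -(size_map (fun l => (e l).1 ord0 i)).
apply: uniq_leq_size; last first.
  by move=> _ /mapP[l lc ->]; apply: h; rewrite mem_enum in lc.
rewrite map_inj_in_uniq ?enum_uniq // => k l; rewrite !mem_enum => kc lc kl.
have nal l' : l' \in strip j c -> l' \notin along.
  rewrite inE; apply: contraL => /alongP[-> _]; by rewrite addbb.
have [ki kj] := not_alongP (nal _ kc); have [li lj] := not_alongP (nal _ lc).
apply: (same_inj hd); move: kc lc; rewrite !inE => kc lc.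
pose lo l' := if (e l').1 ord0 j <= (e l').2 ord0 j then (e l').1 else (e l').2.
pose hi l' := if (e l').1 ord0 j <= (e l').2 ord0 j then (e l').2 else (e l').1.
have loE : lo k = lo l.
  apply: (@site2_eq i); rewrite /lo.
    by case: ifP => _; case: ifP => _; rewrite -?ki -?li.
  move: kj lj kc lc; case: ifP; case: ifP;
  move: ((e k).1 ord0 j) ((e k).2 ord0 j) ((e l).1 ord0 j) ((e l).2 ord0 j);
  clear; lia.
have hiE : hi k = hi l.
  apply: (@site2_eq i); rewrite /hi.
    by case: ifP => _; case: ifP => _; rewrite -?ki -?li.
  move: kj lj kc lc; case: ifP; case: ifP;
  move: ((e k).1 ord0 j) ((e k).2 ord0 j) ((e l).1 ord0 j) ((e l).2 ord0 j);
  clear; lia.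
have incs l' : inc (lo l') (e l') /\ inc (hi l') (e l').
  by rewrite !inc_nn // /lo /hi; case: ifP => _; rewrite !eqxx ?orbT.
have lh : lo k != hi k.
  have /nn_neq : nn ((e k).1, (e k).2) by rewrite -surjective_pairing.
  by rewrite /lo /hi; case: ifP => _ //; rewrite eq_sym.
have [k1 k2] := incs k; have [l1 l2] := incs l.
by apply: (inc2_same (he k) (he l) lh) => //; rewrite ?loE ?hiE.
Qed.

(** An odd vertex has all four edges, so the strips on both sides of its column are occupied. With
    at most 7 edges along [i], this contradicts either [thin_column] or the four edges required by
    [cut_crossing]. *)
Lemma crossing_along (A B : {set 'I_n}) x : even_set e A -> even_set e B ->
  dpar e (A :&: B) x -> (8 <= #|along|)%N.
Proof.
move=> hA hB dx; rewrite leqNgt; apply/negP; rewrite ltnS => al7.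
set D := A :&: B in dx.
have deg4 u : dpar e D u -> (4 <= #|[set k | inc u (e k)]|)%N.
  exact: degree_crossing.
have full u : dpar e D u -> _ := fun du => full_strips (deg4 u du).
pose T := [seq y <- endpoints e | dpar e D y].
have memT y : (y \in T) = dpar e D y.
  by rewrite mem_filter andb_idr // => /dpar_endpoint.
have xT : x \in T by rewrite memT.
have [u uT umin] := seq_argmin (fun y : site 2 => y ord0 i) xT.
have [u' u'T umax] := seq_argmax (fun y : site 2 => y ord0 i) xT.
rewrite !memT in uT u'T.
pose a : int := u ord0 i.
have [su su'] := full u uT; have [tu _] := full u' u'T.
rewrite -/a in su su'.
have a1 : a - 1 != a by rewrite -subr_eq0 addrAC subrr sub0r oppr_eq0.
have ev := strip_even i.
(* Odd vertices in several columns: three different strips hold at least two edges each, so those at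
   [a - 1] and [a] hold only two. The line right of column [a] then cannot have a single odd vertex
   to its left, so that column contains a second one. *)
have [lt_a|le_a] := ltP a (u' ord0 i).
  have lt_a1 : a - 1 < u' ord0 i by rewrite (lt_trans _ lt_a) // ltrBlDr ltrDl.
  have s3 := strip_card3 a1 (negbT (lt_eqF lt_a)) (negbT (lt_eqF lt_a1)).
  have s1 : (#|strip i a| <= 2)%N.
    rewrite leqNgt; apply/negP => /(even_gt2 (ev _)) s4.
    by have := leq_trans (leq_trans (leq_add (leq_add su' s4) tu) s3) al7.
  have s2 : (#|strip i (a - 1)| <= 2)%N.
    rewrite leqNgt; apply/negP => /(even_gt2 (ev _)) s4.
    by have := leq_trans (leq_trans (leq_add (leq_add s4 su) tu) s3) al7.
  have [d|] := boolP (\big[addb/false]_(y <- endpoints e |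
      (y : site 2) ord0 i <= a) dpar e D y).
    by have := leq_trans (cut_crossing hT hA hB d) s1.
  move=> /negP d; have [v] : exists v, [&& v \in T, v != u & v ord0 i <= a].
    apply: contrapT => h; apply: d.
    rewrite big_mkcond (bigD1_seq u) ?undup_uniq ?(dpar_endpoint uT) //= lexx uT.
    rewrite big1 // => v vu; case: ifP => // va.
    by apply/negP => dv; apply: h; exists v; rewrite memT dv vu.
  case/and3P => vT vu va; have vi : u ord0 i = v ord0 i.
    by apply/eqP; rewrite eq_le umin.
  apply: (@thin_column u v) => //; first by rewrite eq_sym.
    exact: deg4.
  by apply: deg4; rewrite -memT.
(* All odd vertices in one column: by [thin_column] the two strips beside it hold at least 6 edges,
   which leaves no room for a third strip. *)
have Ti y : y \in T -> y ord0 i = a.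
  move=> yT; apply/eqP; rewrite eq_le (umin y yT) andbT.
  exact: le_trans (umax y yT) le_a.
have [v vu vT] := dpar_second uT.
have vi : u ord0 i = v ord0 i by rewrite (Ti v) ?memT.
have big6 : (6 <= #|strip i (a - 1)| + #|strip i a|)%N.
  rewrite leqNgt; apply/negP; rewrite ltnS => h.
  apply: (@thin_column u v); rewrite ?deg4 //; first by rewrite eq_sym.
    rewrite -/a leqNgt; apply/negP => /(even_gt2 (ev _)) s4.
    by have := leq_trans (leq_add su' s4) h.
  rewrite -/a leqNgt; apply/negP => /(even_gt2 (ev _)) s4.
  by have := leq_trans (leq_add s4 su) h.
have only c : (0 < #|strip i c|)%N -> c = a \/ c = a - 1.
  move=> c0; have c2 : (2 <= #|strip i c|)%N.
    by move: c0 (ev c); case: #|_| => [|[|]].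
  have [->|ca] := eqVneq c a; first by left.
  have [->|ca'] := eqVneq c (a - 1); first by right.
  have ac' : a != c by rewrite eq_sym.
  rewrite eq_sym in ca'; have s3 := strip_card3 a1 ac' ca'.
  by have := leq_trans (leq_trans (leq_add big6 c2) s3) al7.
(* The line just above the lowest odd vertex has exactly one odd vertex below it and needs four
   vertical edges, but only three columns are available. *)
have [w wT wmin] := seq_argmin (fun y : site 2 => y ord0 j) xT.
rewrite memT in wT; pose y0 : int := w ord0 j.
have d : \big[addb/false]_(y <- endpoints e | (y : site 2) ord0 j <= y0) dpar e D y.
  rewrite big_mkcond (bigD1_seq w) ?undup_uniq ?(dpar_endpoint wT) //= lexx wT.
  rewrite big1 // => z zw; case: ifP => // zy; apply/negP => dz.
  case/negP: zw; apply/eqP/(@site2_eq i); first by rewrite !Ti ?memT.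
  by apply/eqP; rewrite eq_le zy wmin // memT.
have := cut_crossing hT hA hB d; rewrite -/(strip j y0) => r4.
have := @card_row_strip y0 [:: a - 1; a; a + 1]; rewrite leqNgt r4 => h.
suff : false by []; apply: h => l lc.
have lV : l \notin along.
  by move: lc; rewrite inE; apply: contraL => /alongP[-> _]; rewrite addbb.
rewrite !inE; case: (column_strip lV) => /only [] E.
- by rewrite E eqxx orbT.
- by rewrite E eqxx.
- by rewrite -E subrK eqxx !orbT.
- by move/(congr1 (+%R^~ 1)): E; rewrite !subrK => ->; rewrite eqxx orbT.
Qed.

End Direction.
Lemma even_setI_planar (A B : {set 'I_n}) : (n <= 15)%N ->
  even_set e A -> even_set e B -> even_set e (A :&: B).
Proof.
move=> n15 hA hB x; apply/negbTE/negP => dx.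
have h0 := crossing_along o0 hA hB dx; have h1 := crossing_along o1 hA hB dx.
suff : (#|along o0| + #|along o1| <= n)%N by move: h0 h1 n15; clear; lia.
have := cardsUI (along o0) (along o1).
have /eqP -> : along o0 :&: along o1 == set0.
  rewrite -subset0; apply/subsetP => l /setIP[/alongP[+ _]]; rewrite !inE.
  have -> : rev_ord o0 = o1 by apply: val_inj.
  by move=> ->; rewrite eqxx.
rewrite cards0 addn0 => <-; rewrite -[X in (_ <= X)%N]card_ord.
exact: max_card.
Qed.

End PlanarCrossing.

(** * Sign of small Ursell functions *)

Section SpinUrsell.
Variables (R : realType) (m n : nat) (beta : R) (e : 'I_n -> site m * site m).
Hypothesis beta0 : 0 < beta.
Hypothesis he : edges e.
Implicit Types (A B C : {set 'I_n}).

Definition spin_mean A : R := wilson beta (sel e A).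
Notation F := spin_mean.

Lemma nn_sel A : all (@nn m) (sel e A).
Proof. by apply/allP => _ /mapP[i _ ->]. Qed.

Lemma chi_sel N A (f : gauge_field m N) :
  chi R (sel e A) f = \prod_(i in A) spin R (e i) f.
Proof. by rewrite /chi big_map big_enum. Qed.

Lemma ursell_spinsE : ursell_spins beta e = ursell_sum F.
Proof.
apply: eq_bigr => P _; congr (_ * _); apply: eq_bigr => B _.
rewrite /expect /spin_mean /wilson; congr (limn _); apply/funext => N.
by apply: eq_bigr => f _; rewrite chi_sel.
Qed.

Lemma spin_mean_ge0 A : 0 <= F A.
Proof. by rewrite wilson_ge0 ?nn_sel. Qed.

Lemma spin_mean_le1 A : F A <= 1.
Proof. by rewrite wilson_le1 ?nn_sel. Qed.

Lemma spin_mean_even A : F A != 0 -> even_set e A.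
Proof.
move=> FA x; apply: contra_neqF FA => d.
by rewrite /spin_mean (wilson_odd beta0 (nn_sel A) (x := x)) // odd_sel.
Qed.

Lemma par_selU A B f : [disjoint A & B] ->
  par (sel e (A :|: B)) f = par (sel e A) f (+) par (sel e B) f.
Proof.
move=> AB; rewrite -par_cat /par; congr odd; apply/permP.
rewrite /sel -map_cat; apply/perm_map/uniq_perm; rewrite ?enum_uniq //.
  rewrite cat_uniq !enum_uniq andbT /=; apply/hasPn => i; rewrite !mem_enum.
  by move=> iB; apply: contraL iB => iA; rewrite (disjointFr AB iA).
by move=> i; rewrite mem_cat !mem_enum inE.
Qed.

Lemma spin_meanU A B : [disjoint A & B] -> F A * F B <= F (A :|: B).
Proof.
move=> AB; have -> : F (A :|: B) = wilson beta (sel e A ++ sel e B).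
  by apply: wilson_par => f; rewrite par_selU // par_cat.
by apply: wilson_cat; rewrite ?nn_sel.
Qed.

Lemma spin_mean_split A : F A * F (~: A) <= F [set: 'I_n].
Proof. by rewrite -(setUCr A) spin_meanU // disjoints_subset setCK. Qed.

Lemma even_setT_cover P : finset.partition P [set: 'I_n] ->
  (forall B, B \in P -> even_set e B) -> even_set e [set: 'I_n].
Proof.
move=> /and3P[/eqP c tr _] h x; rewrite /dpar -c big_trivIset //= big1 // => B BP.
exact: (h B BP x).
Qed.

(** A contributing partition has even blocks, and their disjoint union is even. *)
Lemma ursell_odd_cover : ~ even_set e [set: 'I_n] -> ursell_sum F = 0.
Proof.
move=> h; apply: big1 => P PT; apply/eqP; apply: contraT => t0; case: h.
by apply: (even_setT_cover PT) => B /(term_neq0 t0) /spin_mean_even.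
Qed.

Lemma even_setC A : even_set e [set: 'I_n] -> even_set e A -> even_set e (~: A).
Proof. by move=> hT hA; rewrite -setTD; apply: even_setD => //; rewrite setTI. Qed.

Definition no_even_triple := forall A B C, A != set0 -> B != set0 -> C != set0 ->
  [disjoint A & B] -> [disjoint B & C] -> [disjoint C & A] ->
  even_set e A -> even_set e B -> even_set e C -> False.

(** Two different splits into even sets would cut each other into three disjoint nonempty even sets,
    so at most one split contributes. *)
Lemma ursell_ge0_no_triple : (0 < n)%N -> no_even_triple ->
  (even_set e [set: 'I_n] -> forall A B, even_set e A -> even_set e B ->
     even_set e (A :&: B)) ->
  0 <= ursell_sum F.
Proof.
move=> n0 tri hI; apply: (ursell_sum_ge0_split n0 spin_mean_ge0).
- move=> A B C A0 B0 C0 AB BC CA /spin_mean_even eA /spin_mean_even eB.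
  by move=> /spin_mean_even eC; exact: (tri A B C).
- exact: spin_mean_split.
move=> A B A0 A0' B0 B0'; rewrite !mulf_eq0 !negb_or.
move=> /andP[/spin_mean_even eA /spin_mean_even eA'].
move=> /andP[/spin_mean_even eB /spin_mean_even eB'].
have hT : even_set e [set: 'I_n].
  rewrite -(setUCr A); apply: even_setU => //.
  by rewrite disjoints_subset setCK.
have dj (C D : {set 'I_n}) : (forall x, x \in C -> x \notin D) -> [disjoint C & D].
  by move=> h; rewrite disjoints_subset; apply/subsetP => x /h; rewrite inE.
have [AB0|AB0] := eqVneq (A :&: B) set0.
  right; apply/eqP; rewrite eqEsubset; apply/andP; split.
    by rewrite subsets_disjoint setCK -setI_eq0 AB0.
  rewrite -setCS setCK; apply: contraT => nAB.
  have N0 : ~: A :&: ~: B != set0.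
    apply: contraNneq nAB => N0; apply/subsetP => x xA.
    by move/setP/(_ x): N0; rewrite in_setI xA in_setC in_set0 => /negbFE.
  have dAB : [disjoint A & B] by rewrite -setI_eq0 AB0.
  exfalso; apply: (tri A B (~: A :&: ~: B)) => //; last exact: hI.
    by apply: dj => x xB; rewrite !inE xB andbF.
  by apply: dj => x; rewrite !inE => /andP[].
left; apply/eqP; rewrite eqEsubset -!setD_eq0; apply/andP; split.
  apply: contraT => D0; exfalso; apply: (tri (A :&: B) (A :\: B) (~: A)) => //.
  - by apply: dj => x; rewrite !inE => /andP[_ ->].
  - by apply: dj => x; rewrite !inE negbK => /andP[].
  - by apply: dj => x; rewrite !inE => /negbTE ->.
  - exact: hI.
  - by apply: even_setD => //; apply: hI.
apply: contraT => D0; exfalso; apply: (tri (A :&: B) (B :\: A) (~: B)) => //.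
- by apply: dj => x; rewrite !inE => /andP[-> _].
- by apply: dj => x; rewrite !inE negbK => /andP[].
- by apply: dj => x; rewrite !inE => /negbTE ->; rewrite andbF.
- exact: hI.
by apply: even_setD => //; rewrite setIC; apply: hI.
Qed.

Hypothesis hd : distinct_edges e.

Lemma card_triple A B C : A != set0 -> B != set0 -> C != set0 ->
  [disjoint A & B] -> [disjoint B & C] -> [disjoint C & A] ->
  even_set e A -> even_set e B -> even_set e C -> (12 <= n)%N.
Proof.
move=> A0 B0 C0 AB BC CA eA eB eC.
have hA := even_card_ge4 he hd eA A0; have hB := even_card_ge4 he hd eB B0.
have hC := even_card_ge4 he hd eC C0.
have h1 := cardsUI A B; have h2 := cardsUI (A :|: B) C.
have /eqP AB0 : A :&: B == set0 by rewrite setI_eq0.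
have /eqP ABC0 : (A :|: B) :&: C == set0.
  by rewrite setIUl setU_eq0 !setI_eq0 BC disjoint_sym CA.
rewrite AB0 cards0 addn0 in h1; rewrite ABC0 cards0 addn0 in h2.
have := max_card (mem ((A :|: B) :|: C)); rewrite card_ord.
rewrite h2 h1; move: hA hB hC; clear; lia.
Qed.

Lemma ursell_small_ge0 : (0 < n)%N -> (n <= 9)%N -> 0 <= ursell_sum F.
Proof.
move=> n0 n9; apply: ursell_ge0_no_triple => //.
  move=> A B C A0 B0 C0 AB BC CA eA eB eC.
  by have := leq_trans (card_triple A0 B0 C0 AB BC CA eA eB eC) n9.
by move=> hT A B hA hB; exact: even_setI_small.
Qed.

End SpinUrsell.

(** * Three disjoint even sets in the plane *)

Section PlanarAtoms.
Notation o0 := (ord0 : 'I_2).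
Notation o1 := (ord_max : 'I_2).
Variables (R : realType) (n : nat) (beta : R) (e : 'I_n -> site 2 * site 2).
Hypothesis beta0 : 0 < beta.
Hypothesis hd : distinct_edges e.
Hypothesis hT : even_set e [set: 'I_n].
Notation F := (spin_mean beta e).
Notation t := (tnh beta).
Implicit Types (A B C : {set 'I_n}) (X : {fset site 2}).

Let he : edges e. Proof. by case: hd. Qed.

Lemma par_sel_mem A f : par (sel e A) f -> exists2 l, l \in A & same f (e l).
Proof.
move=> p; have : has (same f) (sel e A).
  by rewrite has_count; move: p; rewrite /par; case: count.
by case/hasP => _ /mapP[l lA ->] sf; exists l => //; rewrite mem_enum in lA.
Qed.

Lemma par_sel_single l A : l \in A -> par (sel e A) (e l).
Proof.
move=> lA; rewrite /par /sel count_map.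
rewrite (@eq_count _ _ (pred1 l)); last first.
  move=> k /=; apply/idP/eqP => [/(same_inj hd) -> //|->]; exact: same_refl.
by rewrite count_uniq_mem ?enum_uniq // mem_enum lA.
Qed.

Lemma hedge_strip k (x : site 2) l : same (hedge x k) (e l) ->
  l \in strip e k (x ord0 k).
Proof. by move/same_strip; apply; rewrite mxE dirE eqxx lexx ltrDl. Qed.

Lemma par_loops_fset X x k : par (loops X) (hedge x k) =
  (x \in X) (+) (x - dir (rev_ord k) \in X).
Proof. exact: par_loops (fset_uniq X). Qed.

(* The extreme edges of a nonempty column of [X] lie on the boundary. *)
Lemma loops_strip A X (y : site 2) k : fillable (sel e A) X -> y \in X ->
  (2 <= #|A :&: strip e k (y ord0 k)|)%N.
Proof.
move=> fA yX; set c := y ord0 k.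
pose Y := [seq z <- enum_fset X | (z : site 2) ord0 k == c].
have yY : y \in Y by rewrite mem_filter eqxx.
have [z zY zmax] := seq_argmax (fun z : site 2 => z ord0 (rev_ord k)) yY.
have [w wY wmin] := seq_argmin (fun z : site 2 => z ord0 (rev_ord k)) yY.
have dk (s : site 2) : (s + dir (rev_ord k)) ord0 k = s ord0 k.
  by rewrite mxE dirE eq_sym (negbTE (rev_ord2 k)) addr0.
have dk' (s : site 2) : (s - dir (rev_ord k)) ord0 k = s ord0 k.
  by rewrite !mxE eqxx eq_sym (negbTE (rev_ord2 k)) subr0.
have [zX zc] : z \in X /\ z ord0 k = c.
  by move: zY; rewrite mem_filter => /andP[/eqP].
have [wX wc] : w \in X /\ w ord0 k = c.
  by move: wY; rewrite mem_filter => /andP[/eqP].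
have zN : z + dir (rev_ord k) \notin X.
  apply/negP => zX'; have : z + dir (rev_ord k) \in Y by rewrite mem_filter dk zc eqxx.
  by move/zmax; rewrite mxE dirE eqxx gerDl.
have wN : w - dir (rev_ord k) \notin X.
  apply/negP => wX'; have : w - dir (rev_ord k) \in Y by rewrite mem_filter dk' wc eqxx.
  by move/wmin; rewrite !mxE !eqxx lerDl.
have [l lA lz] : exists2 l, l \in A & same (hedge (z + dir (rev_ord k)) k) (e l).
  by apply: par_sel_mem; rewrite fA par_loops_fset (negbTE zN) addrK zX.
have [l' l'A lw] : exists2 l, l \in A & same (hedge w k) (e l).
  by apply: par_sel_mem; rewrite fA par_loops_fset (negbTE wN) wX.
have ll' : l != l'.
  apply/eqP => E; subst l'; have := same_eql (hedge w k) lz.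
  rewrite lw same_hedge => /andP[/eqP wz _].
  by have := wmin z zY; rewrite wz mxE dirE eqxx gerDl.
have <- : #|[set l; l']| = 2%N by rewrite cards2 ll'.
apply/subset_leq_card/subsetP => i; rewrite in_set2 in_setI => /orP[] /eqP ->.
  by rewrite lA -zc -(dk z) hedge_strip.
by rewrite l'A -wc hedge_strip.
Qed.

Lemma alongI A : (#|A :&: along e o0| + #|A :&: along e o1| <= #|A|)%N.
Proof.
have := cardsUI (A :&: along e o0) (A :&: along e o1).
have /eqP -> : (A :&: along e o0) :&: (A :&: along e o1) == set0.
  rewrite -subset0; apply/subsetP => l; rewrite !in_setI.
  case/andP => /andP[_ /(alongP hd)[+ _]] /andP[_]; rewrite !inE.
  have -> : rev_ord o0 = o1 by apply: val_inj.
  by move=> ->; rewrite eqxx.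
rewrite cards0 addn0 => <-; apply: subset_leq_card.
by rewrite subUset !subsetIl.
Qed.

Lemma along_rev A k : (#|A :&: along e k| + #|A :&: along e (rev_ord k)| <= #|A|)%N.
Proof.
have r0 : rev_ord o0 = o1 by apply: val_inj.
have r1 : rev_ord o1 = o0 by apply: val_inj.
case: (ord2P k) => ->; [rewrite r0|rewrite r1 addnC]; exact: alongI.
Qed.

Lemma strip_sum A k (s : seq int) : uniq s ->
  (\sum_(c <- s) #|A :&: strip e k c| <= #|A :&: along e k|)%N.
Proof.
elim: s A => [|c s IH] A /=; first by rewrite big_nil.
move=> /andP[cs us]; rewrite big_cons.
rewrite -(cardsID (strip e k c) (A :&: along e k)); apply: leq_add.
  by rewrite -setIA (setIidPr (strip_along e k c)).
have -> : (A :&: along e k) :\: strip e k c = (A :\: strip e k c) :&: along e k.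
  by rewrite !setDE setIAC.
apply: leq_trans (IH _ us).
rewrite big_seq [X in (_ <= X)%N]big_seq; apply: leq_sum => d ds.
apply/subset_leq_card/subsetP => l /setIP[lA ld].
rewrite in_setI in_setD lA ld !andbT; apply/negP => lc.
by move: cs; rewrite (strip_inj hd lc ld) ds.
Qed.

(** Every column of squares met by [X] has two extreme boundary edges, and the row through [y] adds
    two edges of the other direction. *)
Lemma loops_size A X (y : site 2) k (s : seq (site 2)) : fillable (sel e A) X ->
  y \in X -> {subset s <= X} -> uniq [seq (z : site 2) ord0 k | z <- s] ->
  (2 * size s + 2 <= #|A|)%N.
Proof.
move=> fA yX sX us; apply: leq_trans (along_rev A k).
apply: leq_add; last first.
  apply: leq_trans (loops_strip (rev_ord k) fA yX) _.
  by apply/subset_leq_card/setIS/strip_along.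
apply: leq_trans (strip_sum A k us); rewrite big_map; elim: s sX {us} => [|z s IH] sX.
  by rewrite big_nil.
rewrite big_cons mulnS; apply: leq_add.
  by apply: (loops_strip k fA); rewrite sX ?mem_head.
by apply: IH => w ws; rewrite sX // inE ws orbT.
Qed.

Lemma fillable_neq0 A X : fillable (sel e A) X -> A != set0 -> exists y, y \in X.
Proof.
move=> fA /set0Pn[l lA]; have : X != fset0.
  apply/eqP => X0; have := par_sel_single lA; rewrite fA X0.
  by rewrite /loops /par (_ : [seq _ | _ <- _] = [::]).
by case/fset0Pn => y; exists y.
Qed.

(** Two squares of [X] would differ in some coordinate, and [loops_size] would give [2 * 2 + 2 = 6]
    edges. *)
Lemma fillable_single A X : fillable (sel e A) X -> A != set0 -> (#|A| <= 5)%N ->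
  exists p, fillable (sel e A) [fset p]%fset.
Proof.
move=> fA A0 A5; have [p pX] := fillable_neq0 fA A0; exists p.
suff -> : [fset p]%fset = X by [].
apply/fsetP => q; rewrite in_fset1; apply/eqP/idP => [->//|qX].
apply/eqP; apply: contraT => qp.
have [k qpk] : exists k, q ord0 k != p ord0 k.
  apply: contrapT => h; case/negP: qp; apply/eqP/rowP => k.
  by have [//|hk] := eqVneq (q ord0 k) (p ord0 k); case: h; exists k.
have := @loops_size A X p k [:: q; p] fA pX; rewrite /= !inE qpk => h.
have : (6 <= #|A|)%N.
  by apply: h => // z; rewrite !inE => /orP[] /eqP ->.
by move/leq_trans/(_ A5).
Qed.

Lemma par_square_sides p k : par (loops [fset p]%fset) (hedge p k) /\
  par (loops [fset p]%fset) (hedge (p + dir (rev_ord k)) k).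
Proof.
have nd (z : site 2) : z + dir (rev_ord k) != z.
  by rewrite -subr_eq0 addrAC subrr add0r dir_neq0.
rewrite !par_loops_fset !in_fset1 eqxx addrK eqxx (negbTE (nd p)).
by rewrite -(inj_eq (addIr (dir (rev_ord k)))) subrK eq_sym (negbTE (nd p)).
Qed.

(** The vertical sides of [p] belong to [A], hence not to [B]. If [p] were in [X], both horizontal
    neighbours of [p] would be too, and three columns need [2 * 3 + 2 = 8] edges. *)
Lemma fillable_notin A B p X : [disjoint A & B] -> (#|B| <= 7)%N ->
  fillable (sel e A) [fset p]%fset -> fillable (sel e B) X -> p \notin X.
Proof.
move=> AB B7 fA fB; apply/negP => pX.
have excl f : par (loops [fset p]%fset) f -> par (loops X) f = false.
  rewrite -fA => /par_sel_mem[l lA fl]; apply/negbTE/negP.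
  rewrite -fB => /par_sel_mem[l' l'B fl'].
  have E : l = l' by apply: (same_inj hd); rewrite -(same_eqr _ fl).
  by subst l'; rewrite (disjointFr AB lA) in l'B.
have [s1 s2] := par_square_sides p o1.
have r1 : rev_ord o1 = o0 by apply: val_inj.
have qX : p - dir o0 \in X.
  by have := excl _ s1; rewrite par_loops_fset pX r1; case: (_ \in X).
have rX : p + dir o0 \in X.
  have := excl _ s2; rewrite par_loops_fset r1 addrK pX.
  by case: (_ \in X).
have := @loops_size B X p o0 [:: p - dir o0; p; p + dir o0] fB pX.
rewrite /= !inE !mxE !eqxx /= => h.
have : (8 <= #|B|)%N.
  apply: h; first by move=> z; rewrite !inE => /or3P[] /eqP ->.
  by move: (p ord0 o0) => a; lia.
by move/leq_trans/(_ B7).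
Qed.

Lemma fillableU A B X p : [disjoint A & B] ->
  fillable (sel e A) [fset p]%fset -> fillable (sel e B) X -> p \notin X ->
  F (A :|: B) = t * F B.
Proof.
move=> AB fA fB pX; rewrite /spin_mean (wilson_fillable beta0 fB).
rewrite (wilson_fillable beta0 (X := (p |` X)%fset)) ?cardfsU1 ?pX ?exprS // => f.
rewrite par_selU // fA fB -par_cat /par; congr odd; apply/permP.
rewrite /loops -flatten_cat -map_cat; apply/perm_flatten/perm_map.
apply: uniq_perm; rewrite ?fset_uniq // ?cat_uniq ?fset_uniq ?andbT /=.
  by apply/hasPn => z zX; apply/negP => /fset1P zp; rewrite -zp zX in pX.
move=> z; rewrite mem_cat; transitivity ((z == p) || (z \in X)).
  by congr (_ || _); rewrite -in_fset1.
by symmetry; exact: in_fset1U.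
Qed.

Lemma fillable_xor s s1 s2 X1 X2 :
  (forall f, par s f = par s1 f (+) par s2 f) ->
  fillable s1 X1 -> fillable s2 X2 ->
  exists2 X, fillable s X & forall z, z \in X -> (z \in X1) || (z \in X2).
Proof.
move=> hs f1 f2; exists ((X1 `\` X2) `|` (X2 `\` X1))%fset; last first.
  by move=> z; rewrite !inE => /orP[] /andP[_ ->]; rewrite ?orbT.
move=> f; rewrite hs f1 f2.
have h X Y : [disjoint X & Y]%fset ->
    par (loops (X `|` Y)%fset) f = par (loops X) f (+) par (loops Y) f.
  move=> XY; rewrite -par_cat /par; congr odd; apply/permP.
  rewrite /loops -flatten_cat -map_cat; apply/perm_flatten/perm_map.
  apply: uniq_perm; rewrite ?fset_uniq // ?cat_uniq ?fset_uniq ?andbT /=.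
    apply/hasPn => z zY; apply/negP => zX.
    by have /fdisjointP/(_ z zX)/negP := XY; apply.
  by move=> z; rewrite mem_cat; exact: in_fsetU.
have d1 X Y : par (loops X) f =
    par (loops (X `\` Y)%fset) f (+) par (loops (X `&` Y)%fset) f.
  rewrite -h; last first.
    by apply/fdisjointP => z; rewrite !inE => /andP[/negbTE -> _]; rewrite andbF.
  congr (par (loops (enum_fset _)) f); apply/fsetP => z; rewrite !inE.
  by case: (z \in X); case: (z \in Y).
rewrite h; last first.
  by apply/fdisjointP => z; rewrite !inE => /andP[/negbTE -> ->].
rewrite (d1 X1 X2) (d1 X2 X1) fsetIC.
by case: (par _ f); case: (par _ f); case: (par _ f).
Qed.

Lemma spin_mean_fillable A : F A != 0 -> exists X, fillable (sel e A) X.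
Proof. by apply: wilson_neq0 => //; exact: nn_sel. Qed.

(** If all three sets bound regions, [C1] bounds one square outside the other two regions; it
    contributes a factor [t] throughout and equality holds. Otherwise at most one product on the
    left is nonzero, since two nonzero ones would fill all three sets, and supermultiplicativity
    bounds it. *)
Lemma three_atoms C1 C2 C3 : [disjoint C1 & C2] -> [disjoint C1 & C3] ->
  [disjoint C2 & C3] -> C1 != set0 -> (#|C1| <= 5)%N -> (#|C2| <= 7)%N ->
  (#|C3| <= 7)%N ->
  F C1 * F (C2 :|: C3) + F C2 * F (C1 :|: C3) + F C3 * F (C1 :|: C2) <=
  F (C1 :|: (C2 :|: C3)) + 2 * (F C1 * F C2 * F C3).
Proof.
move=> d12 d13 d23 C10 c1 c2 c3.
have dU A B C : [disjoint A & B] -> [disjoint A & C] -> [disjoint A & B :|: C].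
  by move=> AB AC; rewrite -setI_eq0 setIUr setU_eq0 !setI_eq0 AB.
have F0 A : 0 <= F A by exact: spin_mean_ge0.
have diff A B X Y : [disjoint A & B] -> fillable (sel e A) X ->
    fillable (sel e (A :|: B)) Y -> exists X, fillable (sel e B) X.
  move=> AB fA fAB; have [f|Z fZ _] := fillable_xor (s := sel e B) _ fA fAB.
    by rewrite par_selU // addKb.
  by exists Z.
have [all|] := pselect ((exists X, fillable (sel e C1) X) /\
  (exists X, fillable (sel e C2) X) /\ (exists X, fillable (sel e C3) X)).
  case: all => -[X1 f1] [[X2 f2] [X3 f3]].
  have [p fp] := fillable_single f1 C10 c1.
  have p2 := fillable_notin d12 c2 fp f2; have p3 := fillable_notin d13 c3 fp f3.
  have [X23 f23 h23] := fillable_xor (fun f => par_selU e f d23) f2 f3.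
  have p23 : p \notin X23 by apply/negP => /h23; rewrite (negbTE p2) (negbTE p3).
  rewrite (fillableU d12 fp f2 p2) (fillableU d13 fp f3 p3).
  rewrite (fillableU (dU _ _ _ d12 d13) fp f23 p23).
  rewrite [F C1](wilson_fillable beta0 fp) cardfs1 expr1.
  by rewrite le_eqVlt; apply/orP; left; apply/eqP; ring.
move=> nall.
have FU A B : [disjoint A & B] -> F A * F B <= F (A :|: B) by apply: spin_meanU.
have E1 : C1 :|: (C2 :|: C3) = C2 :|: (C1 :|: C3) by rewrite setUCA.
have E2 : C1 :|: (C2 :|: C3) = C3 :|: (C1 :|: C2) by rewrite setUA setUC.
have t1 := FU _ _ (dU _ _ _ d12 d13).
have d21 : [disjoint C2 & C1] by rewrite disjoint_sym.
have d31 : [disjoint C3 & C1] by rewrite disjoint_sym.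
have d32 : [disjoint C3 & C2] by rewrite disjoint_sym.
have t2 := FU _ _ (dU _ _ _ d21 d23); rewrite -E1 in t2.
have t3 := FU _ _ (dU _ _ _ d31 d32); rewrite -E2 in t3.
have z0 : 0 <= F C1 * F C2 * F C3 by rewrite !mulr_ge0.
have zz A B : F A * F B = 0 \/ (exists X, fillable (sel e A) X) /\
    (exists X, fillable (sel e B) X).
  have [|] := eqVneq (F A * F B) 0; first by left.
  rewrite mulf_eq0 negb_or => /andP[/spin_mean_fillable ? /spin_mean_fillable ?].
  by right.
have h (a b c T z : R) : 0 <= z -> a <= T -> b <= T -> c <= T ->
   0 <= T -> a = 0 /\ b = 0 \/ a = 0 /\ c = 0 \/ b = 0 /\ c = 0 ->
   a + b + c <= T + 2 * z by clear; move=> ? ? ? ? ? [[]|[[]|[]]] -> ->; lra.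
apply: h => //.
case: (zz C1 (C2 :|: C3)) => [|[[X1 f1] [X23 f23]]].
  case: (zz C2 (C1 :|: C3)) => [|[[X2 f2] [X13 f13]]]; first by auto.
  case: (zz C3 (C1 :|: C2)) => [|[[X3 f3] [X12 f12]]]; first by auto.
  case: nall; split; last by split; [exists X2|exists X3].
  by rewrite setUC in f13; exact: (diff _ _ _ _ d31 f3 f13).
case: (zz C2 (C1 :|: C3)) => [|[[X2 f2] [X13 f13]]]; last first.
  case: nall; split; first by exists X1.
  by split; [exists X2|exact: (diff _ _ _ _ d23 f2 f23)].
case: (zz C3 (C1 :|: C2)) => [|[[X3 f3] [X12 f12]]]; first by auto.
case: nall; split; first by exists X1.
by split; [exact: (diff _ _ _ _ d12 f1 f12)|exists X3].
Qed.

Hypothesis n15 : (n <= 15)%N.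

(** Each [C] has at most 7 edges, too few for two nonempty even sets, so every even set is a union
    of them. This leaves exactly the splits compared in [three_atoms]. *)
Lemma ursell_atoms_ge0 C1 C2 C3 : [disjoint C1 & C2] -> [disjoint C1 & C3] ->
  [disjoint C2 & C3] -> C1 :|: (C2 :|: C3) = [set: 'I_n] ->
  C1 != set0 -> C2 != set0 -> C3 != set0 ->
  even_set e C1 -> even_set e C2 -> even_set e C3 -> (#|C1| <= 5)%N ->
  0 <= ursell_sum F.
Proof.
move=> d12 d13 d23 CT C10 C20 C30 e1 e2 e3 c15.
have g1 := even_card_ge4 he hd e1 C10.
have g2 := even_card_ge4 he hd e2 C20.
have g3 := even_card_ge4 he hd e3 C30.
have dU A B C : [disjoint A & B] -> [disjoint A & C] -> [disjoint A & B :|: C].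
  by move=> AB AC; rewrite -setI_eq0 setIUr setU_eq0 !setI_eq0 AB.
have cU A B : [disjoint A & B] -> #|A :|: B| = (#|A| + #|B|)%N.
  move=> AB; have := cardsUI A B.
  by have /eqP -> : A :&: B == set0; rewrite ?setI_eq0 // cards0 addn0.
have cn : (#|C1| + (#|C2| + #|C3|) = n)%N.
  by rewrite -(cU _ _ d23) -(cU _ _ (dU _ _ _ d12 d13)) CT cardsT card_ord.
have c17 : (#|C1| <= 7)%N by move: cn g2 g3 n15; clear; lia.
have c27 : (#|C2| <= 7)%N by move: cn g1 g3 n15; clear; lia.
have c37 : (#|C3| <= 7)%N by move: cn g1 g2 n15; clear; lia.
have n0 : (0 < n)%N by move: cn g1; clear; lia.
have compl A B : [disjoint A & B] -> A :|: B = [set: 'I_n] -> B = ~: A.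
  move=> AB ABT; apply/setP => x; have : x \in A :|: B by rewrite ABT inE.
  rewrite !inE; case xA: (x \in A) => //= _.
  by rewrite (disjointFr AB xA).
have k1 := compl _ _ (dU _ _ _ d12 d13) CT.
have k2 : C1 :|: C3 = ~: C2.
  by apply: compl; [apply: dU => //; rewrite disjoint_sym|rewrite setUCA].
have k3 : C1 :|: C2 = ~: C3.
  apply: compl; last by rewrite setUC -setUA.
  by apply: dU; rewrite disjoint_sym.
have atom C D : even_set e C -> (#|C| <= 7)%N -> even_set e D ->
    D :&: C = set0 \/ D :&: C = C.
  move=> eC C7 eD; have eI := even_setI_planar hd hT n15 eD eC.
  have eD' : even_set e (C :\: D) by apply: even_setD => //; rewrite setIC.
  have [->|I0] := eqVneq (D :&: C) set0; first by left.
  right; have [/eqP|D0] := eqVneq (C :\: D) set0.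
    by rewrite setD_eq0 => /setIidPr.
  have := even_card_ge4 he hd eI I0; have := even_card_ge4 he hd eD' D0.
  by rewrite -(cardsID D C) [C :&: D]setIC in C7; move: C7; clear; lia.
have nT C : C != set0 -> ~: C != set0 -> [set C; ~: C] != [set [set: 'I_n]].
  move=> C0 C0'; apply/eqP => /setP /(_ C); rewrite !inE eqxx /=.
  by move/esym/eqP => CE; move: C0'; rewrite CE setCT eqxx.
have U0 A B : A != set0 -> A :|: B != set0.
  by apply: contraNneq => /eqP; rewrite setU_eq0 => /andP[].
have k10 : ~: C1 != set0 by rewrite -k1 U0.
have k20 : ~: C2 != set0 by rewrite -k2 U0.
have k30 : ~: C3 != set0 by rewrite -k3 U0.
have neq A B : [disjoint A & B] -> A != set0 -> A != B.
  move=> AB A0; apply: contraNneq A0 => E.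
  by move: AB; rewrite -E -setI_eq0 setIid.
have nsplit A B C : [disjoint A & B] -> A != set0 -> B != set0 -> A :|: C = ~: B ->
   [disjoint A & C] -> C != set0 -> [set A; ~: A] != [set B; ~: B].
  move=> AB A0 B0 AC dAC C0; apply/eqP => /setP /(_ A); rewrite !inE eqxx /=.
  rewrite (negbTE (neq _ _ AB A0)) -AC => /esym/eqP E.
  move: dAC; rewrite E disjoints_subset => /subsetP h.
  by case/set0Pn: C0 => x xC; have := h x; rewrite !inE xC orbT => /(_ isT).
have k12 : [set C1; ~: C1] != [set C2; ~: C2] by exact: (nsplit _ _ C3).
have k13 : [set C1; ~: C1] != [set C3; ~: C3] by exact: (nsplit _ _ C2).
have k23 : [set C2; ~: C2] != [set C3; ~: C3].
  apply: (nsplit _ _ C1) => //; first by rewrite setUC.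
  by rewrite disjoint_sym.
(* Four even blocks would need 16 edges, so there are at most three blocks, and only two blocks
   carry a minus sign. *)
have term3_ge0 P : finset.partition P [set: 'I_n] -> ursell_term F P != 0 ->
    #|P| != 2 -> 0 <= ursell_term F P.
  move=> PT t0 P2.
  have P3 : (#|P| <= 3)%N.
    have := card_partition PT; rewrite cardsT card_ord => nE.
    have : (\sum_(A in P) 4 <= \sum_(A in P) #|A|)%N.
      apply: leq_sum => A AP; apply: (even_card_ge4 he hd).
        exact: (spin_mean_even beta0 he (term_neq0 t0 AP)).
      by case/and3P: PT => _ _; apply: contraNneq => <-.
    by rewrite -nE sum_nat_const; move: n15; clear; lia.
  rewrite /ursell_term mulr_ge0 ?prodr_ge0 // => [|B _]; last exact: spin_mean_ge0.
  have := partition_card_gt0 n0 PT; move: P2 P3.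
  case: #|P| => [|[|[|[|//]]]] // _ _ _.
    by rewrite expr0 mul1r.
  by rewrite (_ : (3 - 1)%N = 2%N) // sqrrN expr1n mul1r.
pose P3 := [set C1; C2; C3].
have P3T : finset.partition P3 [set: 'I_n].
  apply/and3P; split.
  - rewrite /cover /P3 -setUA !bigcup_setU !big_set1; apply/eqP; exact: CT.
  - apply/trivIsetP => A B; rewrite !inE -!orbA.
    by case/or3P => /eqP ->; case/or3P => /eqP ->; rewrite ?eqxx //;
      rewrite disjoint_sym.
  by rewrite !inE !negb_or ![set0 == _]eq_sym C10 C20 C30.
have P3c : #|P3| = 3%N.
  rewrite /P3 setUC cardsU1 !inE negb_or ![C3 == _]eq_sym (neq _ _ d13) //.
  by rewrite (neq _ _ d23) // cards2 (neq _ _ d12).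
have c2 A : A != set0 -> #|[set A; ~: A]| = 2%N.
  by move=> A0; rewrite cards2 neq_setC.
have n3 A : A != set0 -> P3 != [set A; ~: A].
  by move=> A0; apply/eqP => E; have := P3c; rewrite E c2.
have n3T : P3 != [set [set: 'I_n]].
  by apply/eqP => E; have := P3c; rewrite E cards1.
rewrite /ursell_sum (bigD1 [set [set: 'I_n]]) ?partitionT //=.
rewrite (bigD1 [set C1; ~: C1]) /=; last by rewrite partition_split ?nT.
rewrite (bigD1 [set C2; ~: C2]) /=; last first.
  by rewrite partition_split ?nT //= eq_sym.
rewrite (bigD1 [set C3; ~: C3]) /=; last first.
  by rewrite partition_split ?nT //= [_ == [set C1; _]]eq_sym k13 eq_sym.
rewrite (bigD1 P3) /=; last by rewrite P3T n3T !n3.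
have T3 : ursell_term F P3 = _ :=
  term3 F (neq _ _ d12 C10) (neq _ _ d13 C10) (neq _ _ d23 C20).
rewrite term1 (term2 F (neq_setC C10)) (term2 F (neq_setC C20)).
rewrite (term2 F (neq_setC C30)) T3.
set s := \sum_(_ | _) _; suff s0 : 0 <= s.
  have := three_atoms d12 d13 d23 C10 c15 c27 c37.
  by rewrite CT k1 k2 k3; move: s0; lra.
apply: sumr_ge0 => P /andP[/andP[/andP[/andP[/andP[PT _] Q1] Q2] Q3] _].
have [->//|t0] := eqVneq (ursell_term F P) 0.
have [P2|] := eqVneq #|P| 2; last exact: term3_ge0.
have [A [PE A0 A0']] := partition2 PT P2.
have eA : even_set e A.
  by apply: (spin_mean_even beta0 he (term_neq0 t0 _)); rewrite PE !inE eqxx.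
(* Of the eight unions of atoms, two are trivial and the other six form the three splits already
   taken out of the sum. *)
have dec : A = (A :&: C1) :|: ((A :&: C2) :|: (A :&: C3)).
  by rewrite -!setIUr CT setIT.
exfalso; move: dec.
case: (atom C1 A e1 c17 eA) => ->; case: (atom C2 A e2 c27 eA) => ->;
  case: (atom C3 A e3 c37 eA) => ->; rewrite ?set0U ?setU0 => AE.
- by rewrite AE eqxx in A0.
- by rewrite PE AE eqxx in Q3.
- by rewrite PE AE eqxx in Q2.
- by rewrite PE AE k1 setCK setUC eqxx in Q1.
- by rewrite PE AE eqxx in Q1.
- by rewrite PE AE k2 setCK setUC eqxx in Q2.
- by rewrite PE AE k3 setCK setUC eqxx in Q3.
by rewrite AE CT setCT eqxx in A0'.
Qed.

End PlanarAtoms.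

Lemma ursell_planar_ge0 (R : realType) (n : nat) (beta : R)
    (e : 'I_n -> site 2 * site 2) :
  0 < beta -> (0 < n)%N -> (n <= 15)%N -> distinct_edges e ->
  0 <= ursell_sum (spin_mean beta e).
Proof.
move=> beta0 n0 n15 hd; have he : edges e by case: hd.
have [hT|hT] := pselect (even_set e [set: 'I_n]); last first.
  by rewrite ursell_odd_cover.
have [tri|] := pselect (no_even_triple e).
  by apply: ursell_ge0_no_triple => // _ A B; exact: even_setI_planar.
(* The third set is enlarged to the complement of the other two, so that the three form a
   partition. *)
move=> ntri; have [A [B [A0 B0 AB [eA [eB C0]]]]] : exists A B : {set 'I_n},
    [/\ A != set0, B != set0, [disjoint A & B] &
      even_set e A /\ even_set e B /\ ~: (A :|: B) != set0].
  apply: contrapT => h; apply: ntri => A B C A0 B0 C0 AB BC CA eA eB eC.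
  apply: h; exists A, B; split=> //; split=> //; split=> //.
  case/set0Pn: C0 => x xC; apply/set0Pn; exists x; rewrite !inE negb_or.
  by rewrite (disjointFr CA xC) (disjointFl BC xC).
pose C := ~: (A :|: B).
have eC : even_set e C by apply: even_setC => //; apply: even_setU.
have AC : [disjoint A & C] by rewrite disjoints_subset setCK subsetUl.
have BC : [disjoint B & C] by rewrite disjoints_subset setCK subsetUr.
have ABC : A :|: (B :|: C) = [set: 'I_n] by rewrite setUA setUCr.
have cn : (#|A| + (#|B| + #|C|) = n)%N.
  have c1 := cardsUI A B; have c2 := cardsC (A :|: B).
  have /eqP e0 : A :&: B == set0 by rewrite setI_eq0.
  by rewrite e0 cards0 addn0 in c1; rewrite card_ord in c2; rewrite addnA -c1; exact: c2.
(* Three sets of 6 edges would exceed 15, so one of them has at most 5 and can take the place of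
   [C1]. *)
have [a5|a5] := leqP #|A| 5; first exact: (ursell_atoms_ge0 beta0 hd hT n15 AB AC BC).
have BA : [disjoint B & A] by rewrite disjoint_sym.
have CA : [disjoint C & A] by rewrite disjoint_sym.
have CB : [disjoint C & B] by rewrite disjoint_sym.
have [b5|b5] := leqP #|B| 5.
  by apply: (ursell_atoms_ge0 beta0 hd hT n15 BA BC AC) => //; rewrite setUCA.
have [c5|c5] := leqP #|C| 5; last by move: a5 b5 c5 cn n15; clear; lia.
by apply: (ursell_atoms_ge0 beta0 hd hT n15 CA CB AB) => //; rewrite setUC -setUA.
Qed.

(** * Examples *)

Section Examples.
Variable m : nat.
Notation edge := (site m * site m)%type.

Lemma distinct_of_same n (e : 'I_n -> edge) : edges e ->
  (forall i j, same (e i) (e j) -> i = j) -> distinct_edges e.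
Proof.
move=> he h; split=> // i j ij; apply/andP; rewrite -negb_or; apply: contra ij => hs.
by apply/eqP/h; rewrite same_sym /same.
Qed.

(** In a nonempty set of edges of a segment, the far end of the last edge has degree 1. *)
Lemma line_edges n (i : 'I_m) :
  let e := fun k : 'I_n => hedge (dir i *+ k) i in
  distinct_edges e /\ forall A : {set 'I_n}, even_set e A -> A = set0.
Proof.
move=> e; have he : edges e by move=> k; exact: nn_hedge.
have ci (k : nat) : (dir i *+ k) ord0 i = k%:Z.
  rewrite mulmxnE dirE eqxx.
  by rewrite mulr1n natz.
have dinj (k l : nat) : (dir i *+ k == dir i *+ l) = (k == l).
  apply/eqP/eqP => [|-> //] /rowP/(_ i); rewrite !ci => -[].
  by [].
split.
  apply: distinct_of_same => // k l; rewrite same_hedge dinj => /andP[/eqP kl _].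
  exact: val_inj.
move=> A eA; apply/eqP; apply: contraT => /set0Pn[k0 k0A].
case: (arg_maxnP (fun k : 'I_n => val k) k0A) => k kA kmax.
have xk : inc (dir i *+ k.+1) (e k).
  by rewrite inc_nn // /e /hedge /= -mulrSr eqxx orbT.
have [l lA /andP[lk]] := dpar_other (eA _) kA xk.
rewrite inc_nn // /e /hedge /= -mulrSr !dinj eqSS => /orP[] /eqP kl.
  by have := kmax l lA; rewrite /= -kl ltnn.
by move: lk; rewrite -val_eqE /= kl eqxx.
Qed.

(** Configurations are written with concrete integer labels, on which the side conditions are
    settled by computation; [pos] places them in the lattice. *)
Notation label := (int * int * int)%type.

(** Lexicographic orientation, so that two lists of undirected edges can be compared by a computable
    [perm_eq]. *)
Definition norm_edge (q : label * label) : label * label :=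
  let: (a, b) := q in
  if (a.1.1 < b.1.1) || ((a.1.1 == b.1.1) && ((a.1.2 < b.1.2) ||
     ((a.1.2 == b.1.2) && (a.2 <= b.2)))) then (a, b) else (b, a).

Definition lstep (q : label * label) : bool :=
  (`|q.2.1.1 - q.1.1.1| + `|q.2.1.2 - q.1.1.2| + `|q.2.2 - q.1.2| == 1).

Definition linc (x : label) (q : label * label) : bool := (x == q.1) || (x == q.2).

Definition lsame (q r : label * label) : bool :=
  (r == q) || (r == (q.2, q.1)).

Definition lside (x u : label) (a : nat) : seq (label * label) :=
  [seq (x + u *+ l, x + u *+ l.+1) | l <- iota 0 a].

Definition lrect (x u v : label) (a b : nat) : seq (label * label) :=
  lside x u a ++ lside (x + v *+ b) u a ++ lside x v b ++ lside (x + u *+ a) v b.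

Notation u1 := ((1, 0, 0) : label).
Notation u2 := ((0, 1, 0) : label).
Notation u3 := ((0, 0, 1) : label).

Section Position.
Variables (i1 i2 i3 : 'I_m).

Definition pos (x : label) : site m :=
  dir i1 *~ x.1.1 + dir i2 *~ x.1.2 + dir i3 *~ x.2.

Definition posE (q : label * label) : edge := (pos q.1, pos q.2).

Lemma posD x y : pos (x + y) = pos x + pos y.
Proof. by rewrite /pos !mulrzDr [RHS]addrACA; congr (_ + _); rewrite [RHS]addrACA. Qed.

Lemma posMn x l : pos (x *+ l) = pos x *+ l.
Proof.
elim: l => [|l IH]; last by rewrite !mulrS posD IH.
by rewrite !mulr0n /pos !mulr0z !addr0.
Qed.

Lemma pos_u1 : pos u1 = dir i1.
Proof. by rewrite /pos !mulr0z !addr0. Qed.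

Lemma pos_u2 : pos u2 = dir i2.
Proof. by rewrite /pos !mulr0z add0r addr0. Qed.

Lemma pos_u3 : pos u3 = dir i3.
Proof. by rewrite /pos !mulr0z !add0r. Qed.

Lemma side_pos x u k a : pos u = dir k -> side (pos x) k a = map posE (lside x u a).
Proof.
move=> hu; rewrite /side /lside -map_comp; apply: eq_map => l /=.
by rewrite /posE /hedge /= !posD !posMn hu mulrSr addrA.
Qed.

Lemma rect_pos x u v k l a b : pos u = dir k -> pos v = dir l ->
  rect (pos x) k l a b = map posE (lrect x u v a b).
Proof.
move=> hu hv; rewrite /rect /lrect !map_cat -!(side_pos _ _ hu) -!(side_pos _ _ hv).
by rewrite !posD !posMn hu hv.
Qed.

Variable R : realType.

Lemma chi_norm N (f : gauge_field m N) L L' : f \in Omega1 m N ->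
  perm_eq (map norm_edge L) (map norm_edge L') ->
  chi R (map posE L) f = chi R (map posE L') f.
Proof.
move=> fO LL'; have h L0 : chi R (map posE L0) f = chi R (map posE (map norm_edge L0)) f.
  rewrite /chi !big_map; apply: eq_bigr => -[a b] _; rewrite /norm_edge.
  by case: ifP => // _; apply: spin_same fO _; rewrite /same eqxx orbT.
by rewrite h [RHS]h; apply/perm_big/perm_map.
Qed.

Lemma chi_sel_seq N (f : gauge_field m N) n (e' : nat -> edge) (s : seq nat) :
  uniq s -> all (fun k => (k < n)%N) s ->
  chi R (sel (fun i : 'I_n => e' i) [set i | val i \in s]) f = chi R (map e' s) f.
Proof.
move=> us /allP sn; rewrite /sel (map_comp e' val); apply/perm_big/perm_map.
apply: uniq_perm => //; first by rewrite (map_inj_uniq val_inj) enum_uniq.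
move=> k; apply/mapP/idP => [[i + ->]|ks]; first by rewrite mem_enum inE.
by exists (Ordinal (sn _ ks)) => //; rewrite mem_enum inE.
Qed.

Hypothesis i12 : i1 != i2.
(* The label [(a, b, c)] stands for the site [a e_i1 + b e_i2 + c e_i3]. In the
   plane one takes [i3 = i1] and only the labels with [c = 0] are [good]. *)
Variable good : pred label.
Hypothesis good0 : forall x, x.2 = 0 -> good x.
Hypothesis pos_inj : {in good &, injective pos}.
Hypothesis pos_step : forall q, lstep q -> good q.1 -> good q.2 -> nn (posE q).

(** Here [st] holds the fixed edges, [rts] contains the indices of those at the site [O], and [K] is
    the depth of the long path. *)
Variables (st : seq (label * label)) (rts : seq nat) (K : nat).
Hypothesis K0 : (0 < K)%N.
Notation s := (size st).
Notation n := (s + (2 * K).+1)%N.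
Notation O := ((0, 0, 0) : label).
Notation Q := ((1, 0, 0) : label).
Notation st_ := (nth (O, O) st).

Hypothesis st_ok : all (fun q => [&& lstep q, good q.1, good q.2, 0 <= q.1.1.2 &
  0 <= q.2.1.2]) st.
Hypothesis st_inj : all (fun k => all (fun j => lsame (st_ k) (st_ j) ==> (k == j))
  (iota 0 s)) (iota 0 s).
(* [st] lists the edges of paths starting at [O], oriented along the paths, so
   the first end of an edge not starting at [O] lies on the preceding edge only. *)
Hypothesis st_path : all (fun k => ((st_ k).1 == O) || [&& (st_ k).1 != Q &
  all (fun j => linc (st_ k).1 (st_ j) ==> ((j == k) || (j.+1 == k))) (iota 0 s)])
  (iota 0 s).
Hypothesis st_rts : all (fun j => linc O (st_ j) ==> (j \in rts)) (iota 0 s).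

(* The long path from [O] to [Q] through the half-plane of negative second
   coordinate. *)
Definition ear (l : nat) : label :=
  ((nat_of_bool (K < l)%N)%:Z, - (minn l ((2 * K).+1 - l))%N%:Z, 0).

Definition lab (k : nat) : label * label :=
  if (k < s)%N then st_ k else (ear (k - s), ear (k - s).+1).

Definition theta_edge (k : nat) : edge := posE (lab k).

Definition theta (i : 'I_n) : edge := theta_edge i.

Lemma lab_static k : (k < s)%N -> lab k = st_ k.
Proof. by rewrite /lab => ->. Qed.

Lemma lab_ear l : lab (s + l)%N = (ear l, ear l.+1).
Proof. by rewrite /lab ltnNge leq_addr addKn. Qed.

Lemma st_okP k : (k < s)%N -> [/\ lstep (st_ k), good (st_ k).1, good (st_ k).2,
  0 <= (st_ k).1.1.2 & 0 <= (st_ k).2.1.2].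
Proof. by move=> ks; have := allP st_ok _ (mem_nth (O, O) ks) => /and5P[]. Qed.

Lemma ear_step l : (l < (2 * K).+1)%N -> lstep (ear l, ear l.+1).
Proof. by rewrite /lstep /ear /=; lia. Qed.

Lemma ear_good l : good (ear l).
Proof. exact: good0. Qed.

Lemma lab_cases (k : 'I_n) :
  (k < s)%N \/ exists2 l, (l < (2 * K).+1)%N & k = (s + l)%N :> nat.
Proof.
have [ks|sk] := ltnP k s; first by left.
right; exists (k - s)%N; last by rewrite subnKC.
by have := ltn_ord k; rewrite -{1}(subnKC sk) ltn_add2l.
Qed.

Lemma lab_good (k : 'I_n) : good (lab k).1 /\ good (lab k).2.
Proof.
case: (lab_cases k) => [ks|[l _ ->]]; last by rewrite lab_ear; split; exact: ear_good.
by rewrite lab_static //; have [] := st_okP ks.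
Qed.

Lemma theta_nn : edges theta.
Proof.
move=> k; have [g1 g2] := lab_good k; apply: pos_step => //.
case: (lab_cases k) => [ks|[l lK ->]]; last by rewrite lab_ear ear_step.
by rewrite lab_static //; have [] := st_okP ks.
Qed.

Lemma inc_theta x (k : 'I_n) : good x -> inc (pos x) (theta k) = linc x (lab k).
Proof.
have [g1 g2] := lab_good k; move=> gx.
by rewrite (inc_nn _ (theta_nn k)) /= !(inj_in_eq pos_inj).
Qed.

Lemma same_theta (k l : 'I_n) : same (theta k) (theta l) = lsame (lab k) (lab l).
Proof.
have [g1 g2] := lab_good k; have [g3 g4] := lab_good l.
rewrite /same /lsame /rev_edge /theta /theta_edge /posE.
case: (lab k) (lab l) g1 g2 g3 g4 => [a b] [c d] /= ga gb gc gd.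
by rewrite !xpair_eqE !(inj_in_eq pos_inj).
Qed.

Lemma ear_neg l : (0 < l)%N -> (l <= 2 * K)%N -> (ear l).1.2 < 0.
Proof. by rewrite /ear /=; lia. Qed.

Lemma ear_inj l l' : (l <= (2 * K).+1)%N -> (l' <= (2 * K).+1)%N ->
  ear l = ear l' -> l = l'.
Proof. by rewrite /ear => h h' []; lia. Qed.

Lemma ear0 : ear 0 = O.
Proof. by rewrite /ear min0n. Qed.

Lemma earN : ear (2 * K).+1 = Q.
Proof. by rewrite /ear subnn minn0 (_ : (K < (2 * K).+1)%N) //; lia. Qed.

(** Fixed edges stay at nonnegative second coordinate, while every edge of the long path has an end
    below. *)
Lemma theta_distinct : distinct_edges theta.
Proof.
apply: distinct_of_same => [|k l]; first exact: theta_nn.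
rewrite same_theta => kl; apply: val_inj => /=; move: kl.
have neg l' : (l' < (2 * K).+1)%N -> (ear l').1.2 < 0 \/ (ear l'.+1).1.2 < 0.
  case: l' => [|l'] h; first by right; apply: ear_neg => //; lia.
  by left; apply: ear_neg => //; lia.
case: (lab_cases k) => [ks|[k' kK ->]]; case: (lab_cases l) => [ls|[l' lK ->]].
- rewrite !lab_static // => h.
  have /allP/(_ (val k)) := st_inj; rewrite mem_iota ks => /(_ isT)/allP/(_ (val l)).
  by rewrite mem_iota ls h => /(_ isT)/eqP.
- rewrite lab_static // lab_ear; have [_ _ _ h1 h2] := st_okP ks.
  case/orP => /eqP E; have := neg _ lK;
    move: h1 h2; rewrite -[(ear l').1.2]/((ear l', ear l'.+1).1.1.2);
    rewrite -[(ear l'.+1).1.2]/((ear l', ear l'.+1).2.1.2) E /=; clear; lia.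
- rewrite lab_ear lab_static //; have [_ _ _ h1 h2] := st_okP ls.
  by case/orP => /eqP E; have := neg _ kK; move: h1 h2; rewrite E /=; clear; lia.
rewrite !lab_ear /lsame /= => /orP[] /eqP E;
  have /= E1 := congr1 fst E; have /= E2 := congr1 snd E.
  by congr (_ + _)%N; symmetry; apply: ear_inj E1; exact: ltnW.
have e1 := ear_inj (ltnW lK) kK E1; have e2 := ear_inj lK (ltnW kK) E2.
by move: e1 e2; clear; lia.
Qed.

(** The first end of the edge of least index in [A] lies on a further, hence later, edge of [A].
    Unless that end is [O], only the preceding edge could contain it. *)
Lemma theta_root (A : {set 'I_n}) : even_set theta A -> A != set0 ->
  exists2 i, i \in A & inc (pos O) (theta i).
Proof.
move=> eA /set0Pn[k0 k0A].
case: (arg_minnP (fun k : 'I_n => val k) k0A) => k kA kmin.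
have gk : good (lab k).1 by have [] := lab_good k.
have gO : good O by exact: good0.
have xk : inc (pos (lab k).1) (theta k) by rewrite inc_theta // /linc eqxx.
have [l lA /andP[lk]] := dpar_other (eA _) kA xk.
rewrite inc_theta // => xl; have {kmin} kl := kmin l lA.
have kl' : (k < l)%N by rewrite ltn_neqAle kl andbT eq_sym.
case: (lab_cases k) => [ks|[k' kK kE]].
  rewrite lab_static // in xk xl gk.
  have /allP/(_ (val k)) := st_path; rewrite mem_iota ks => /(_ isT).
  have [kO _|kO /= /andP[kQ /allP h]] := eqVneq (st_ k).1 O.
    by exists k; rewrite // -kO.
  exfalso; case: (lab_cases l) => [ls|[l' lK lE]].
    rewrite lab_static // in xl.
    have := h (val l); rewrite mem_iota ls xl => /(_ isT) /orP[] /eqP E.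
      by rewrite E ltnn in kl'.
    by rewrite -E ltnNge leqnSn in kl'.
  have [_ _ _ y0 _] := st_okP ks.
  rewrite lE lab_ear in xl; case/orP: xl => /= /eqP E.
    case: l' {lE} lK E => [|l'] lK E; first by rewrite ear0 in E; rewrite E eqxx in kO.
    by have := ear_neg (ltn0Sn l') lK; rewrite -E ltNge y0.
  have [lK'|lK'] := leqP l'.+1 (2 * K).
    by have := ear_neg (ltn0Sn l') lK'; rewrite -E ltNge y0.
  have lE' : l' = (2 * K)%N by apply/eqP; rewrite eqn_leq; apply/andP; split.
  by rewrite lE' earN in E; rewrite E eqxx in kQ.
rewrite kE lab_ear /= in xk xl gk.
case: k' {gk} kK kE xk xl => [|k'] kK kE xk xl; first by exists k; rewrite // -ear0.
exfalso; case: (lab_cases l) => [ls|[l' lK lE]].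
  by move: (ltn_trans kl' ls); rewrite kE ltnNge leq_addr.
have kl2 : (k'.+1 < l')%N by move: kl'; rewrite kE lE ltn_add2l.
rewrite lE lab_ear in xl; case/orP: xl => /= /eqP E.
  by move: kl2; rewrite (ear_inj (ltnW kK) (ltnW lK) E) ltnn.
by move: kl2; rewrite (ear_inj (ltnW kK) lK E) ltnNge leqnSn.
Qed.

(** The additional edge at [O] is the first one of the long path, with index [s]. *)
Lemma theta_roots_card : (#|[set k | inc (pos O) (theta k)]| <= (size rts).+1)%N.
Proof.
rewrite cardE -(size_map val) -[X in (_ <= X)%N]/(size (s :: rts)).
apply: uniq_leq_size; first by rewrite (map_inj_uniq val_inj) enum_uniq.
move=> _ /mapP[k + ->]; rewrite mem_enum inE inc_theta; last exact: good0.
rewrite inE /=; case: (lab_cases k) => [ks|[l lK ->]].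
  rewrite lab_static // => h; apply/orP; right.
  by have /allP/(_ (val k)) := st_rts; rewrite mem_iota ks h; apply.
rewrite lab_ear => /orP[] /= /eqP E.
  by rewrite -(ear_inj (leq0n _) (ltnW lK) (etrans ear0 E)) addn0 eqxx.
by have := ear_inj (leq0n _) lK (etrans ear0 E).
Qed.

(** Evenness at [O] turns one edge there into two. So the number of disjoint nonempty even sets is
    at most half the degree of [O]. *)
Lemma theta_even_roots (A : {set 'I_n}) : even_set theta A -> A != set0 ->
  (2 <= #|A :&: [set k | inc (pos O) (theta k)]|)%N.
Proof.
move=> eA A0; have [i iA xi] := theta_root eA A0.
have [j jA /andP[ji xj]] := dpar_other (eA _) iA xi.
apply: (@leq_trans #|[set i; j]|); first by rewrite cards2 eq_sym ji.
apply/subset_leq_card/subsetP => k; rewrite in_set2 !inE => /orP[] /eqP ->.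
  by rewrite iA.
by rewrite jA.
Qed.

Variable beta : R.
Hypothesis beta0 : 0 < beta.
Notation F := (spin_mean beta theta).
Notation t := (tnh beta).

Definition idx (s0 : seq nat) : {set 'I_n} := [set i | val i \in s0].

Lemma chi_idx N (f : gauge_field m N) s0 : uniq s0 -> all (fun k => (k < n)%N) s0 ->
  chi R (sel theta (idx s0)) f = chi R (map theta_edge s0) f.
Proof. exact: chi_sel_seq. Qed.

Lemma idx_static s0 x u v k l a b : uniq s0 -> all (fun k => (k < s)%N) s0 ->
  pos u = dir k -> pos v = dir l -> k != l ->
  perm_eq (map norm_edge (map st_ s0)) (map norm_edge (lrect x u v a b)) ->
  t ^+ (a * b) <= F (idx s0).
Proof.
move=> us /allP s0s hu hv kl P.
suff -> : F (idx s0) = wilson beta (rect (pos x) k l a b) by exact: wilson_rect.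
apply: eq_wilson => N f fO; rewrite (rect_pos _ _ _ hu hv).
rewrite -(chi_norm fO P) chi_idx //.
  rewrite -map_comp; congr (chi R _ f); apply/eq_in_map => j /s0s js /=.
  by rewrite /theta_edge lab_static.
by apply/allP => j /s0s js; rewrite ltn_addr.
Qed.

Lemma lu2E (c y : int) l : (c, y, 0) + u2 *+ l = (c, y + l%:Z, 0).
Proof.
elim: l => [|l IH]; first by rewrite mulr0n !addr0.
rewrite mulrSr addrA IH -[LHS]/(c + 0, y + l%:Z + 1, 0 + 0).
by congr (_, _, _); lia.
Qed.

(** The long path is three sides of a rectangle hanging below [O] and [Q]. Its first side is walked
    downwards, against [lside], which explains the reversed index there. *)
Lemma chi_ear N (f : gauge_field m N) : f \in Omega1 m N ->
  chi R (map posE [seq (ear l, ear l.+1) | l <- iota 0 (2 * K).+1]) f =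
  chi R (map posE (lside (0, - K%:Z, 0) u2 K)) f *
  chi R (map posE (lside (0, - K%:Z, 0) u1 1)) f *
  chi R (map posE (lside (1, - K%:Z, 0) u2 K)) f.
Proof.
move=> fO; rewrite /chi !big_map.
have iE a : iota 0 a = index_iota 0 a by rewrite /index_iota subn0.
have E1 a : (a <= K)%N -> ear a = (0, - a%:Z, 0).
  by move=> aK; rewrite /ear; congr (_, _, _); lia.
have E2 a : (a <= K)%N -> ear (K.+1 + a) = (1, - K%:Z + a%:Z, 0).
  by move=> aK; rewrite /ear; congr (_, _, _); lia.
rewrite [in LHS]iE (@big_cat_nat _ _ _ K) //=; last by lia.
rewrite (@big_cat_nat _ _ _ K.+1 K) //=; last by lia.
rewrite mulrA big_nat1; congr (_ * _ * _).
- rewrite big_nat_rev [in RHS]iE; apply: eq_big_nat => l /andP[_ lK].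
  rewrite !lu2E add0n !E1; [|lia|lia].
  have -> : (- (K - l.+1)%:Z = - K%:Z + l.+1%:Z)%R by lia.
  have -> : (- (K - l.+1).+1%:Z = - K%:Z + l%:Z)%R by lia.
  by apply: spin_same fO _; rewrite /same eqxx orbT.
- rewrite big_cons big_nil mulr1; congr (spin R (posE (_, _)) f).
    by rewrite E1 // addr0.
  by rewrite -[K.+1]addn0 E2 // addr0.
rewrite -{1}[K.+1]add0n (_ : (2 * K).+1 = (K + K.+1)%N); last by lia.
rewrite big_addn addnK [in RHS]iE; apply: eq_big_nat => l /andP[_ lK].
by rewrite !lu2E addnC E2 ?(ltnW lK) // -addnS E2.
Qed.

Hypothesis s0 : (0 < s)%N.
Hypothesis st0 : st_ 0 = (O, Q).

(** Edge 0 joins [O] to [Q] and closes the long path to the boundary of a rectangle of area [K]. *)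
Definition ring_idx : seq nat := 0%N :: iota s (2 * K).+1.

Lemma uniq_ring : uniq ring_idx.
Proof. by rewrite cons_uniq iota_uniq mem_iota negb_and -ltnNge s0. Qed.

Lemma idx_ring : t ^+ K <= F (idx ring_idx).
Proof.
suff -> : F (idx ring_idx) = wilson beta (rect (pos (0, - K%:Z, 0)) i1 i2 1 K).
  by rewrite -{1}[K]mul1n; exact: wilson_rect.
apply: eq_wilson => N f fO; rewrite (rect_pos _ _ _ pos_u1 pos_u2).
rewrite chi_idx ?uniq_ring //; last first.
  apply/allP => k; rewrite inE mem_iota => /orP[/eqP ->|/andP[]//].
  by rewrite ltn_addr.
rewrite -[ring_idx]/([:: 0%N] ++ iota s (2 * K).+1) map_cat chi_cat.
rewrite (_ : map theta_edge (iota s (2 * K).+1) =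
  map posE [seq (ear l, ear l.+1) | l <- iota 0 (2 * K).+1]); last first.
  rewrite -[in LHS](addn0 s) iotaDl -!map_comp; apply: eq_map => l /=.
  by rewrite /theta_edge lab_ear.
rewrite chi_ear // /lrect !map_cat !chi_cat /= /theta_edge lab_static // st0.
have -> : ((0, - K%:Z, 0) : label) + u2 *+ K = O by rewrite lu2E addNr.
have -> : ((0, - K%:Z, 0) : label) + u1 *+ 1 = (1, - K%:Z, 0).
  by rewrite mulr1n; congr (_, _, _); rewrite ?addr0.
have -> : [:: posE (O, Q)] = map posE (lside O u1 1).
  by rewrite /= mulr0n mulr1n !add0r.
ring.
Qed.

Lemma disjoint_sum3 (T : finType) (A B C D : {set T}) : [disjoint A & B] ->
  [disjoint B & C] -> [disjoint C & A] ->
  (#|A :&: D| + #|B :&: D| + #|C :&: D| <= #|D|)%N.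
Proof.
move=> AB BC CA; have h1 := cardsUI (A :&: D) (B :&: D).
have h2 := cardsUI (A :&: D :|: B :&: D) (C :&: D).
have dj (X Y : {set T}) : [disjoint X & Y] -> (X :&: D) :&: (Y :&: D) = set0.
  by rewrite -setI_eq0 setIACA => /eqP ->; rewrite set0I.
rewrite dj // cards0 addn0 in h1.
rewrite setIUl !dj // ?setU0 ?cards0 ?addn0 in h2; last by rewrite disjoint_sym.
rewrite -h1 -h2; apply: subset_leq_card.
by rewrite !subUset !subsetIr.
Qed.

(** The site [O] has degree at most 2, which excludes two disjoint nonempty even sets; only the
    one-block term is left. *)
Lemma cycle_ursell : s = 1%N -> size rts = 1%N -> 0 < ursell_sum F.
Proof.
move=> s1 r1; have n0 : (0 < n)%N by rewrite ltn_addr.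
have RT : idx ring_idx = [set: 'I_n].
  apply/setP => i; rewrite in_set in_setT -[val i]/(nat_of_ord i).
  have := ltn_ord i; move: (nat_of_ord i) => k; rewrite /ring_idx inE mem_iota s1.
  by case: k => // k ->.
have FT : 0 < F [set: 'I_n].
  by rewrite -RT (lt_le_trans _ idx_ring) // exprn_gt0 // tnh_gt0.
have eT : even_set theta [set: 'I_n].
  by apply: (spin_mean_even beta0 theta_nn); rewrite lt0r_neq0.
rewrite ursell_sum_single // => B B0 BT; apply/eqP; apply: contraT => FB.
have eB := spin_mean_even beta0 theta_nn FB.
have B0' : ~: B != set0 by apply: contraNneq BT => E; rewrite -[B]setCK E setC0.
have h1 := theta_even_roots eB B0.
have h2 := theta_even_roots (even_setC eT eB) B0'.
have dB : [disjoint B & ~: B] by rewrite disjoints_subset setCK.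
have d0 (X : {set 'I_n}) : [disjoint set0 & X] by rewrite -setI_eq0 set0I.
have d0' : [disjoint ~: B & (set0 : {set 'I_n})] by rewrite disjoint_sym.
have := disjoint_sum3 [set k | inc (pos O) (theta k)] dB d0' (d0 B).
have := theta_roots_card; rewrite r1 set0I cards0 addn0 => h3 h4.
by have := leq_trans (leq_add h1 h2) (leq_trans h4 h3).
Qed.

(** Edges common to [A] and [B] occur twice in the concatenation and cancel. *)
Lemma spin_mean_sym A B : F A * F B <= F ((A :\: B) :|: (B :\: A)).
Proof.
have -> : F ((A :\: B) :|: (B :\: A)) = wilson beta (sel theta A ++ sel theta B).
  have dj (X Y : {set 'I_n}) : [disjoint X :&: Y & X :\: Y].
    rewrite disjoints_subset; apply/subsetP => x; rewrite !inE.
    by case/andP => _ ->.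
  apply: wilson_par => f; rewrite par_selU; last first.
    rewrite disjoints_subset; apply/subsetP => x; rewrite !inE.
    by case/andP => /negbTE ->; rewrite andbF.
  have eX X Y : par (sel theta X) f =
      par (sel theta (X :&: Y)) f (+) par (sel theta (X :\: Y)) f.
    by rewrite -par_selU ?dj // setID.
  rewrite par_cat (eX A B) (eX B A) [B :&: A]setIC.
  by case: (par _ f); case: (par _ f); case: (par _ f).
by apply: wilson_cat => //; apply: nn_sel; exact: theta_nn.
Qed.

(** The four paths are edge 0, edges 1 to 3, the other fixed edges, and the long path; [R1], [R3],
    [R2] close the last three with edge 0. The complement of [R1] is the symmetric difference of
    [R2] and [R3], and similarly for [R2], so both split products are at least [t ^ (1 + K + M)]. At
    most four edges at [O] exclude three disjoint nonempty even sets. *)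
Lemma theta_ursell M : (5 <= s)%N -> size rts = 3%N ->
  t <= F (idx [:: 0; 1; 2; 3]%N) -> t ^+ M <= F (idx (0%N :: iota 4 (s - 4))) ->
  2^-1 < t ^+ (1 + K + M) -> ursell_sum F < 0.
Proof.
move=> s5 r3 h1 h3 tK; have h2 := idx_ring.
have n0 : (0 < n)%N by rewrite ltn_addr.
set R1 := idx _ in h1; set R3 := idx _ in h3; set R2 := idx _ in h2.
have C1 : ~: R1 = (R2 :\: R3) :|: (R3 :\: R2).
  apply/setP => i; rewrite in_setC in_setU !in_setD !in_set -[val i]/(nat_of_ord i).
  have := ltn_ord i; move: (nat_of_ord i) s5 => k; rewrite /ring_idx !inE !mem_iota.
  by clear; move: (size st) => c; lia.
have C2 : ~: R2 = (R1 :\: R3) :|: (R3 :\: R1).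
  apply/setP => i; rewrite in_setC in_setU !in_setD !in_set -[val i]/(nat_of_ord i).
  have := ltn_ord i; move: (nat_of_ord i) s5 => k; rewrite /ring_idx !inE !mem_iota.
  by clear; move: (size st) => c; lia.
have k0 : (0 < n)%N by [].
have k1 : (1 < n)%N by move: s5; clear; lia.
have t0 : 0 <= t by rewrite ltW // tnh_gt0.
have tX0 k : 0 <= t ^+ k by exact: exprn_ge0.
have g1 : t * (t ^+ K * t ^+ M) <= F R1 * F (~: R1).
  rewrite C1; apply: ler_pM => //; first exact: mulr_ge0.
  by apply: le_trans (spin_mean_sym _ _); apply: ler_pM.
have g2 : t ^+ K * (t * t ^+ M) <= F R2 * F (~: R2).
  rewrite C2; apply: ler_pM => //; first exact: mulr_ge0.
  by apply: le_trans (spin_mean_sym _ _); apply: ler_pM.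
have tE : t ^+ (1 + K + M) = t * (t ^+ K * t ^+ M).
  by rewrite !exprD expr1 mulrA.
have i0R1 : Ordinal k0 \in R1 by rewrite inE.
have i0R2 : Ordinal k0 \in R2 by rewrite inE.
have i1R1 : Ordinal k1 \in R1 by rewrite inE.
have i1R2 : Ordinal k1 \notin R2.
  by rewrite inE inE mem_iota /= negb_and -ltnNge (ltn_trans _ s5).
have i4R1 : exists i, i \in ~: R1.
  have k4 : (4 < n)%N by move: s5; clear; lia.
  by exists (Ordinal k4); rewrite !inE.
apply: (@ursell_sum_lt0 _ _ _ n0 _ R1 R2).
- exact: spin_mean_ge0 theta_nn.
- move=> A B C A0 B0 C0 AB BC CA.
  move=> /(spin_mean_even beta0 theta_nn)/theta_even_roots/(_ A0) hA.
  move=> /(spin_mean_even beta0 theta_nn)/theta_even_roots/(_ B0) hB.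
  move=> /(spin_mean_even beta0 theta_nn)/theta_even_roots/(_ C0) hC.
  have := disjoint_sum3 [set k | inc (pos O) (theta k)] AB BC CA.
  have h4 := theta_roots_card; rewrite r3 in h4 => h5.
  by have := leq_trans (leq_add (leq_add hA hB) hC) (leq_trans h5 h4).
- exact: spin_mean_le1 theta_nn _.
- by apply/set0Pn; exists (Ordinal k0).
- by apply/set0Pn.
- by apply/set0Pn; exists (Ordinal k0).
- by apply/set0Pn; exists (Ordinal k1); rewrite in_setC.
- by apply: contraNneq i1R2 => <-.
- by apply: contraTneq i0R2 => E; rewrite -in_setC -E.
- by apply: lt_le_trans g1; rewrite -tE.
by apply: lt_le_trans g2; rewrite mulrCA -tE.
Qed.

End Position.
End Examples.

(** * Concrete configurations *)

Section Instances.
Notation label := (int * int * int)%type.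
Notation O := ((0, 0, 0) : label).
Notation Q := ((1, 0, 0) : label).
Variables (R : realType) (m : nat).

Lemma dir_mulz (i k : 'I_m) (z : int) : (dir i *~ z) ord0 k = (k == i)%:R * z.
Proof.
case: z => z.
  rewrite -pmulrn mulmxnE dirE -[_ *+ z]mulr_natr.
  by rewrite !natz.
by rewrite NegzE mulrNz -pmulrn mxE mulmxnE dirE -[_ *+ z.+1]mulr_natr !natz mulrN.
Qed.

Lemma lstep_cases (a1 a2 a3 b1 b2 b3 : int) :
  `|b1 - a1| + `|b2 - a2| + `|b3 - a3| == 1 ->
  [\/ [/\ b1 = a1 + 1, b2 = a2 & b3 = a3], [/\ a1 = b1 + 1, a2 = b2 & a3 = b3],
  [/\ b1 = a1, b2 = a2 + 1 & b3 = a3] |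
  [\/ [/\ a1 = b1, a2 = b2 + 1 & a3 = b3], [/\ b1 = a1, b2 = a2 & b3 = a3 + 1] |
      [/\ a1 = b1, a2 = b2 & a3 = b3 + 1] ]].
Proof.
move=> h; have [e1|e1] := eqVneq b1 a1; have [e2|e2] := eqVneq b2 a2.
- have [b3a|b3a] := leP a3 b3; last by apply: Or44; apply: Or33; split; lia.
  by apply: Or44; apply: Or32; split; lia.
- have [b2a|b2a] := leP a2 b2; first by apply: Or43; split; lia.
  by apply: Or44; apply: Or31; split; lia.
- have [b1a|b1a] := leP a1 b1; first by apply: Or41; split; lia.
  by apply: Or42; split; lia.
by move: h e1 e2; clear; lia.
Qed.

Lemma pos_nn (i1 i2 i3 : 'I_m) q : lstep q -> nn (posE i1 i2 i3 q).
Proof.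
have S1 x y z : pos i1 i2 i3 (x + 1, y, z) = pos i1 i2 i3 (x, y, z) + dir i1.
  rewrite -(pos_u1 i1 i2 i3) -posD; congr pos.
  by rewrite -[RHS]/(x + 1, y + 0, z + 0) !addr0.
have S2 x y z : pos i1 i2 i3 (x, y + 1, z) = pos i1 i2 i3 (x, y, z) + dir i2.
  rewrite -(pos_u2 i1 i2 i3) -posD; congr pos.
  by rewrite -[RHS]/(x + 0, y + 1, z + 0) !addr0.
have S3 x y z : pos i1 i2 i3 (x, y, z + 1) = pos i1 i2 i3 (x, y, z) + dir i3.
  rewrite -(pos_u3 i1 i2 i3) -posD; congr pos.
  by rewrite -[RHS]/(x + 0, y + 0, z + 1) !addr0.
case: q => [[[a1 a2] a3] [[b1 b2] b3]]; rewrite /lstep /posE /=.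
move/lstep_cases.
case=> [[-> -> ->]|[-> -> ->]|[-> -> ->]|[[-> -> ->]|[-> -> ->]|[-> -> ->]]];
  rewrite ?S1 ?S2 ?S3; first [exact: nn_hedge | rewrite nnC; exact: nn_hedge].
Qed.

Lemma pos_inj2 (i1 i2 : 'I_m) : i1 != i2 ->
  {in (fun x : label => x.2 == 0) &, injective (pos i1 i2 i1)}.
Proof.
move=> i12 [[a1 a2] a3] [[b1 b2] b3] /eqP /= -> /eqP /= -> /rowP h.
have := h i1; have := h i2; rewrite /pos /= !mulr0z !addr0 !mxE !dir_mulz !eqxx.
rewrite (negbTE i12) eq_sym (negbTE i12) !mul0r !mul1r !add0r !addr0.
by move=> -> ->.
Qed.

Lemma pos_inj3 (i1 i2 i3 : 'I_m) : i1 != i2 -> i1 != i3 -> i2 != i3 ->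
  {in xpredT &, injective (pos i1 i2 i3)}.
Proof.
move=> i12 i13 i23 [[a1 a2] a3] [[b1 b2] b3] _ _ /rowP h.
have := h i1; have := h i2; have := h i3.
rewrite /pos /= !mxE !dir_mulz !eqxx ![i2 == i1]eq_sym ![i3 == _]eq_sym.
rewrite (negbTE i12) (negbTE i13) (negbTE i23) !mul0r !mul1r !add0r !addr0.
by move=> -> -> ->.
Qed.

Definition cycle_st : seq (label * label) := [:: (O, Q)].

(** The edge [O Q] with paths of length 3 around it in two different planes. Together with the
    shortest long path, of 3 edges, this makes 10. *)
Definition space_st : seq (label * label) :=
  [:: (O, Q); (O, (0, 1, 0)); ((0, 1, 0), (1, 1, 0)); ((1, 1, 0), Q);
      (O, (0, 0, 1)); ((0, 0, 1), (1, 0, 1)); ((1, 0, 1), Q)].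

(* In the plane the fourth path from [O] to [Q] goes around the square above
   the edge [O Q] along the boundary of a 3 by 2 rectangle. *)
Definition plane_st : seq (label * label) :=
  [:: (O, Q); (O, (0, 1, 0)); ((0, 1, 0), (1, 1, 0)); ((1, 1, 0), Q);
      (O, (-1, 0, 0)); ((-1, 0, 0), (-1, 1, 0)); ((-1, 1, 0), (-1, 2, 0));
      ((-1, 2, 0), (0, 2, 0)); ((0, 2, 0), (1, 2, 0)); ((1, 2, 0), (2, 2, 0));
      ((2, 2, 0), (2, 1, 0)); ((2, 1, 0), (2, 0, 0)); ((2, 0, 0), Q)].

Variable beta : R.
Hypothesis beta0 : 0 < beta.

Lemma cycle_example (i1 i2 : 'I_m) K : i1 != i2 -> (0 < K)%N ->
  let e := @theta m i1 i2 i1 cycle_st K in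
  distinct_edges e /\ 0 < ursell_sum (spin_mean beta e).
Proof.
move=> i12 K0 e; have inj := pos_inj2 i12.
have good0 (x : label) : x.2 = 0 -> x.2 == 0 by move->.
split.
  apply: (theta_distinct i12 good0 inj
    (fun q h _ _ => pos_nn _ _ _ h) (rts := [:: 0%N])) => //.
by apply: (cycle_ursell i12 good0 inj
    (fun q h _ _ => pos_nn _ _ _ h) (rts := [:: 0%N])) => //.
Qed.

Lemma space_example (i1 i2 i3 : 'I_m) K : i1 != i2 -> i1 != i3 -> i2 != i3 ->
  (0 < K)%N -> 2^-1 < tnh beta ^+ (1 + K + 1) ->
  let e := @theta m i1 i2 i3 space_st K in
  distinct_edges e /\ ursell_sum (spin_mean beta e) < 0.
Proof.
move=> i12 i13 i23 K0 tK e; have inj := pos_inj3 i12 i13 i23.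
have good0 (x : label) : x.2 = 0 -> xpredT x by [].
split.
  apply: (theta_distinct i12 good0 inj
    (fun q h _ _ => pos_nn _ _ _ h) (rts := [:: 0; 1; 4]%N)) => //.
apply: (@theta_ursell m i1 i2 i3 R i12 _ good0 inj (fun q h _ _ => pos_nn _ _ _ h)
  space_st [:: 0; 1; 4]%N K K0 isT isT isT isT beta beta0 isT erefl 1) => //.
- have := @idx_static m i1 i2 i3 R space_st K beta beta0 [:: 0; 1; 2; 3]%N O
    (1, 0, 0) (0, 1, 0) i1 i2 1 1; rewrite expr1; apply=> //.
  + exact: pos_u1.
  + exact: pos_u2.
have := @idx_static m i1 i2 i3 R space_st K beta beta0 (0%N :: iota 4 3) O
  (1, 0, 0) (0, 0, 1) i1 i3 1 1; apply=> //.
- exact: pos_u1.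
exact: pos_u3.
Qed.

Lemma plane_example (i1 i2 : 'I_m) K : i1 != i2 ->
  (0 < K)%N -> 2^-1 < tnh beta ^+ (1 + K + 6) ->
  let e := @theta m i1 i2 i1 plane_st K in
  distinct_edges e /\ ursell_sum (spin_mean beta e) < 0.
Proof.
move=> i12 K0 tK e; have inj := pos_inj2 i12.
have good0 (x : label) : x.2 = 0 -> x.2 == 0 by move->.
split.
  apply: (theta_distinct i12 good0 inj
    (fun q h _ _ => pos_nn _ _ _ h) (rts := [:: 0; 1; 4]%N)) => //.
apply: (@theta_ursell m i1 i2 i1 R i12 _ good0 inj (fun q h _ _ => pos_nn _ _ _ h)
  plane_st [:: 0; 1; 4]%N K K0 isT isT isT isT beta beta0 isT erefl 6) => //.
- have := @idx_static m i1 i2 i1 R plane_st K beta beta0 [:: 0; 1; 2; 3]%N O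
    (1, 0, 0) (0, 1, 0) i1 i2 1 1; rewrite expr1; apply=> //.
  + exact: pos_u1.
  + exact: pos_u2.
have := @idx_static m i1 i2 i1 R plane_st K beta beta0 (0%N :: iota 4 9) (-1, 0, 0)
  (1, 0, 0) (0, 1, 0) i1 i2 3 2; apply=> //.
- exact: pos_u1.
exact: pos_u2.
Qed.

End Instances.

(** * The parameter [tnh] at low temperature *)

Section LowTemperature.
Variable R : realType.

(** Bernoulli gives [t ^ k >= 1 - k (1 - t)]. With [a = exp (2 beta)] one has
    [1 - t = 2 / (a ^ 2 + 1)], and [a ^ 2 >= 1 + 4 beta] exceeds [4 k]. *)
Lemma tnh_pow_large k (beta : R) : k%:R <= beta -> 0 < beta ->
  2^-1 < tnh beta ^+ k.
Proof.
move=> kb b0; have t01 := tnh01 b0; set t := tnh beta in t01 *.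
have bern : 1 - k%:R * (1 - t) <= t ^+ k.
  elim: k {kb} => [|k IH]; first by rewrite mul0r subr0 expr0.
  have /andP[t0 t1] := t01.
  have h1 : t * (1 - k%:R * (1 - t)) <= t * t ^+ k by rewrite ler_wpM2l.
  have h2 : 0 <= k%:R * ((1 - t) * (1 - t)).
    by rewrite !mulr_ge0 ?subr_ge0 ?ler0n.
  by rewrite exprS -natr1; move: h1 h2; clear; lra.
apply: lt_le_trans bern.
have a0 := expR_gt0 (2 * beta); have c0 := expR_gt0 (- (2 * beta)).
have ac : expR (2 * beta) * expR (- (2 * beta)) = 1 by rewrite -expRD subrr expR0.
have aa : 1 + 4 * beta <= expR (2 * beta) * expR (2 * beta).
  by rewrite -expRD; apply: le_trans (expR_ge1Dx _); lra.
move: a0 c0 ac aa; rewrite /t /tnh.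
move: (expR (2 * beta)) (expR (- (2 * beta))) => a c a0 c0 ac aa.
have -> : 1 - (a - c) / (a + c) = 2 * c / (a + c) by field; rewrite lt0r_neq0 ?addr_gt0.
have ac0 : 0 < a + c by rewrite addr_gt0.
suff : k%:R * (2 * c / (a + c)) < 2^-1 by lra.
rewrite mulrA ltr_pdivrMr //.
have k0 : 0 <= k%:R :> R by exact: ler0n.
have : 4 * k%:R < a * a by lra.
move=> h; have : 4 * k%:R * c < a * a * c by rewrite ltr_pM2r.
have -> : a * a * c = a by rewrite -mulrA ac mulr1.
by move: c0; clear; lra.
Qed.

End LowTemperature.

Theorem theorem1p1 (R : realType) (m : nat) (hm : (2 <= m)%N) :
  (forall (beta : R) (n : nat), 0 < beta -> (0 < n)%N ->
     exists e : 'I_n -> site m * site m,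
       distinct_edges e /\ ursell_spins beta e = 0) /\
  (forall (beta : R) (n : nat), 0 < beta ->
     (odd n -> forall e : 'I_n -> site m * site m,
        edges e -> ursell_spins beta e = 0) /\
     (n = 2%N -> forall e : 'I_n -> site m * site m,
        distinct_edges e -> ursell_spins beta e = 0)) /\
  (forall (beta : R) (n : nat), 0 < beta -> (4 <= n)%N -> ~~ odd n ->
     exists e : 'I_n -> site m * site m,
       distinct_edges e /\ 0 < ursell_spins beta e) /\
  ((3 <= m)%N ->
     (forall n : nat, (10 <= n)%N -> ~~ odd n ->
        exists beta0 : R, forall beta : R, 0 < beta -> beta0 <= beta ->
          exists e : 'I_n -> site m * site m,
            distinct_edges e /\ ursell_spins beta e < 0) /\
     (forall (beta : R) (n : nat) (e : 'I_n -> site m * site m),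
        0 < beta -> (0 < n)%N -> distinct_edges e ->
        ursell_spins beta e < 0 -> (10 <= n)%N)) /\
  (m = 2%N ->
     (forall n : nat, (16 <= n)%N -> ~~ odd n ->
        exists beta0 : R, forall beta : R, 0 < beta -> beta0 <= beta ->
          exists e : 'I_n -> site m * site m,
            distinct_edges e /\ ursell_spins beta e < 0) /\
     (forall (beta : R) (n : nat) (e : 'I_n -> site m * site m),
        0 < beta -> (0 < n)%N -> distinct_edges e ->
        ursell_spins beta e < 0 -> (16 <= n)%N)).
Proof.
have spinsE n (beta : R) (e : 'I_n -> site m * site m) :
    ursell_spins beta e = ursell_sum (spin_mean beta e) by exact: ursell_spinsE.
pose i1 : 'I_m := Ordinal (ltnW hm); pose i2 : 'I_m := Ordinal hm.
have i12 : i1 != i2 by [].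
(* Here [c] is the number of fixed edges, namely 1, 7 or 13; the shortest long path, [K = 1], gives
   the totals 4, 10 and 16. *)
have halves c n : (c + 3 <= n)%N -> odd n = ~~ odd c -> exists2 K, (0 < K)%N &
    n = (c + (2 * K).+1)%N.
  by move=> cn on; exists ((n - c.+1)./2); lia.
split; last split; last split; last split.
- move=> beta n b0 n0; have [hd he] := line_edges n i1.
  exists (fun k : 'I_n => hedge (dir i1 *+ k) i1); split=> //.
  rewrite spinsE; apply: ursell_sum_eq0 => // B B0; apply/eqP.
  apply: contraT => FB; case/eqP: B0; apply: he.
  by apply: (spin_mean_even b0 hd.1 FB).
- move=> beta n b0; split=> [on e he|n2 e hd].
    rewrite spinsE; apply: (ursell_odd_cover b0 he) => hT.
    by have := even_card he hT; rewrite cardsT card_ord on.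
  subst n; rewrite spinsE; apply: ursell_sum_eq0 => // B B0; apply/eqP.
  apply: contraT => FB; have := even_card_ge4 hd.1 hd (spin_mean_even b0 hd.1 FB) B0.
  by have := max_card (mem B); rewrite card_ord => h /leq_trans/(_ h).
- move=> beta n b0 n4 en; have [|K K0 ->] := halves 1%N n n4.
    by rewrite (negbTE en).
  have [hd pos] := cycle_example b0 i12 K0.
  by exists (theta i1 i2 i1 (st := cycle_st) (K := K)); rewrite spinsE.
- move=> m3; pose i3 : 'I_m := Ordinal m3; split.
    move=> n n10 en; have [|K K0 ->] := halves 7%N n n10.
      by rewrite (negbTE en).
    (* The exponent in [space_example], the total area of the three rectangles, also serves as the
       threshold for [beta]. *)
    exists (1 + K + 1)%:R => beta b0 hb.
    have i13 : i1 != i3 by []. have i23 : i2 != i3 by [].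
    have [hd neg] := space_example b0 i12 i13 i23 K0 (tnh_pow_large hb b0).
    by exists (theta i1 i2 i3 (st := space_st) (K := K)); rewrite spinsE.
  move=> beta n e b0 n0 hd; rewrite spinsE => neg; rewrite leqNgt; apply/negP => n9.
  by move: neg; rewrite ltNge (ursell_small_ge0 b0 hd.1 hd n0).
move=> m2; split.
  move=> n n16 en; have [|K K0 ->] := halves 13%N n n16.
    by rewrite (negbTE en).
  exists (1 + K + 6)%:R => beta b0 hb.
  have [hd neg] := plane_example b0 i12 K0 (tnh_pow_large hb b0).
  by exists (theta i1 i2 i1 (st := plane_st) (K := K)); rewrite spinsE.
clear i1 i2 i12; subst m => beta n e b0 n0 hd; rewrite spinsE => neg.
rewrite leqNgt; apply/negP => n15.
by move: neg; rewrite ltNge (ursell_planar_ge0 b0 n0).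
Qed.
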